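(* Let $n\ge2$ and let $\mathbf Y\sim GSLo_n(\boldsymbol\mu,\mathbf\Sigma,\boldsymbol\gamma,J)$, i.e. $\mathbf Y$ has density $$f_{\mathbf Y}(\boldsymbol y)=\frac{2c_n}{\sqrt{|\mathbf\Sigma|}}\,g_n\!\left\{\tfrac12(\boldsymbol y-\boldsymbol\mu)^T\mathbf\Sigma^{-1}(\boldsymbol y-\boldsymbol\mu)\right\}J\!\left(\boldsymbol\gamma^T\mathbf\Sigma^{-1/2}(\boldsymbol y-\boldsymbol\mu)\right),\quad g_n(u)=\frac{e^{-u}}{(1+e^{-u})^2},\quad c_n=\frac1{(2\pi)^{n/2}\Psi_2^*(-1,\frac n2,1)},$$ where $\boldsymbol\gamma=(\gamma_1,\dots,\gamma_n)^T\in\mathbb R^n$ and $J:\mathbb R\to\mathbb R$ is a twice differentiable skewing function. Let $\boldsymbol a<\boldsymbol b$ in $\mathbb R^n$ (componentwise) and $F:=F_{\mathbf Z}(\boldsymbol\xi_{\boldsymbol a},\boldsymbol\xi_{\boldsymbol b})$. Then $$\mathrm E[\mathbf Y\mid\boldsymbol a<\mathbf Y\le\boldsymbol b]=\boldsymbol\mu+\frac{\mathbf\Sigma^{1/2}\boldsymbol\delta}{F},$$ $$\mathrm E[\mathbf Y\mathbf Y^T\mid\boldsymbol a<\mathbf Y\le\boldsymbol b]=\boldsymbol\mu\boldsymbol\mu^T+\frac{\mathbf\Sigma^{1/2}\boldsymbol\delta\boldsymbol\mu^T}{F}+\frac{\boldsymbol\mu\boldsymbol\delta^T\mathbf\Sigma^{1/2}}{F}+\frac{\mathbf\Sigma^{1/2}\mathbf\Omega\mathbf\Sigma^{1/2}}{F},$$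 $$\mathrm{MDTCov}_{(\boldsymbol a,\boldsymbol b)}(\mathbf Y)=\mathbf\Sigma^{1/2}\left[\frac{\mathbf\Omega}{F}-\frac{\boldsymbol\delta\boldsymbol\delta^T}{F^2}\right]\mathbf\Sigma^{1/2},$$ where, for $i,j,k\in\{1,\dots,n\}$, $$\delta_k=2\Big\{\tfrac{c_n}{c^*_{a,k}}E^*_{a,k}[J_\gamma]-\tfrac{c_n}{c^*_{b,k}}E^*_{b,k}[J_\gamma]+\tfrac{\Psi_1^*(-1,\frac n2,1)\gamma_k}{\Psi_2^*(-1,\frac n2,1)}E^*[J'_\gamma]\Big\},$$ for $i\ne j$, $$\begin{aligned}\Omega_{ij}=2\Big\{&\tfrac{c_n}{c^{**}_{a,i;a,j}}E^{**}_{a,i;a,j}[J_\gamma]-\tfrac{c_n}{c^{**}_{a,i;b,j}}E^{**}_{a,i;b,j}[J_\gamma]+\tfrac{c_n\gamma_j}{c^{**}_{a,i}}E^{**}_{a,i}[J'_\gamma]\\&+\tfrac{c_n}{c^{**}_{b,i;b,j}}E^{**}_{b,i;b,j}[J_\gamma]-\tfrac{c_n}{c^{**}_{b,i;a,j}}E^{**}_{b,i;a,j}[J_\gamma]-\tfrac{c_n\gamma_j}{c^{**}_{b,i}}E^{**}_{b,i}[J'_\gamma]\\&+\tfrac{c_n\gamma_i}{c^{**}_{a,j}}E^{**}_{a,j}[J'_\gamma]-\tfrac{c_n\gamma_i}{c^{**}_{b,j}}E^{**}_{b,j}[J'_\gamma]+\tfrac{\Psi_1^*(-1,\frac n2+1,1)\gamma_i\gamma_j}{\Psi_2^*(-1,\frac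 n2,1)}E^{**}[J''_\gamma]\Big\},\end{aligned}$$ and $$\begin{aligned}\Omega_{ii}=2\Big\{&\tfrac{c_n\xi_{\boldsymbol a,i}}{c^*_{a,i}}E^*_{a,i}[J_\gamma]-\tfrac{c_n\xi_{\boldsymbol b,i}}{c^*_{b,i}}E^*_{b,i}[J_\gamma]+\tfrac{c_n\gamma_i}{c^{**}_{a,i}}E^{**}_{a,i}[J'_\gamma]-\tfrac{c_n\gamma_i}{c^{**}_{b,i}}E^{**}_{b,i}[J'_\gamma]\\&+\tfrac{\Psi_1^*(-1,\frac n2+1,1)\gamma_i^2}{\Psi_2^*(-1,\frac n2,1)}E^{**}[J''_\gamma]\Big\}+\tfrac{\Psi_1^*(-1,\frac n2,1)}{\Psi_2^*(-1,\frac n2,1)}F_{\mathbf Z^*}(\boldsymbol\xi_{\boldsymbol a},\boldsymbol\xi_{\boldsymbol b}).\end{aligned}$$ Moreover, for $s,t\in\{a,b\}$ and $k\ne l$, $$\frac{c_n}{c^*_{s,k}}=\frac{\Psi_1^*\!\left(-e^{-\xi_{\boldsymbol s,k}^2/2},\frac{n-1}2,1\right)\phi(\xi_{\boldsymbol s,k})}{\Psi_2^*(-1,\frac n2,1)},\qquad\frac{c_n}{c^{**}_{s,k}}=\frac{\int_0^\infty x^{(n-3)/2}\ln\!\left[1+e^{-\xi_{\boldsymbol s,k}^2/2}e^{-x}\right]dx}{\Gamma(\frac{n-1}2)\sqrt{2\pi}\,\Psi_2^*(-1,\frac n2,1)},$$ $$\frac{c_n}{c^{**}_{s,k;t,l}}=\frac{\int_0^\infty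 x^{(n-4)/2}\ln\!\left[1+e^{-\xi_{\boldsymbol s,k}^2/2-\xi_{\boldsymbol t,l}^2/2}e^{-x}\right]dx}{2\,\Gamma(\frac{n-2}2)\,\pi\,\Psi_2^*(-1,\frac n2,1)}\quad(n\ge3\text{ in this last formula}).$$
   Context: $\boldsymbol\mu\in\mathbb R^n$ is fixed, $\mathbf\Sigma$ is a fixed positive definite matrix with symmetric positive definite square root $\mathbf\Sigma^{1/2}$. Skewing function: $0\le J\le1$ and $J(-t)=1-J(t)$. $J_\gamma(\boldsymbol z)=J(\boldsymbol\gamma^T\boldsymbol z)$, $J'_\gamma(\boldsymbol z)=J'(\boldsymbol\gamma^T\boldsymbol z)$, $J''_\gamma(\boldsymbol z)=J''(\boldsymbol\gamma^T\boldsymbol z)$. $\phi$ is the univariate standard normal density. $\Psi^*_\mu(z,s,a)$ is the generalized Hurwitz–Lerch zeta function, $\Psi^*_\mu(z,s,a)=\frac1{\Gamma(s)}\int_0^\infty\frac{t^{s-1}e^{-at}}{(1-ze^{-t})^\mu}dt$. Generators: $\overline G_n(t)=\frac{e^{-t}}{1+e^{-t}}$, $\overline{\mathcal G}_n(t)=\ln(1+e^{-t})$, with $c_n^*=\frac1{(2\pi)^{n/2}\Psi_1^*(-1,\frac n2,1)}$ and $c_n^{**}=\frac1{(2\pi)^{n/2}\Psi_1^*(-1,\frac n2+1,1)}$ the constants making $c_n^*\overline G_n(\frac12\boldsymbol z^T\boldsymbol z)$ and $c_n^{**}\overline{\mathcal G}_n(\frac12\boldsymbol z^T\boldsymbol z)$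 probability densities on $\mathbb R^n$. $\boldsymbol\xi_{\boldsymbol v}=(\xi_{\boldsymbol v,1},\dots,\xi_{\boldsymbol v,n})^T=\mathbf\Sigma^{-1/2}(\boldsymbol v-\boldsymbol\mu)$ for $\boldsymbol v\in\{\boldsymbol a,\boldsymbol b\}$. $F_{\mathbf W}(\boldsymbol t,\boldsymbol v)=\Pr(\boldsymbol t<\mathbf W\le\boldsymbol v)$ (componentwise). $\mathbf Z\sim GSLo_n(\boldsymbol0,\mathbf I_n,\boldsymbol\gamma,J)$; $\mathbf Z^*$ has density $2c_n^*\overline G_n(\frac12\boldsymbol z^T\boldsymbol z)J(\boldsymbol\gamma^T\boldsymbol z)$. $\boldsymbol\delta=(\delta_1,\dots,\delta_n)^T$, $\mathbf\Omega=(\Omega_{ij})_{i,j=1}^n$. $\boldsymbol v_{-k}$ (resp. $\boldsymbol v_{-kl}$) is $\boldsymbol v$ with its $k$-th (resp. $k$-th and $l$-th) component deleted. For $s,t\in\{a,b\}$, $k\ne l$, the constants $c^*_{s,k}$, $c^{**}_{s,k}$, $c^{**}_{s,k;t,l}$ are the normalizing constants of the densities $$f^*_{s,k}(\boldsymbol w)=c^*_{s,k}\overline G_n(\tfrac12\boldsymbol w^T\boldsymbol w+\tfrac12\xi_{\boldsymbol s,k}^2),\quad f^{**}_{s,k}(\boldsymbol w)=c^{**}_{s,k}\overline{\mathcal G}_n(\tfrac12\boldsymbol w^T\boldsymbol w+\tfrac12\xi_{\boldsymbol s,k}^2)\quad(\boldsymbol w\in\mathbb R^{n-1}),$$ $$f^{**}_{s,k;t,l}(\boldsymbol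 u)=c^{**}_{s,k;t,l}\overline{\mathcal G}_n(\tfrac12\boldsymbol u^T\boldsymbol u+\tfrac12\xi_{\boldsymbol s,k}^2+\tfrac12\xi_{\boldsymbol t,l}^2)\quad(\boldsymbol u\in\mathbb R^{n-2}).$$ For $h:\mathbb R^n\to\mathbb R$: $E^*[h]=\int_{\boldsymbol\xi_{\boldsymbol a}}^{\boldsymbol\xi_{\boldsymbol b}}h(\boldsymbol z)c_n^*\overline G_n(\frac12\boldsymbol z^T\boldsymbol z)d\boldsymbol z$; $E^{**}[h]=\int_{\boldsymbol\xi_{\boldsymbol a}}^{\boldsymbol\xi_{\boldsymbol b}}h(\boldsymbol z)c_n^{**}\overline{\mathcal G}_n(\frac12\boldsymbol z^T\boldsymbol z)d\boldsymbol z$; $E^*_{s,k}[h]$ (resp. $E^{**}_{s,k}[h]$) is $\int_{\boldsymbol\xi_{\boldsymbol a,-k}}^{\boldsymbol\xi_{\boldsymbol b,-k}}h(\boldsymbol z)f(\boldsymbol z_{-k})d\boldsymbol z_{-k}$ with $z_k=\xi_{\boldsymbol s,k}$ and $f=f^*_{s,k}$ (resp. $f^{**}_{s,k}$); $E^{**}_{s,k;t,l}[h]=\int_{\boldsymbol\xi_{\boldsymbol a,-kl}}^{\boldsymbol\xi_{\boldsymbol b,-kl}}h(\boldsymbol z)f^{**}_{s,k;t,l}(\boldsymbol z_{-kl})d\boldsymbol z_{-kl}$ with $z_k=\xi_{\boldsymbol s,k}$, $z_l=\xi_{\boldsymbol t,l}$. For $n=2$: $c^{**}_{s,k;t,l}=1/\overline{\mathcal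 G}_2(\frac12\xi_{\boldsymbol s,k}^2+\frac12\xi_{\boldsymbol t,l}^2)$ and $E^{**}_{s,k;t,l}[h]=h(\boldsymbol z)$ at that point. $\mathrm{MDTCov}_{(\boldsymbol a,\boldsymbol b)}(\mathbf Y)=\mathrm E[(\mathbf Y-\boldsymbol m)(\mathbf Y-\boldsymbol m)^T\mid\boldsymbol a<\mathbf Y\le\boldsymbol b]$ with $\boldsymbol m=\mathrm E[\mathbf Y\mid\boldsymbol a<\mathbf Y\le\boldsymbol b]$.
   Formalization: As stated false for non-diagonal Σ: the event a<Y≤b is read as ξ_a<Σ^{-1/2}(Y−μ)≤ξ_b (literal event kept when Σ is diagonal); the event is assumed to have positive probability and, for the two Ω-formulas, J''_γ to be integrable on the box. *)

(* Defs.v *)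
From HB Require Import structures.
From mathcomp Require Import all_boot all_order all_algebra.
From mathcomp Require Import all_classical all_reals all_analysis.

Set Implicit Arguments.
Unset Strict Implicit.
Unset Printing Implicit Defensive.

Import Order.TTheory GRing.Theory Num.Theory.
Import numFieldNormedType.Exports.

Local Open Scope classical_set_scope.
Local Open Scope ring_scope.

(* R^n, with the product (Borel) sigma-algebra provided for tuples.  Linear
   algebra is done on column vectors, through [colv]. *)
Notation Rn R n := (n.-tuple (measurableTypeR R)).

Section lebesgue_step.
Context {R : realType} {n : nat}.
Variable m : {sigma_finite_measure set (Rn R n) -> \bar R}.

Definition cons_pair (p : measurableTypeR R * Rn R n) : Rn R n.+1 :=
  [the n.+1.-tuple _ of p.1 :: p.2].

Lemma measurable_cons_pair : measurable_fun setT cons_pair.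
Proof.
apply: measurable_cons; [exact: measurable_fst|exact: measurable_snd].
Qed.

Definition leb_step : set (Rn R n.+1) -> \bar R :=
  pushforward (lebesgue_measure \x m)%E cons_pair.

Let leb_step0 : leb_step set0 = 0%E.
Proof. by rewrite /leb_step /pushforward preimage_set0 measure0. Qed.

Let leb_step_ge0 A : (0 <= leb_step A)%E.
Proof. by rewrite /leb_step /pushforward measure_ge0. Qed.

Let leb_step_sigma_additive : semi_sigma_additive leb_step.
Proof.
move=> F mF tF mUF; rewrite /leb_step /pushforward preimage_bigcup.
apply: measure_semi_sigma_additive.
- by move=> i; rewrite -[X in measurable X]setTI; exact: measurable_cons_pair.
- apply/trivIsetP => /= i j _ _ ij; rewrite -preimage_setI.
  by move/trivIsetP : tF => /(_ _ _ _ _ ij) ->//; rewrite preimage_set0.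
- rewrite -preimage_bigcup -[X in measurable X]setTI.
  exact: measurable_cons_pair.
Qed.

HB.instance Definition _ := isMeasure.Build _ _ _ leb_step
  leb_step0 leb_step_ge0 leb_step_sigma_additive.

Let leb_step_sigma_finite : sigma_finite setT leb_step.
Proof.
have /sigma_finiteP[F [FT Fnd Foo]] :=
  sigma_finiteT (@lebesgue_measure R).
have /sigma_finiteP[G [GT Gnd Goo]] := sigma_finiteT m.
exists (fun k => [set w | F k (thead w) /\ G k [tuple of behead w]]).
  apply/esym; rewrite -subTset => w _.
  have [i _ Fi] : (\bigcup_i F i) (thead w) by rewrite -FT.
  have [j _ Gj] : (\bigcup_i G i) [tuple of behead w] by rewrite -GT.
  exists (maxn i j) => //; split.
    by move: Fi; apply/subsetPset/Fnd; exact: leq_maxl.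
  by move: Gj; apply/subsetPset/Gnd; exact: leq_maxr.
move=> k; have [mF Fk] := Foo k; have [mG Gk] := Goo k; split.
  apply: measurableI.
    have := measurable_tnth (ord0 : 'I_n.+1) measurableT mF.
    by rewrite setTI.
  have := @measurable_behead _ (measurableTypeR R) n measurableT _ mG.
  by rewrite setTI.
rewrite /leb_step /pushforward.
rewrite [X in (_ \x _)%E X](_ : _ = F k `*` G k).
  by rewrite product_measure1E// lte_mul_pinfty// ge0_fin_numE.
apply/seteqP; split=> -[x y]/= [Fx Gy]; split.
- by move: Fx; rewrite theadE.
- by move: Gy; congr (G k _); exact: val_inj.
- by rewrite theadE.
- by move: Gy; congr (G k _); exact: val_inj.
Qed.

HB.instance Definition _ := @Measure_isSigmaFinite.Build _ _ _
  leb_step leb_step_sigma_finite.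

End lebesgue_step.

(* Lebesgue measure on R^n: the n-fold product of [lebesgue_measure].  On R^0
   it is the unit point mass, so integrating there is evaluating. *)
Fixpoint lebesgue_Rn (R : realType) (n : nat) :
    {sigma_finite_measure set (Rn R n) -> \bar R} :=
  match n with
  | 0 => \d_([tuple] : Rn R 0)
  | n'.+1 => leb_step (lebesgue_Rn R n')
  end.

Section vectors.
Context {R : realType}.

Definition colv {d} (w : Rn R d) : 'cV[R]_d := \col_i tnth w i.

Definition dot d (u v : 'cV[R]_d) : R := (u^T *m v) 0 0.

Definition posdef d (M : 'M[R]_d) : Prop :=
  M^T = M /\ forall x : 'cV[R]_d, x != 0 -> 0 < dot x (M *m x).

Definition box d (u v : 'cV[R]_d) : set 'cV[R]_d :=
  [set z | forall i, u i 0 < z i 0 <= v i 0].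

(* [ins1 k x w] is the vector z with z_k = x and z_{-k} = w; [ins2 k l x y w],
   for k <> l, is the vector z with z_k = x, z_l = y and z_{-kl} = w: the
   index of z_i among the remaining coordinates is i minus the number of
   deleted indices below i. *)
Definition ins1 n (k : 'I_n) (x : R) (w : Rn R n.-1) : 'cV[R]_n :=
  \col_i (if i == k then x else w`_(i - (k < i))).

Definition ins2 n (k l : 'I_n) (x y : R) (w : Rn R n.-2) : 'cV[R]_n :=
  \col_i (if i == k then x else if i == l then y
          else w`_(i - (k < i) - (l < i))).

(* The boxes ]u_{-k}, v_{-k}] and ]u_{-kl}, v_{-kl}]; the inserted values are
   irrelevant. *)
Definition box1 n (u v : 'cV[R]_n) (k : 'I_n) : set (Rn R n.-1) :=
  [set w | forall i, i != k -> u i 0 < ins1 k 0 w i 0 <= v i 0].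

Definition box2 n (u v : 'cV[R]_n) (k l : 'I_n) : set (Rn R n.-2) :=
  [set w | forall i, i != k -> i != l ->
     u i 0 < ins2 k l 0 0 w i 0 <= v i 0].

End vectors.

Section special_functions.
Context {R : realType}.
Implicit Types mu z s a t : R.

Definition Gamma s : R :=
  \int[@lebesgue_measure R]_(t in `]0, +oo[) (t `^ (s - 1) * expR (- t)).

(* Generalized Hurwitz-Lerch zeta function. *)
Definition HLzeta mu z s a : R :=
  (Gamma s)^-1 *
  \int[@lebesgue_measure R]_(t in `]0, +oo[)
    (t `^ (s - 1) * expR (- a * t) / (1 - z * expR (- t)) `^ mu).

Definition g t : R := expR (- t) / (1 + expR (- t)) ^+ 2.
Definition Gbar t : R := expR (- t) / (1 + expR (- t)).
Definition GGbar t : R := ln (1 + expR (- t)).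

Definition phi t : R := normal_pdf 0 1 t.

Definition c_ (n : nat) : R :=
  ((2 * pi) `^ (n%:R / 2) * HLzeta 2 (-1) (n%:R / 2) 1)^-1.
Definition cs_ (n : nat) : R :=
  ((2 * pi) `^ (n%:R / 2) * HLzeta 1 (-1) (n%:R / 2) 1)^-1.
Definition css_ (n : nat) : R :=
  ((2 * pi) `^ (n%:R / 2) * HLzeta 1 (-1) (n%:R / 2 + 1) 1)^-1.

(* Normalizing constants of the face densities, as functions of
   x = xi_{s,k} and y = xi_{t,l}. *)
Definition cs1 (n : nat) (x : R) : R :=
  (\int[lebesgue_Rn R n.-1]_w
     Gbar (dot (colv w) (colv w) / 2 + x ^+ 2 / 2))^-1.
Definition css1 (n : nat) (x : R) : R :=
  (\int[lebesgue_Rn R n.-1]_w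
     GGbar (dot (colv w) (colv w) / 2 + x ^+ 2 / 2))^-1.
Definition css2 (n : nat) (x y : R) : R :=
  (\int[lebesgue_Rn R n.-2]_w
     GGbar (dot (colv w) (colv w) / 2 + x ^+ 2 / 2 + y ^+ 2 / 2))^-1.

End special_functions.

(* [u] and [v] stand for xi_a and xi_b. *)
Section truncated_integrals.
Context {R : realType} {n : nat}.
Variables u v : 'cV[R]_n.
Implicit Types (h : 'cV[R]_n -> R) (k l : 'I_n) (x y : R).

Definition Es h : R :=
  \int[lebesgue_Rn R n]_(w in colv @^-1` box u v)
    (h (colv w) * (cs_ n * Gbar (dot (colv w) (colv w) / 2))).

Definition Ess h : R :=
  \int[lebesgue_Rn R n]_(w in colv @^-1` box u v)
    (h (colv w) * (css_ n * GGbar (dot (colv w) (colv w) / 2))).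

Definition Es1 k x h : R :=
  \int[lebesgue_Rn R n.-1]_(w in box1 u v k)
    (h (ins1 k x w) *
     (cs1 n x * Gbar (dot (colv w) (colv w) / 2 + x ^+ 2 / 2))).

Definition Ess1 k x h : R :=
  \int[lebesgue_Rn R n.-1]_(w in box1 u v k)
    (h (ins1 k x w) *
     (css1 n x * GGbar (dot (colv w) (colv w) / 2 + x ^+ 2 / 2))).

Definition Ess2 k x l y h : R :=
  \int[lebesgue_Rn R n.-2]_(w in box2 u v k l)
    (h (ins2 k l x y w) *
     (css2 n x y *
      GGbar (dot (colv w) (colv w) / 2 + x ^+ 2 / 2 + y ^+ 2 / 2))).

End truncated_integrals.

Section distributions.
Context {R : realType} {n : nat}.

Definition has_density d (T : measurableType d) (P : probability T R)
    (X : {RV P >-> Rn R n}) (f : 'cV[R]_n -> R) : Prop :=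
  forall A : set (Rn R n), measurable A ->
    P (X @^-1` A) = (\int[lebesgue_Rn R n]_(w in A) (f (colv w))%:E)%E.

Definition skewing (J : R -> R) : Prop :=
  (forall t, 0 <= J t <= 1) /\ (forall t, J (- t) = 1 - J t).

Definition twice_differentiable (J : R -> R) : Prop :=
  (forall t, derivable J t 1) /\ (forall t, derivable (derive1 J) t 1).

(* [S] is the symmetric positive definite square root of [Sigma]. *)
Definition gslo_pdf (mu : 'cV[R]_n) (Sigma S : 'M[R]_n) (gamma : 'cV[R]_n)
    (J : R -> R) (y : 'cV[R]_n) : R :=
  2 * c_ n / Num.sqrt (\det Sigma)
  * g (dot (y - mu) (invmx Sigma *m (y - mu)) / 2)
  * J (dot gamma (invmx S *m (y - mu))).

Definition gslo_star_pdf (gamma : 'cV[R]_n) (J : R -> R) (z : 'cV[R]_n) : R :=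
  2 * cs_ n * Gbar (dot z z / 2) * J (dot gamma z).

Definition rect_prob d (T : measurableType d) (P : probability T R)
    (W : {RV P >-> Rn R n}) (t v : 'cV[R]_n) : R :=
  fine (P [set w | box t v (colv (W w))]).

End distributions.

(* Entrywise conditional expectation given an event of positive probability. *)
Definition cexp {R : realType} d (T : measurableType d) (P : probability T R)
    (D : set T) p q (X : T -> 'M[R]_(p, q)) : 'M[R]_(p, q) :=
  \matrix_(i, j) ((\int[P]_(w in D) X w i j) / fine (P D)).

(* Main.v *)
Require Import Defs.
From HB Require Import structures.
From mathcomp Require Import all_boot all_order all_algebra.
From mathcomp Require Import all_classical all_reals all_analysis.
From mathcomp Require Import measurable_realfun ring lra.

(** Put W = S^-1 (Y - mu).  The substitution y = S z + mu
    ([lebesgue_Rn_posdef], [standardized_density]) shows that W has density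
    2 c_n g(|z|^2/2) J(gamma . z), and truncating Y means truncating W to the
    box B with corners u = xi a and v = xi b.  Since Y = S W + mu, the three
    formulas for Y are linear algebra ([cexp_affine], [cexp_affine2],
    [cexp_affine_cov]) once E[W | W in B] = delta / F and
    E[W W^T | W in B] = Omega / F are known.

    These two moments come from integration by parts.  The generators form a
    chain GGbar' = - Gbar, Gbar' = - g, so that z_k g(|z|^2/2) is minus the
    derivative of Gbar(|z|^2/2) in z_k.  Integrating by parts in z_k removes
    the factor z_k and replaces g by Gbar; it leaves integrals over the two
    faces z_k = u_k and z_k = v_k, and an integral over B in which J is
    differentiated.  One application gives delta ([first_moment]).  A second
    one, on B and on the faces, gives Omega: off the diagonal it leaves
    integrals over corners z_i = x, z_j = y ([second_moment_off]), and on the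
    diagonal the derivative of the weight z_i leaves the mass of Gbar times J,
    which is the term with the probability of Z* ([second_moment_diag]).

    J'' is not assumed to be continuous, nor bounded: only the function
    J''(gamma . z) is integrable on B.  The integration by parts therefore
    rests on the fundamental theorem of calculus for functions that are
    differentiable everywhere with a Lebesgue integrable derivative
    ([FTC_integrable]), applied on almost every segment parallel to an axis
    ([box_ibp]).

    The normalizing constants of the face and corner densities are inverses of
    integrals over R^d of h(|w|^2/2), for shifted generators h.  By the layer
    cake formula, both this integral and the one of r^(d/2-1) h(r) over the
    half line are multiples of the integral of s^(d/2) (- h'(s)) over the half
    line, with factors that do not depend on h.  The Gaussian case determines
    their ratio, (2 pi)^(d/2) / Gamma(d/2) ([radial_formula]), and the zeta
    function appears because its integrand is that of the shifted generator
    Gbar ([HLzeta1E]). *)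

Set Implicit Arguments.
Unset Strict Implicit.
Unset Printing Implicit Defensive.

Import Order.TTheory GRing.Theory Num.Theory.
Import numFieldNormedType.Exports.

Local Open Scope classical_set_scope.
Local Open Scope ring_scope.

(** * The fundamental theorem of calculus for integrable derivatives *)

Section real_integrable.
Context d (T : measurableType d) (R : realType).
Variable mu : {measure set T -> \bar R}.
Implicit Types (D : set T) (f h : T -> R).

Lemma integrable_EFinD D f h : measurable D ->
  mu.-integrable D (EFin \o f) -> mu.-integrable D (EFin \o h) ->
  mu.-integrable D (EFin \o (fun x => f x + h x)).
Proof.
by move=> mD /(integrableD mD) H /H; apply: eq_integrable.
Qed.

Lemma integrable_EFinZ D (c : R) f : measurable D ->
  mu.-integrable D (EFin \o f) -> mu.-integrable D (EFin \o (fun x => c * f x)).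
Proof.
by move=> mD /(integrableZl mD c); apply: eq_integrable.
Qed.

Lemma integrable_EFinB D f h : measurable D ->
  mu.-integrable D (EFin \o f) -> mu.-integrable D (EFin \o h) ->
  mu.-integrable D (EFin \o (fun x => f x - h x)).
Proof.
move=> mD fi hi; have := integrable_EFinD mD fi (integrable_EFinZ (-1) mD hi).
by apply: eq_integrable => // x _ /=; rewrite mulN1r.
Qed.

Lemma integrable_bounded D f (M : R) : measurable D -> (mu D < +oo)%E ->
  measurable_fun D f -> (forall x, D x -> `|f x| <= M) ->
  mu.-integrable D (EFin \o f).
Proof.
move=> mD Dfin mf fM; apply: measurable_bounded_integrable => //.
exists M; split; first exact: num_real.
by move=> N MN x /= Dx; rewrite (le_trans (fM _ Dx))// ltW.
Qed.

Lemma integrable_EFinM_bounded D f h (M : R) : measurable D ->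
  measurable_fun D h -> (forall x, D x -> `|h x| <= M) ->
  mu.-integrable D (EFin \o f) -> mu.-integrable D (EFin \o (fun x => h x * f x)).
Proof.
move=> mD mh hM fi.
apply: (@le_integrable _ _ _ mu _ _ _ (EFin \o (fun x => M * f x))) => //.
- apply/measurable_EFinP/measurable_funM => //.
  by apply/measurable_EFinP; exact: measurable_int fi.
- move=> x Dx /=; rewrite lee_fin !normrM ler_wpM2r//.
  by rewrite (le_trans (hM _ Dx))// ler_norm.
- exact: integrable_EFinZ.
Qed.

End real_integrable.

Section local_to_global.
Context {R : realType}.

(** Let s be the supremum of the t up to which G stays above G a.  Left
    continuity gives G a <= G s, and if s < b then the local increase to the
    right of s contradicts the choice of s. *)
Lemma right_increasing_le (G : R -> R) (a b : R) : a <= b ->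
  (forall s, a < s <= b -> G x @[x --> s^'-] --> G s) ->
  (forall x, a <= x < b -> exists2 d : R, 0 < d &
     forall t, x < t < x + d -> t <= b -> G x <= G t) ->
  G a <= G b.
Proof.
move=> ab Gl Gr.
pose S := [set t | a <= t <= b /\ forall r, a <= r <= t -> G a <= G r].
have Sa : S a.
  by split; [rewrite lexx|move=> r /andP[ar ra]; rewrite (@le_anti _ _ a r) ?ar].
have Sb : ubound S b by move=> t [/andP[]].
have hS : has_sup S by split; [exists a|exists b].
set s := sup S.
have as_ : a <= s by apply: ub_le_sup => //; exists b.
have sb : s <= b by apply: ge_sup => //; exists a.
have Slt r : a <= r -> r < s -> G a <= G r.
  move=> ar rs; have [t St rt] := sup_adherent (eps := s - r) ltac:(lra) hS.
  by apply: St.2; rewrite ar /= ltW//; move: rt; rewrite -/s; lra.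
have Gas : G a <= G s.
  move: as_; rewrite le_eqVlt => /predU1P[<-//|as_].
  rewrite leNgt; apply/negP => Gsa.
  have /cvgrPdist_lt/(_ (G a - G s)) := Gl s ltac:(lra).
  rewrite subr_gt0 => /(_ Gsa) H.
  have [r [/andP[ar rs]]] : exists r, a < r < s /\ `|G s - G r| < G a - G s.
    apply: (@filter_ex _ (s^'-)).
    near=> r; split; last by near: r.
    by apply/andP; split; near: r; [exact: nbhs_left_gt|exact: nbhs_left_lt].
  have := Slt r (ltW ar) rs.
  rewrite ltr_norml => ? /andP[? ?]; lra.
move: sb; rewrite le_eqVlt => /predU1P[<-//|sb].
have [d d0 Hd] := Gr s ltac:(lra).
have [t [st [td tb]]] : exists t, s < t /\ t < s + d /\ t <= b.
  have [sdb|sdb] := leP (s + d / 2) b; [exists (s + d / 2)|exists b]; lra.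
suff : S t by move/(ub_le_sup (ex_intro _ b Sb)); rewrite -/s; lra.
split; first by rewrite tb (le_trans as_ (ltW st)).
move=> r /andP[ar rt]; have [rs|] := ltP r s; first exact: Slt.
rewrite le_eqVlt => /predU1P[<-//|sr].
by rewrite (le_trans Gas)// Hd; lra.
Unshelve. all: by end_near. Qed.

End local_to_global.

Section ftc.
Context {R : realType}.
Notation mu := (@lebesgue_measure R).

Lemma is_derive_right_le (F : R -> R) (x l c : R) : is_derive x 1 F l -> l < c ->
  exists2 d : R, 0 < d & forall t, x < t < x + d -> F t - F x <= c * (t - x).
Proof.
move=> [dF Fl] lc.
have /cvgrPdist_lt/(_ (c - l)) : h^-1 *: ((F \o shift x) (h *: 1) - F x)
    @[h --> 0^'] --> l by rewrite -Fl; exact: dF.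
rewrite subr_gt0 => /(_ lc) -[d /= d0 Hd].
exists d => // t /andP[xt td].
have tx : 0 < t - x by rewrite subr_gt0.
have := Hd (t - x); rewrite /ball_/= sub0r normrN gtr0_norm//.
rewrite gt_eqF// => /(_ ltac:(lra) isT).
rewrite /= [_%:A]mulr1 subrK ltr_norml => /andP[+ _].
rewrite ltrBrDr => /ltW H.
by rewrite -ler_pdivrMr// mulrC; move: H; rewrite /GRing.scale/=; lra.
Qed.

(** The growth of F near x is governed by f x, while the integral of f over
    ]x, t] may be much smaller than f x * (t - x), since f need not be
    continuous.  The correction w repairs this at a total cost of e: put
    E_k = {c_k - e <= f < c_k}, choose an open U_k containing E_k such that
    |f| + |c_k| has integral at most e / 2^(k+1) over U_k \ E_k, and let w be
    the sum of the functions (|f| + |c_k|) 1_(U_k \ E_k).  Then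
    f + e + w >= c_k on all of U_k, and F grows at a rate less than c_k to the
    right of a point of E_k. *)
Lemma local_majorant (F f : R -> R) (a b e : R) : 0 < e ->
  (forall x, a <= x <= b -> is_derive x 1 F (f x)) ->
  mu.-integrable `[a, b] (EFin \o f) ->
  exists w : R -> R, [/\ mu.-integrable `[a, b] (EFin \o w),
    \int[mu]_(x in `[a, b]) w x <= e &
    forall x, a <= x < b -> exists2 d : R, 0 < d &
      forall t, x < t < x + d -> t <= b ->
      F t - F x <= \int[mu]_(y in `]x, t]) (f y + e + w y)].
Proof.
move=> e0 dF intf.
set D : set (measurableTypeR R) := `[a, b]%classic in intf *.
have mD : measurable D by exact: measurable_itv.
have finD : (mu D < +oo)%E.
  by rewrite lebesgue_measure_itv/=; case: ifP => _; rewrite ltry.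
have mf : measurable_fun D (f : measurableTypeR R -> R) by apply/measurable_EFinP; exact: measurable_int intf.
(* the levels are the integer multiples of e, indexed by nat *)
pose c (k : nat) : R := ((odflt 0 (unpickle k : option int))%:~R + 1) * e.
pose E k : set (measurableTypeR R) := D `&` f @^-1` `[c k - e, c k[%classic.
have mE k : measurable (E k) by exact: mf.
have coverE x : D x -> exists k, E k x.
  move=> Dx; exists (pickle (Num.floor (f x / e))); split => //=.
  rewrite in_itv/= /c pickleK/=.
  have /andP[] := floor_itv (f x / e).
  rewrite ler_pdivlMr// ltr_pdivrMr// => H1 H2.
  by move: H2; rewrite intrD => ->; rewrite andbT; move: H1; lra.
pose g k (x : measurableTypeR R) : R := `|f x| + `|c k|.
have intcst r : mu.-integrable D (EFin \o cst r).
  by apply: measurable_bounded_integrable => //; exact: bounded_cst.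
have intc k := intcst (c k).
have intg k : mu.-integrable D (EFin \o g k).
  apply: integrable_EFinD => //; first exact: integrable_norm.
  exact: (integrable_norm (intc k)).
have g0 k (x : measurableTypeR R) : 0 <= g k x by rewrite addr_ge0.
have ek0 k : 0 < e / (2 ^ k.+1)%:R by rewrite divr_gt0// ltr0n expn_gt0.
have /choice[U HU] k : exists U : set (measurableTypeR R), [/\ open (U : set R), E k `<=` U &
    \int[mu]_(x in (U `\` E k) `&` D) g k x < e / (2 ^ k.+1)%:R].
  have int2 : mu.-integrable setT (EFin \o (g k \_ D)).
    by rewrite -restrict_EFin -integrable_mkcond.
  have [d [d0 Hd]] :=
    integral_normr_continuous int2 (ek0 k).
  have [|U [oU EU UE]] := lebesgue_regularity_outer (mE k) _ d0.
    by apply: le_lt_trans finD; apply: le_measure; [rewrite inE; exact: mE|rewrite inE; exact: mD|move=> x []].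
  exists U; split => //.
  have mU : measurable U by have H := open_measurable oU; exact H.
  have mUE : measurable (U `\` E k) by apply: measurableD => //; exact: mE.
  have := Hd _ mUE UE; congr (_ < _).
  rewrite [RHS]Rintegral_mkcondr; apply: eq_Rintegral => x _.
  by rewrite ger0_norm// patchE; case: ifP.
pose V k : set (measurableTypeR R) := (U k `\` E k) `&` D.
have mV k : measurable (V k).
  have [oU _ _] := HU k.
  by apply: measurableI => //; apply: measurableD => //; have H := open_measurable oU; exact H.
have VD k : V k `<=` D by exact: subIsetr.
pose wE x := (\sum_(k <oo) ((g k \_ (V k)) x)%:E)%E.
have h0 k x : (0 <= ((g k \_ (V k)) x)%:E)%E.
  by rewrite lee_fin patchE; case: ifP.
have mh k : measurable_fun D (fun x => ((g k \_ (V k)) x)%:E).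
  apply/measurable_EFinP; apply/measurable_restrict => //.
  rewrite setIidr; last exact: VD.
  apply: measurable_funS (VD k) _ => //.
  by apply/measurable_EFinP; exact: measurable_int (intg k).
have mwE : measurable_fun D wE.
  apply: (@ge0_emeasurable_sum _ _ _ _ _ xpredT) => //.
have wE0 x : (0 <= wE x)%E by exact: nneseries_ge0.
have intwE_le : (\int[mu]_(x in D) wE x <= e%:E)%E.
  rewrite integral_nneseries//.
  apply: le_trans (epsilon_trick0 xpredT (ltW e0)).
  apply: lee_nneseries => [k _ _|k _].
    by apply: integral_ge0 => x _; exact: h0.
  have [_ _ H] := HU k.
  have intV : mu.-integrable (V k) (EFin \o g k).
    exact: integrableS mD (mV k) (VD k) (intg k).
  have -> : (\int[mu]_(x in D) ((g k \_ (V k)) x)%:E =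
             \int[mu]_(x in D `&` V k) (g k x)%:E)%E.
    by rewrite integral_mkcondr; apply: eq_integral => x _; rewrite restrict_EFin.
  rewrite setIidr; last exact: VD.
  by rewrite -[leLHS]fineK ?lee_fin ?(ltW H)//; exact: integrable_fin_num.
have intwE : mu.-integrable D wE.
  apply/integrableP; split => //.
  under eq_integral do rewrite gee0_abs//.
  by rewrite (le_lt_trans intwE_le)// ltry.
have aew : ae_eq mu D wE (EFin \o (fine \o wE)).
  apply: filterS (integrable_ae mD intwE) => x /= H /H wfin.
  by rewrite fineK.
have intw : mu.-integrable D (EFin \o (fine \o wE)).
  apply/integrableP; split; first exact/measurable_EFinP/measurableT_comp.
  under eq_integral do rewrite /= ger0_norm ?fine_ge0//.
  have -> : (\int[mu]_(x in D) (fine (wE x))%:E = \int[mu]_(x in D) wE x)%E.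
    apply: ae_eq_integral => //; last exact: ae_eq_sym.
    exact/measurable_EFinP/measurableT_comp.
  by rewrite (le_lt_trans intwE_le)// ltry.
exists (fine \o wE); split => //.
  rewrite /Rintegral.
  have <- : (\int[mu]_(x in D) wE x = \int[mu]_(x in D) (fine (wE x))%:E)%E.
    apply: ae_eq_integral => //.
    exact/measurable_EFinP/measurableT_comp.
  by rewrite -lee_fin fineK//; exact: integrable_fin_num.
move=> x /andP[ax xb].
have Dx : D x by rewrite /D/= in_itv/= ax ltW.
have [k Ekx] := coverE _ Dx.
have fc : f x < c k by have [_] := Ekx; rewrite /= in_itv/= => /andP[].
have [oU EU _] := HU k.
have /open_nbhs_nbhs : open_nbhs x (U k) by split => //; exact: EU.
move=> /nbhs_ballP[d1 /= d10 Hd1].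
have [|d2 d20 Hd2] := @is_derive_right_le F x (f x) (c k) _ fc.
  by apply: dF; rewrite ax ltW.
exists (Num.min d1 d2); first by rewrite lt_min d10.
move=> t /andP[xt]; rewrite -ltrBlDl lt_min => /andP[t1 t2] tb.
apply: le_trans (Hd2 t _) _; first by rewrite xt/=; lra.
set I : set (measurableTypeR R) := `]x, t]%classic.
have mI : measurable I by exact: measurable_itv.
have ID : I `<=` D.
  move=> y; rewrite /I /D/= !in_itv/= => /andP[xy yt].
  by rewrite (le_trans ax (ltW xy)) (le_trans yt).
have IU : I `<=` U k.
  move=> y; rewrite /I/= !in_itv/= => /andP[xy yt].
  by apply: Hd1; rewrite /ball/= ltr_norml; lra.
have intI h : mu.-integrable D h -> mu.-integrable I h by exact: integrableS mD mI ID.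
have intfe : mu.-integrable D (EFin \o (fun y => f y + e)).
  exact: (integrable_EFinD mD intf (intcst e)).
have -> : c k * (t - x) = \int[mu]_(y in I) c k.
  rewrite Rintegral_cst//; congr (_ * _).
  have := lebesgue_measure_itv `]x, t]; rewrite /= lte_fin xt -EFinB => muI.
  exact: (esym (congr1 fine muI)).
have -> : \int[mu]_(y in I) (f y + e + (fine \o wE) y) =
   fine (\int[mu]_(y in I) ((f y + e)%:E + wE y))%E.
  rewrite RintegralD//; [|exact: intI|exact: intI].
  rewrite integralD//; [|exact: intI|exact: intI].
  rewrite fineD; [|exact/integrable_fin_num/intI|exact/integrable_fin_num/intI].
  congr (_ + fine _); apply: ae_eq_integral => //.
  - by apply/measurable_EFinP/measurableT_comp => //; exact: measurable_funS mwE.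
  - exact: measurable_funS mwE.
  - exact/ae_eq_sym/(ae_eq_subset ID).
have intS : mu.-integrable I (fun y => ((f y + e)%:E + wE y)%E).
  exact: (integrableD mI (intI _ intfe) (intI _ intwE)).
rewrite -lee_fin fineK; last exact: (integrable_fin_num mI (intI _ (intc k))).
rewrite fineK; last exact: (integrable_fin_num mI intS).
apply: le_integral => //; first exact: (intI _ (intc k)).
move=> y; rewrite inE => Iy.
have [Eky|nEky] := pselect (E k y).
  rewrite -[leLHS]adde0; apply: leeD => //; rewrite lee_fin.
  by have [_] := Eky; rewrite /= in_itv/= => /andP[]; lra.
apply: (@le_trans _ _ ((f y + e)%:E + ((g k \_ (V k)) y)%:E)%E); last first.
  rewrite leeD2l// /wE (nneseriesD1 (n := k))//.
  by rewrite leeDl// nneseries_ge0.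
rewrite patchE ifT; last by rewrite inE; split; [split => //; exact: IU|exact: ID].
rewrite -EFinD lee_fin /g.
have := ler_norm (c k); have := ler_norm (- f y); rewrite normrN; move: e0; lra.
Qed.

(** With Phi the indefinite integral of the majorant f + e + w, the function
    Phi - F increases locally to the right of every point; hence it increases
    from a to b, and e is arbitrary. *)
Let FTC_le (F f : R -> R) (a b : R) : a < b ->
  (forall x, a <= x <= b -> is_derive x 1 F (f x)) ->
  mu.-integrable `[a, b] (EFin \o f) ->
  F b - F a <= \int[mu]_(x in `[a, b]) f x.
Proof.
move=> ab dF intf.
set D : set (measurableTypeR R) := `[a, b]%classic in intf *.
have mD : measurable D by exact: measurable_itv.
have ba0 : 0 < b - a by rewrite subr_gt0.
suff H e : 0 < e -> F b - F a <= \int[mu]_(x in D) f x + e * (b - a + 1).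
  apply/ler_addgt0Pr => e e0.
  have := H (e / (b - a + 1)) ltac:(by rewrite divr_gt0//; lra).
  by rewrite divfK// gt_eqF//; lra.
move=> e0; have [w [intw we H]] := local_majorant e0 dF intf.
have finD : (mu D < +oo)%E by rewrite lebesgue_measure_itv/= lte_fin ab -EFinB ltry.
have inte : mu.-integrable D (EFin \o cst e).
  exact: (integrable_bounded (M := `|e|)).
pose h y := f y + e + w y.
have inth : mu.-integrable D (EFin \o h).
  by apply: integrable_EFinD => //; apply: integrable_EFinD.
pose Phi t := \int[mu]_(y in `[a, t]) h y.
have [_ _ cPb] := (continuous_within_itvP _ ab).1
  (parameterized_integral_continuous (ltW ab) inth).
have [cP _ _] := (continuous_within_itvP _ ab).1
  (parameterized_integral_continuous (ltW ab) inth).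
have : Phi a - F a <= Phi b - F b.
  apply: (@right_increasing_le _ (fun t => Phi t - F t)); first exact: ltW.
    move=> s /andP[as_ sb]; apply: cvgB.
      move: sb; rewrite le_eqVlt => /predU1P[->//|sb].
      by apply: cvg_at_left_filter; apply: cP; rewrite in_itv/= as_.
    apply: cvg_at_left_filter; apply/differentiable_continuous/derivable1_diffP.
    by apply: ex_derive; apply: dF; rewrite (ltW as_).
  move=> x /andP[ax xb]; have [|d d0 Hd] := H x; first by rewrite ax.
  exists d => // t xtd tb; have := Hd t xtd tb.
  have /andP[xt _] := xtd.
  have := @Rintegral_itvB _ h (BLeft a) (BRight t) x.
  rewrite !bnd_simp (ltW xt) => /(_ _ ax isT); rewrite -/(Phi t) -/(Phi x).
  rewrite -/(h _) => <-; first by lra.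
  apply: integrableS inth => //.
  by apply: subset_itvl; rewrite bnd_simp.
rewrite /Phi set_itv1 Rintegral_set1.
have -> : \int[mu]_(y in D) h y =
    \int[mu]_(y in D) f y + e * (b - a) + \int[mu]_(y in D) w y.
  rewrite RintegralD//; last exact: integrable_EFinD.
  rewrite RintegralD//; congr (_ + _ + _); rewrite Rintegral_cst//.
  have := lebesgue_measure_itv `[a, b]; rewrite /= lte_fin ab -EFinB => muI.
  by congr (_ * _); exact: (congr1 fine muI).
by lra.
Qed.

(** The derivative is only assumed to be integrable, not continuous.  Each
    inequality is the one-sided estimate, for F and for its opposite. *)
Lemma FTC_integrable (F f : R -> R) (a b : R) : a <= b ->
  (forall x, a <= x <= b -> is_derive x 1 F (f x)) ->
  mu.-integrable `[a, b] (EFin \o f) ->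
  \int[mu]_(x in `[a, b]) f x = F b - F a.
Proof.
rewrite le_eqVlt => /predU1P[<-|ab] dF intf.
  by rewrite set_itv1 Rintegral_set1 subrr.
apply/eqP; rewrite eq_le FTC_le// andbT.
have mD : measurable (`[a, b]%classic : set (measurableTypeR R)).
  exact: measurable_itv.
have := @FTC_le (fun x => - F x) (fun x => (-1) * f x) a b ab.
rewrite RintegralZl// => H.
suff : - F b - - F a <= -1 * \int[mu]_(x in `[a, b]) f x by lra.
by apply: H => [x /dF dFx|]; [rewrite mulN1r; exact: is_deriveN|exact: integrable_EFinZ].
Qed.

End ftc.

(** * Lebesgue measure on R^n, one coordinate at a time *)

Section tuples.
Context {R : realType}.

Definition tupc n (v : 'cV[R]_n) : Rn R n := [tuple v i 0 | i < n].

Lemma tupcK n : cancel (@tupc n) colv.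
Proof. by move=> v; apply/colP => i; rewrite !mxE tnth_mktuple. Qed.

Lemma colvK n : cancel colv (@tupc n).
Proof.
by move=> w; apply: eq_from_tnth => i; rewrite tnth_mktuple mxE.
Qed.

Lemma measurable_tupc d (T : measurableType d) n (f : T -> 'cV[R]_n) :
  (forall i, measurable_fun setT (fun t => f t i 0)) ->
  measurable_fun setT (fun t => tupc (f t)).
Proof.
move=> mf; apply/measurable_fun_tnthP => i.
have := mf i; congr measurable_fun; apply/funext => t /=.
by rewrite tnth_mktuple.
Qed.

Lemma measurable_colv n (i : 'I_n) :
  measurable_fun setT (fun w : Rn R n => colv w i 0).
Proof.
have H := @measurable_tnth _ (measurableTypeR R) n i.
have -> : (fun w : Rn R n => colv w i 0) = (fun w => tnth w i).
  by apply/funext => w; rewrite mxE.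
exact: H.
Qed.

Lemma measurable_comp_colv d (T : measurableType d) d' (Z : measurableType d')
    n (f : T -> 'cV[R]_n) (F : 'cV[R]_n -> Z) :
  (forall i, measurable_fun setT (fun t => f t i 0)) ->
  measurable_fun setT (fun w : Rn R n => F (colv w)) ->
  measurable_fun setT (fun t => F (f t)).
Proof.
move=> /measurable_tupc mf mF.
have := measurableT_comp mF mf; congr measurable_fun.
by apply/funext => t /=; rewrite tupcK.
Qed.

Lemma measurable_mulmx_colv d (T : measurableType d) m n (A : 'M[R]_(m, n))
    (c : 'cV[R]_m) (f : T -> 'cV[R]_n) :
  (forall i, measurable_fun setT (fun t => f t i 0)) ->
  forall i, measurable_fun setT (fun t => (A *m f t + c) i 0).
Proof.
move=> mf i; under eq_fun do rewrite !mxE.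
apply: measurable_funD => //.
apply: measurable_sum => j; apply: measurable_funM => //.
Qed.

End tuples.

Section affine1.
Context {R : realType}.
Local Open Scope ereal_scope.
Notation lam := (@lebesgue_measure R).

(** The image of s * lam under x |-> s x + c gives each interval its length,
    hence is the Lebesgue measure. *)
Lemma lebesgue_affine (s c : R) (f : measurableTypeR R -> \bar R) : (0 < s)%R ->
  measurable_fun setT f -> (forall x, 0 <= f x) ->
  \int[lam]_x f x = s%:E * \int[lam]_x f (s * x + c)%R.
Proof.
move=> s0 mf f0.
pose phi (x : measurableTypeR R) : measurableTypeR R := (s * x + c)%R.
have mphi : measurable_fun setT phi.
  have H : measurable_fun setT (fun x : R => (s * x + c)%R).
    by apply: measurable_funD => //; exact: measurable_funM.
  exact H.
pose s' := NngNum (ltW s0).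
have E A : measurable A -> lam A = mscale s' (pushforward lam phi) A.
  move=> mA; apply: lebesgue_measure_unique => // _ [[a b]] _ <-.
  transitivity (s%:E * lam [set` `](a - c) / s, (b - c) / s]%R]); last first.
    congr (_ * lam _); apply/seteqP; split => x /=; rewrite !in_itv/= /phi;
      by rewrite ltr_pdivrMr// ler_pdivlMr// mulrC ltrBlDr lerBrDr.
  rewrite !lebesgue_measure_itv/= !lte_fin ltr_pM2r ?invr_gt0// ltrD2r.
  case: ifP => _; last by rewrite mule0.
  rewrite -EFinB -EFinM; congr EFin.
  by rewrite -mulrBl mulrC divfK ?gt_eqF//; ring.
rewrite (eq_measure_integral (mscale s' (pushforward lam phi))); last first.
  by move=> A mA _; exact: E.
rewrite ge0_integral_mscale//; congr (_ * _).
by rewrite ge0_integral_pushforward.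
Qed.

End affine1.

Section iterated.
Context {R : realType}.
Local Open Scope ereal_scope.
Notation lam := (@lebesgue_measure R).
Notation leb n := (lebesgue_Rn R n).

Lemma lebesgue_RnS n (f : Rn R n.+1 -> \bar R) :
  measurable_fun setT f -> (forall w, 0 <= f w) ->
  \int[leb n.+1]_w f w = \int[(lam \x leb n)]_p f (cons_pair p).
Proof.
move=> mf f0.
transitivity (\int[pushforward (lam \x leb n) (@cons_pair R n)]_w f w).
  apply: eq_measure_integral => [|mc A mA _ //].
  exact: measurable_cons_pair.
by rewrite ge0_integral_pushforward//; exact: measurable_cons_pair.
Qed.

(** A vector of R^(1+n) from its first coordinate and the others, in the
    block form that the matrix lemmas use. *)
Definition ccol n (x : R) (v : 'cV[R]_n) : 'cV[R]_(1 + n) := col_mx x%:M v.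

Lemma colv_cons n (p : measurableTypeR R * Rn R n) :
  colv (cons_pair p) = ccol p.1 (colv p.2).
Proof.
apply/colP => i; rewrite !mxE.
case: splitP => j ij; rewrite !mxE ?ord1.
  by rewrite ord1 in ij; rewrite (_ : i = ord0) ?tnth0//; apply/val_inj.
by rewrite (_ : i = lift ord0 j) ?tnthS//; apply/val_inj.
Qed.

Lemma measurable_ccol d (T : measurableType d) n (f : T -> R) (g : T -> 'cV[R]_n) :
  measurable_fun setT f -> (forall i, measurable_fun setT (fun t => g t i 0%R)) ->
  forall i, measurable_fun setT (fun t => ccol (f t) (g t) i 0%R).
Proof.
move=> mf mg i; case: (splitP i) => j ij.
  have -> : i = lshift n j by apply/val_inj.
  by under eq_fun do rewrite col_mxEu mxE ord1 eqxx mulr1n.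
have -> : i = rshift 1 j by apply/val_inj.
by under eq_fun do rewrite col_mxEd; exact: mg.
Qed.

Section Tonelli.
Variables (n : nat) (F : 'cV[R]_(1 + n) -> \bar R).
Hypothesis mF : measurable_fun setT (fun w : Rn R (1 + n) => F (colv w)).
Hypothesis F0 : forall v, 0 <= F v.

Lemma measurable_ccol_prod : measurable_fun setT
  (fun p : measurableTypeR R * Rn R n => F (ccol p.1 (colv p.2))).
Proof.
apply: measurable_comp_colv mF => i.
apply: measurable_ccol; first exact: measurable_fst.
move=> j; apply: (measurableT_comp (measurable_colv j)).
exact: measurable_snd.
Qed.

Lemma lebesgue_Rn12 : \int[leb (1 + n)]_w F (colv w) =
  \int[lam]_x \int[leb n]_w F (ccol x (colv w)).
Proof.
rewrite (lebesgue_RnS mF)//.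
under eq_integral do rewrite colv_cons.
by rewrite fubini_tonelli1//; exact: measurable_ccol_prod.
Qed.

Lemma lebesgue_Rn21 : \int[leb (1 + n)]_w F (colv w) =
  \int[leb n]_w \int[lam]_x F (ccol x (colv w)).
Proof.
rewrite lebesgue_Rn12.
exact: (fubini_tonelli _ measurable_ccol_prod (fun p => F0 _)).
Qed.

End Tonelli.

End iterated.

(** * Positive definite changes of variables *)

Section schur.
Context {R : realType}.

Lemma dotE d (u v : 'cV[R]_d) : dot u v = \sum_i u i 0 * v i 0.
Proof. by rewrite /dot mxE; apply: eq_bigr => i _; rewrite mxE. Qed.

Lemma sqnorm_gt0 n (x : 'cV[R]_n) : x != 0 -> 0 < dot x x.
Proof.
move=> x0; have [i xi] : exists i, x i 0 != 0.
  apply/not_existsP => H; move/eqP: x0; apply; apply/colP => i.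
  by rewrite mxE; have /negP := H i; rewrite negbK => /eqP.
rewrite dotE (bigD1 i)//= ltr_wpDr//.
  by apply: sumr_ge0 => j _; rewrite -expr2 sqr_ge0.
by rewrite -expr2 exprn_even_gt0.
Qed.

Lemma dot_ccol n (a b : R) (u v : 'cV[R]_n) :
  dot (ccol a u) (ccol b v) = a * b + dot u v.
Proof.
by rewrite /dot /ccol tr_col_mx mul_row_col mxE tr_scalar_mx -scalar_mxM !mxE eqxx.
Qed.

Section block.
Variables (n : nat) (M : 'M[R]_(1 + n)).
Hypothesis pM : posdef M.

Let s := M (lshift n 0) (lshift n 0).
Let r : 'cV_n := dlsubmx M.

Definition schur : 'M[R]_n := drsubmx M - s^-1 *: (r *m r^T).

Let ME : M = block_mx s%:M r^T r (drsubmx M).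
Proof.
rewrite -[LHS]submxK; congr block_mx.
  by apply/matrixP => i j; rewrite !ord1 !mxE eqxx.
by rewrite /r trmx_dlsub pM.1.
Qed.

Let M_ccol x v : M *m ccol x v = ccol (s * x + dot r v) (x *: r + drsubmx M *m v).
Proof.
rewrite [in LHS]ME mul_block_col /ccol -scalar_mxM; congr col_mx.
  by apply/matrixP => i j; rewrite !ord1 !mxE eqxx !mulr1n -/(dot r v) /dot mxE.
by rewrite mul_mx_scalar.
Qed.

Lemma pivot_gt0 : 0 < s.
Proof.
have /pM.2 : ccol 1 (0 : 'cV[R]_n) != 0.
  apply/eqP => /(congr1 (fun z : 'cV_(1 + n) => z (lshift n 0) 0)).
  by rewrite /ccol col_mxEu !mxE eqxx; apply/eqP/oner_neq0.
have dot0l (w : 'cV[R]_n) : dot 0 w = 0 by rewrite /dot trmx0 mul0mx mxE.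
have dot0r (w : 'cV[R]_n) : dot w 0 = 0 by rewrite /dot mulmx0 mxE.
by rewrite M_ccol dot_ccol dot0l dot0r !addr0 mulr1 mul1r.
Qed.

(** In terms of the new first coordinate y = s x + r . v, the other
    coordinates of the image are schur v, translated by a vector that depends
    on y only. *)
Lemma mulmx_ccol_schur x v : M *m ccol x v =
  ccol (s * x + dot r v) (((s * x + dot r v) / s) *: r + schur *m v).
Proof.
rewrite M_ccol; congr ccol; rewrite /schur mulmxBl.
have -> : s^-1 *: (r *m r^T) *m v = (dot r v / s) *: r.
  rewrite -scalemxAl -mulmxA [r^T *m v]mx11_scalar -/(dot r v) mul_mx_scalar.
  by rewrite scalerA mulrC.
rewrite mulrDl mulrAC divff ?gt_eqF ?pivot_gt0// mul1r scalerDl.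
by rewrite -addrA subrKC.
Qed.

(** M sends the vector (- (r . x) / s, x) to (0, schur x), so the quadratic
    form of the Schur complement at x is the one of M at that vector. *)
Lemma posdef_schur : posdef schur.
Proof.
split.
  rewrite /schur linearB/= linearZ/= trmx_mul trmxK.
  by rewrite trmx_drsub pM.1.
move=> x x0; pose y := ccol (- (dot r x) / s) x.
have y0 : y != 0.
  apply: contra x0 => /eqP y0; apply/eqP/colP => i.
  have := congr1 (fun z : 'cV_(1 + n) => z (rshift 1 i) 0) y0.
  by rewrite /y /ccol col_mxEd !mxE.
have := pM.2 _ y0; rewrite /y mulmx_ccol_schur.
have -> : s * (- dot r x / s) + dot r x = 0.
  by rewrite mulrCA divff ?gt_eqF ?pivot_gt0// mulr1 addNr.
rewrite mul0r scale0r add0r.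
by rewrite dot_ccol mulr0 add0r.
Qed.

Lemma det_schur : \det M = s * \det schur.
Proof.
have -> : M = block_mx s%:M 0 r schur *m block_mx 1%:M (s^-1 *: r^T) 0 1%:M.
  rewrite mulmx_block !mulmx1 !mul0mx !mulmx0 !addr0 mul_scalar_mx scalerA.
  rewrite divff ?gt_eqF ?pivot_gt0// scale1r -scalemxAr /schur subrKC.
  exact: ME.
rewrite det_mulmx det_lblock det_ublock !det1 !mulr1.
by rewrite det_scalar1.
Qed.

End block.

Lemma posdef_det_gt0 n (M : 'M[R]_n) : posdef M -> 0 < \det M.
Proof.
elim: n M => [|n IH] M pM; first by rewrite det_mx00.
by rewrite (@det_schur n M pM) mulr_gt0 ?(@pivot_gt0 n M)// IH//; exact: posdef_schur.
Qed.

End schur.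

Section change_of_variables.
Context {R : realType}.
Local Open Scope ereal_scope.
Notation lam := (@lebesgue_measure R).
Notation leb n := (lebesgue_Rn R n).

(** By induction on n: for fixed v, substitute y = s x + r . v for the first
    coordinate x; then for fixed y the remaining coordinates undergo the Schur
    complement followed by a translation.  The two factors s and
    \det (schur M) multiply to \det M. *)
Lemma lebesgue_Rn_posdef n (M : 'M[R]_n) (c : 'cV[R]_n) (F : 'cV[R]_n -> \bar R) :
  posdef M -> measurable_fun setT (fun w : Rn R n => F (colv w)) ->
  (forall v, 0 <= F v) ->
  \int[leb n]_w F (colv w) = (\det M)%:E * \int[leb n]_w F (M *m colv w + c)%R.
Proof.
elim: n M c F => [|n IH] M c F pM mF F0.
  rewrite det_mx00 mul1e; apply: eq_integral => w _; congr F.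
  by apply/colP => -[].
change n.+1 with (1 + n)%N in *.
set s := M (lshift n 0%R) (lshift n 0%R); set r : 'cV_n := dlsubmx M.
have s0 : (0 < s)%R by exact: pivot_gt0.
have pS := posdef_schur pM; have dS := posdef_det_gt0 pS.
set c0 := c (lshift n 0%R) 0%R; set c1 : 'cV_n := dsubmx c.
have cE : c = ccol c0 c1.
  rewrite -[LHS]vsubmxK; congr col_mx.
  by apply/matrixP => i j; rewrite !ord1 !mxE eqxx.
have addE x y (v w : 'cV[R]_n) : (ccol x v + ccol y w = ccol (x + y) (v + w))%R.
  by rewrite /ccol add_col_mx raddfD.
have affE x v : (M *m ccol x v + c = ccol (s * x + dot r v + c0)
    (((s * x + dot r v) / s) *: r + schur M *m v + c1))%R.
  by rewrite cE mulmx_ccol_schur// addE.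
have mccol d (T : measurableType d) (f : T -> R) (h : T -> 'cV[R]_n) :
    measurable_fun setT f -> (forall i, measurable_fun setT (fun t => h t i 0%R)) ->
    measurable_fun setT (fun t => F (ccol (f t) (h t))).
  move=> mf mh; apply: (@measurable_comp_colv _ _ _ _ _ _ (fun t => ccol (f t) (h t))) => //.
  exact: measurable_ccol.
pose G (v : 'cV[R]_(1 + n)) := F (M *m v + c)%R.
have mG : measurable_fun setT (fun w : Rn R (1 + n) => G (colv w)).
  apply: (@measurable_comp_colv _ _ _ _ _ _ (fun w : Rn R (1 + n) => M *m colv w + c)%R) => //.
  apply: measurable_mulmx_colv => i; exact: measurable_colv.
rewrite (lebesgue_Rn21 mG) /G; last by move=> v; exact: F0.
(* substitute y = s x + r . w in the inner integral *)
pose H (w : 'cV[R]_n) (y : R) := F (ccol (y + c0) ((y / s) *: r + schur M *m w + c1)).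
have mH w : measurable_fun setT (H w : measurableTypeR R -> \bar R).
  apply: (mccol _ _ (fun y : measurableTypeR R => y + c0)%R
    (fun y => (y / s) *: r + schur M *m w + c1)%R).
    by apply: measurable_funD.
  move=> i; under eq_fun do rewrite !mxE.
  apply: measurable_funD => //; apply: measurable_funD => //.
  by apply: measurable_funM => //; apply: measurable_funM.
transitivity ((\det M)%:E * \int[leb n]_w (s^-1%:E * \int[lam]_y H (colv w) y)); last first.
  congr (_ * _); apply: eq_integral => w _.
  rewrite (lebesgue_affine (dot r (colv w)) s0 (mH (colv w))); last first.
    by move=> x; exact: F0.
  rewrite muleA -EFinM mulVf ?gt_eqF// mul1e.
  by apply: eq_integral => x _; rewrite /H affE.
rewrite (det_schur pM) -/s.
have mHp : measurable_fun setT
    (fun p : measurableTypeR R * Rn R n => H (colv p.2) p.1).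
  have mfst : measurable_fun setT
    (fun p : measurableTypeR R * Rn R n => p.1 : R) by exact: measurable_fst.
  have msnd i : measurable_fun setT
      (fun p : measurableTypeR R * Rn R n => colv p.2 i 0%R).
    by apply: (measurableT_comp (measurable_colv i)); exact: measurable_snd.
  apply: mccol; first exact: measurable_funD.
  move=> i; rewrite (_ : (fun _ => _) = fun p : measurableTypeR R * Rn R n =>
    ((p.1 / s) * r i 0 + (schur M *m colv p.2) i 0 + c1 i 0)%R); last first.
    by apply/funext => p; rewrite !mxE.
  apply: measurable_funD => //; apply: measurable_funD => //.
    by apply: measurable_funM => //; apply: measurable_funM.
  have := measurable_mulmx_colv (schur M) 0%R msnd i.
  by under eq_fun do rewrite addr0.
rewrite ge0_integralZl//; last 3 first.
- exact: (measurable_fun_fubini_tonelli_G _ mHp (fun=> F0 _)).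
- by move=> w _; apply: integral_ge0 => x _; exact: F0.
- by rewrite lee_fin invr_ge0 ltW.
rewrite muleA -EFinM (mulrC s) mulfK ?gt_eqF//.
transitivity ((\det (schur M))%:E * \int[lam]_x \int[leb n]_w H (colv w) x);
  last first.
  congr (_ * _).
  have /= E := fubini_tonelli (m1 := lam) (m2 := leb n) _ mHp (fun=> F0 _).
  exact E.
rewrite -ge0_integralZl//; last 3 first.
- exact: (measurable_fun_fubini_tonelli_F _ mHp (fun=> F0 _)).
- by move=> w _; apply: integral_ge0 => x _; exact: F0.
- by rewrite lee_fin ltW.
transitivity (\int[lam]_x \int[leb n]_w F (ccol (x + c0) (colv w))); last first.
  apply: eq_integral => y _.
  rewrite (IH (schur M) ((y / s) *: r + c1)%R (fun v => F (ccol (y + c0) v))).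
    congr (_ * _); apply: eq_integral => w _; rewrite /H. congr (F (ccol _ _)).
    by rewrite addrCA addrA.
  3: by move=> v; exact: F0.
    exact: pS.
  apply: mccol => [|i]; [exact: measurable_cst|exact: measurable_colv].
rewrite (lebesgue_Rn12 mF F0).
rewrite (lebesgue_affine c0 ltr01).
- by rewrite mul1e; apply: eq_integral => x _; rewrite mul1r.
- exact: (measurable_fun_fubini_tonelli_F _
    (measurable_ccol_prod mF) (fun=> F0 _)).
- by move=> x; apply: integral_ge0 => w _; exact: F0.
Qed.

End change_of_variables.

(** * Integration along a coordinate axis *)

Section slices.
Context {R : realType}.
Local Open Scope ereal_scope.
Notation lam := (@lebesgue_measure R).
Notation leb n := (lebesgue_Rn R n).

Lemma measurable_nth n j : measurable_fun setT (fun w : Rn R n => nth 0%R w j : R).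
Proof.
have [jn|nj] := ltnP j n.
  have -> : (fun w : Rn R n => nth 0%R w j : R) = fun w => colv w (Ordinal jn) 0%R.
    by apply/funext => w; rewrite mxE (tnth_nth 0%R).
  exact: measurable_colv.
have -> : (fun w : Rn R n => nth 0%R w j : R) = cst 0%R.
  by apply/funext => w; rewrite nth_default ?size_tuple.
exact: measurable_cst.
Qed.

Lemma measurable_ins1 d (T : measurableType d) n (k : 'I_n) (f : T -> R)
    (h : T -> Rn R n.-1) : measurable_fun setT f -> measurable_fun setT h ->
  forall i, measurable_fun setT (fun t => ins1 k (f t) (h t) i 0%R).
Proof.
move=> mf mh i; under eq_fun do rewrite mxE.
case: (i == k) => //.
exact: (measurableT_comp (@measurable_nth _ _) mh).
Qed.

Lemma measurable_box_on d (T : measurableType d) n (P : pred 'I_n)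
    (u v : 'cV[R]_n) (h : T -> 'cV[R]_n) :
  (forall i, measurable_fun setT (fun t => h t i 0%R)) ->
  measurable [set t | forall i, P i -> (u i 0 < h t i 0 <= v i 0)%R].
Proof.
move=> mh.
rewrite (_ : [set t | _] = \bigcap_(i in [set i | P i])
  ((fun t => h t i 0%R) @^-1` `](u i 0%R), (v i 0%R)]%classic)); last first.
  by apply/seteqP; split => t /= H i Pi; have := H i Pi; rewrite /= in_itv.
apply: fin_bigcap_measurable => // i _.
by rewrite -[X in measurable X]setTI; apply: mh => //; exact: measurable_itv.
Qed.

Lemma measurable_box n (u v : 'cV[R]_n) :
  measurable ((@colv R n) @^-1` box u v).
Proof.
have := measurable_box_on xpredT u v (@measurable_colv R n).
by congr measurable; apply/seteqP; split => w /= H i //; exact: H.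
Qed.

Lemma measurable_box1 n (u v : 'cV[R]_n) (k : 'I_n) : measurable (box1 u v k).
Proof.
by apply: measurable_box_on; apply: measurable_ins1.
Qed.

Lemma ins1_ord0 n x (w : Rn R n) : ins1 (@ord0 n) x w = ccol x (colv w).
Proof.
apply/colP => i; rewrite !mxE; case: splitP => j ij.
  by rewrite mxE ord1 eqxx; case: eqP => // /eqP; rewrite -val_eqE/= ij ord1.
rewrite -val_eqE/= ij/= mxE (tnth_nth 0%R).
by rewrite addKn.
Qed.

Lemma ins1_lift n (k : 'I_n.+1) x (p : measurableTypeR R * Rn R n) :
  ins1 (lift ord0 k) x (cons_pair p) = ccol p.1 (ins1 k x p.2).
Proof.
apply/colP => i; rewrite !mxE; case: splitP => j ij.
  by rewrite !mxE -!val_eqE/= ij !ord1.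
rewrite !mxE -!val_eqE/= ij/= /bump/= !add1n eqSS ltnS; case: ifP => // /eqP jk.
case: ltnP => [kj|_]; last by rewrite !subn0.
by rewrite !subn1/=; case: (nat_of_ord j) kj.
Qed.

Lemma measurable_ins1_prod n (k : 'I_n.+1) (F : 'cV[R]_n.+1 -> \bar R) :
  measurable_fun setT (fun w : Rn R n.+1 => F (colv w)) ->
  measurable_fun setT (fun p : measurableTypeR R * Rn R n => F (ins1 k p.1 p.2)).
Proof.
move=> mF; apply: measurable_comp_colv mF => i.
by apply: measurable_ins1; [exact: measurable_fst|exact: measurable_snd].
Qed.

(** The measure is built by adding coordinates in front, so coordinate k is
    reached by induction: the case k = 0 is the definition, and otherwise the
    front coordinate is split off on both sides. *)
Lemma lebesgue_Rn_slice n (k : 'I_n.+1) (F : 'cV[R]_n.+1 -> \bar R) :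
  measurable_fun setT (fun w : Rn R n.+1 => F (colv w)) ->
  (forall v, 0 <= F v) ->
  \int[leb n.+1]_w F (colv w) = \int[leb n]_w \int[lam]_x F (ins1 k x w).
Proof.
elim: n k F => [|n IH] k F mF F0.
  rewrite (lebesgue_Rn21 mF F0); apply: eq_integral => w _.
  by apply: eq_integral => x _; rewrite (ord1 k) ins1_ord0.
case: (unliftP ord0 k) => [k' ->|->]; last first.
  rewrite (lebesgue_Rn21 mF F0); apply: eq_integral => w _.
  by apply: eq_integral => x _; rewrite ins1_ord0.
rewrite (lebesgue_Rn12 mF F0).
have mG := measurable_fun_fubini_tonelli_G (m1 := lam) _
  (measurable_ins1_prod (lift ord0 k') mF) (fun=> F0 _).
have G0 (w : Rn R n.+1) : 0 <= \int[lam]_x F (ins1 (lift ord0 k') x w).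
  by apply: integral_ge0 => x _; exact: F0.
rewrite (lebesgue_RnS mG G0).
rewrite (fubini_tonelli1 _ (measurableT_comp mG (@measurable_cons_pair R n)) (fun=> G0 _)).
apply: eq_integral => y _.
rewrite (IH k' (fun v => F (ccol y v))); first last.
- by move=> v; exact: F0.
- apply: (@measurable_comp_colv _ _ _ _ _ _ (fun w : Rn R n.+1 => ccol y (colv w))) mF.
  by apply: measurable_ccol => // i; exact: measurable_colv.
by apply: eq_integral => w _; apply: eq_integral => x _; rewrite ins1_lift.
Qed.

End slices.

Section box_ibp.
Context {R : realType}.
Notation lam := (@lebesgue_measure R).
Notation leb n := (lebesgue_Rn R n).

Lemma ins1_same n (k : 'I_n) x (w : Rn R n.-1) : ins1 k x w k 0 = x.
Proof. by rewrite mxE eqxx. Qed.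

Lemma ins1_other n (k : 'I_n.+1) x (w : Rn R n) j :
  ins1 k x w (lift k j) 0 = colv w j 0.
Proof.
rewrite !mxE eq_sym (negbTE (neq_lift k j)) (tnth_nth 0); congr nth.
rewrite /= /bump; case: (leqP k j) => kj; first by rewrite add1n ltnS kj subn1.
by rewrite add0n ltnNge (ltnW kj) subn0.
Qed.

Lemma row1E n (k : 'I_n.+1) (u : 'cV[R]_n.+1) j : row' k u j 0 = u (lift k j) 0.
Proof. by rewrite mxE. Qed.

Lemma boxE n (u v : 'cV[R]_n.+1) (k : 'I_n.+1) x (w : Rn R n) :
  box u v (ins1 k x w) <-> (u k 0 < x <= v k 0 /\ box (row' k u) (row' k v) (colv w)).
Proof.
split=> [H|[Hk H] i].
  split; first by have := H k; rewrite ins1_same.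
  by move=> j; have := H (lift k j); rewrite ins1_other !row1E.
case: (unliftP k i) => [j ->|->]; last by rewrite ins1_same.
by have := H j; rewrite ins1_other !row1E.
Qed.

Lemma box1E n (u v : 'cV[R]_n.+1) (k : 'I_n.+1) :
  box1 u v k = (@colv R n) @^-1` box (row' k u) (row' k v).
Proof.
apply/seteqP; split => w H.
  by move=> j; have := H (lift k j); rewrite ins1_other !row1E eq_sym neq_lift => /(_ isT).
move=> i; case: (unliftP k i) => [j -> _|->]; last by rewrite eqxx.
by have := H j; rewrite ins1_other !row1E.
Qed.

Lemma box_fin n (u v : 'cV[R]_n) : (leb n ((@colv R n) @^-1` box u v) < +oo)%E.
Proof.
elim: n u v => [|n IH] u v.
  by rewrite /= diracE; case: (_ \in _); rewrite ltry.
have -> : leb n.+1 (colv @^-1` box u v) =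
    (lam \x leb n)%E (`]u 0 0, v 0 0] `*` (colv @^-1` box (row' 0 u) (row' 0 v))).
  rewrite /= /leb_step /pushforward; congr (_ \x _)%E.
  apply/seteqP; split => -[x w] /=; rewrite colv_cons -ins1_ord0/= in_itv/=.
    by move/boxE.
  by move=> H; apply/boxE.
rewrite product_measure1E//; last exact: measurable_box.
apply: lte_mul_pinfty => //.
have H := lebesgue_measure_itv `]u 0 0, v 0 0].
have : lebesgue_measure [set` `]u 0 0, v 0 0]] \is a fin_num by rewrite H; case: ifP.
by move=> H1; exact H1.
Qed.

Lemma integrable_cc_oc (f : R -> R) (a b : R) :
  lam.-integrable `]a, b] (EFin \o f) -> lam.-integrable `[a, b] (EFin \o f).
Proof.
move=> /integrableP[mf fi]; apply/integrableP; split.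
  exact/emeasurable_fun_itv_obnd_cbndP.
rewrite -integral_itv_obnd_cbnd//.
exact: measurableT_comp.
Qed.

(** Insertion of the k-th coordinate as a map of measurable spaces, under
    which Lebesgue measure is the image of a product measure. *)
Definition insT n (k : 'I_n.+1) (p : measurableTypeR R * Rn R n) : Rn R n.+1 :=
  tupc (ins1 k p.1 p.2).

Lemma colv_insT n (k : 'I_n.+1) p : colv (insT k p) = ins1 k p.1 p.2.
Proof. exact: tupcK. Qed.

Lemma measurable_insT n (k : 'I_n.+1) : measurable_fun setT (insT k).
Proof.
apply: measurable_tupc; apply: measurable_ins1;
  [exact: measurable_fst|exact: measurable_snd].
Qed.

Lemma integral_insT n (k : 'I_n.+1) (f : Rn R n.+1 -> \bar R) :
  measurable_fun setT f -> (forall w, 0 <= f w)%E ->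
  (\int[leb n.+1]_w f w = \int[lam \x leb n]_p f (insT k p))%E.
Proof.
move=> mf f0.
pose F v := f (tupc v).
have -> : (\int[leb n.+1]_w f w = \int[leb n.+1]_w F (colv w))%E.
  by apply: eq_integral => w _; rewrite /F colvK.
have mF : measurable_fun setT (fun w => F (colv w)).
  by rewrite (_ : (fun _ => _) = f)//; apply/funext => w; rewrite /F colvK.
rewrite (lebesgue_Rn_slice k mF (fun=> f0 _)).
by rewrite fubini_tonelli2//; exact: measurableT_comp mf (measurable_insT k).
Qed.

Lemma insT_measure n (k : 'I_n.+1) A : measurable A ->
  leb n.+1 A = pushforward (lam \x leb n)%E (insT k) A.
Proof.
move=> mA; have := @integral_insT n k (EFin \o \1_A) _ _.
rewrite integral_indic// setIT => ->//; last 2 first.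
- exact/measurable_EFinP/measurable_indic.
- by move=> w; rewrite lee_fin.
rewrite /pushforward -[in RHS](setIT (_ @^-1` _)) -integral_indic//.
by rewrite -[X in measurable X]setTI; exact: measurable_insT.
Qed.

Lemma integrable_insT n (k : 'I_n.+1) (f : Rn R n.+1 -> \bar R) :
  (leb n.+1).-integrable setT f ->
  (lam \x leb n)%E.-integrable setT (fun p => f (insT k p)).
Proof.
move=> /integrableP[mf fi]; apply/integrableP; split.
  exact: measurableT_comp mf (measurable_insT k).
rewrite -(integral_insT k (f := fun w => `|f w|%E))//.
exact: measurableT_comp.
Qed.

Lemma lebesgue_Rn_Fubini n (k : 'I_n.+1) (f : Rn R n.+1 -> \bar R) :
  (leb n.+1).-integrable setT f ->
  (\int[leb n.+1]_w f w = \int[leb n]_w \int[lam]_x f (insT k (x, w)))%E.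
Proof.
move=> fi; have fi' := integrable_insT k fi.
rewrite (integral21_prod_meas1 fi').
transitivity (\int[pushforward (lam \x leb n)%E (insT k)]_w f w)%E.
  apply: eq_measure_integral => [|mi A mA _]; first exact: measurable_insT.
  exact: insT_measure.
rewrite integral_pushforward//; first exact: measurable_insT.
by apply: measurable_int fi.
Qed.

(** Since f' is integrable on the box, Fubini's theorem makes it integrable on
    almost every segment in the direction k, and there its integral is a
    difference of values of f by [FTC_integrable]. *)
Lemma box_ibp n (k : 'I_n.+1) (u v : 'cV[R]_n.+1) (f f' : 'cV[R]_n.+1 -> R) :
  u k 0 <= v k 0 ->
  (forall (x : R) w, is_derive x 1 (fun x => f (ins1 k x w)) (f' (ins1 k x w))) ->
  measurable_fun setT (fun w : Rn R n.+1 => f (colv w)) ->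
  (leb n.+1).-integrable (colv @^-1` box u v) (EFin \o (fun w => f' (colv w))) ->
  \int[leb n.+1]_(w in colv @^-1` box u v) f' (colv w) =
  \int[leb n]_(w in box1 u v k) (f (ins1 k (v k 0) w) - f (ins1 k (u k 0) w)).
Proof.
move=> uv df mf fi.
have mB := measurable_box u v.
have mB1 := measurable_box1 u v k.
rewrite /Rintegral integral_mkcond.
have fi' : (leb n.+1).-integrable setT
    (((EFin \o (fun w => f' (colv w))) \_ (colv @^-1` box u v)) : Rn R n.+1 -> \bar R).
  by rewrite -integrable_mkcond.
rewrite (lebesgue_Rn_Fubini k fi') integral_mkcond.
congr fine.
pose h w := f (ins1 k (v k 0) w) - f (ins1 k (u k 0) w).
have mface (x : R) : measurable_fun setT (fun w : Rn R n => f (ins1 k x w)).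
  apply: (@measurable_comp_colv _ _ _ _ _ _ (fun w : Rn R n => ins1 k x w)) mf => i.
  by apply: measurable_ins1.
apply: ae_eq_integral => //.
- exact: (measurable_fubini_G (integrable_insT k fi')).
- apply/(measurable_restrictT _ mB1)/measurable_EFinP.
  by apply: measurable_funTS; exact: measurable_funB.
have aei := ae_integrable2 (integrable_insT k fi').
apply: filterS aei => w fiw _.
have [wB|wB] := pselect (box1 u v k w); last first.
  rewrite patchE memNset//.
  apply: integral0_eq => x _; rewrite patchE memNset//= colv_insT => /boxE[_].
  by rewrite box1E in wB.
rewrite patchE mem_set//.
have E : (fun x => ((EFin \o (fun w0 : Rn R n.+1 => f' (colv w0))) \_ (colv @^-1` box u v))
    (insT k (x, w))) = ((EFin \o (fun x => f' (ins1 k x w))) \_ `](u k 0), (v k 0)]).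
  apply/funext => x; rewrite !patchE /=.
  have -> : (insT k (x, w) \in (colv @^-1` box u v)) = (x \in `](u k 0), (v k 0)]%classic).
    apply/idP/idP => /set_mem; rewrite /= ?colv_insT ?in_itv/= => H; apply/mem_set; rewrite /= ?colv_insT ?in_itv/=.
      by case/boxE : H.
    by apply/boxE; split => //; move: wB; rewrite box1E.
  by case: ifP => //; rewrite colv_insT.
rewrite E -integral_mkcond.
have {}fiw : lam.-integrable `[u k 0, v k 0] (EFin \o (fun x => f' (ins1 k x w))).
  apply: integrable_cc_oc; apply/integrable_mkcond; first exact: measurable_itv.
  by rewrite -E.
rewrite integral_itv_obnd_cbnd; last first.
  by apply/emeasurable_fun_itv_obnd_cbndP; exact: measurable_int fiw.
rewrite -[LHS]fineK; last first.
  by apply: integrable_fin_num fiw; exact: measurable_itv.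
by congr EFin; exact: (FTC_integrable uv (fun x _ => df x w) fiw).
Qed.

End box_ibp.

(** * The logistic generators *)

Section profiles.
Context {R : realType}.

Lemma is_derive_expRN (t : R) : is_derive t 1 (fun t => expR (- t)) (- expR (- t)).
Proof.
apply: (is_derive_eq (is_derive1_comp (f := expR) (g := -%R) _ _)).
by rewrite mulrN1.
Qed.

Lemma onepexp_gt0 (t : R) : 0 < 1 + expR (- t).
Proof. by rewrite addr_gt0// expR_gt0. Qed.

Lemma is_derive_onepexp (t : R) :
  is_derive t 1 (fun t => 1 + expR (- t)) (- expR (- t)).
Proof.
have H := is_derive_expRN t.
have H2 := is_deriveD (is_derive_cst (1 : R) t 1) H.
by rewrite add0r in H2; exact H2.
Qed.

Lemma is_derive_Gbar (t : R) : is_derive t 1 Gbar (- g t).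
Proof.
have H1 := is_derive_expRN t.
have n0 : 1 + expR (- t) != 0 by rewrite gt_eqF// onepexp_gt0.
have H2 := @is_deriveV R (fun t => 1 + expR (- t)) t _ 1 n0 (is_derive_onepexp t).
have H3 := is_deriveM H1 H2.
have -> : - g t = expR (- t) *: (- (1 + expR (- t)) ^- 2 *: - expR (- t)) +
  (1 + expR (- t))^-1 *: - expR (- t); last by exact H3.
rewrite /g /GRing.scale/= -exprVn; move: n0; set e := expR _ => n0.
by field.
Qed.

Lemma is_derive_GGbar (t : R) : is_derive t 1 GGbar (- Gbar t).
Proof.
have H1 := is_derive1_ln (onepexp_gt0 t).
have H2 := @is_derive1_comp R (@ln R) (fun t => 1 + expR (- t)) t _ _ H1
  (is_derive_onepexp t).
have -> : - Gbar t = (1 + expR (- t))^-1 * - expR (- t).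
  by rewrite /Gbar mulrN mulrC.
exact H2.
Qed.

Lemma g_le1 (t : R) : 0 <= g t <= 1.
Proof.
have e0 := expR_gt0 (- t); rewrite /g.
apply/andP; split; first by rewrite divr_ge0 ?sqr_ge0 ?(ltW e0).
rewrite ler_pdivrMr ?exprn_gt0 ?onepexp_gt0// mul1r.
by move: e0; set e := expR _; nra.
Qed.

Lemma Gbar_gt0 (t : R) : 0 < Gbar t.
Proof. by rewrite divr_gt0 ?expR_gt0 ?onepexp_gt0. Qed.

Lemma Gbar_le1 (t : R) : 0 <= Gbar t <= 1.
Proof.
rewrite ltW ?Gbar_gt0//= ler_pdivrMr ?onepexp_gt0// mul1r lerDr.
exact: ler01.
Qed.

(** Up to constants, the generators are squeezed between Gaussian profiles;
    this is what makes all their masses finite and positive. *)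
Lemma Gbar_expR (t : R) : 0 <= t -> expR (- t) / 2 <= Gbar t <= expR (- t).
Proof.
move=> t0; have e0 := expR_gt0 (- t).
have e1 : expR (- t) <= 1 by rewrite -expR0 ler_expR lerNl oppr0.
apply/andP; split.
  by rewrite ler_pM2l// lef_pV2 ?posrE ?onepexp_gt0//; lra.
by rewrite ler_pdivrMr ?onepexp_gt0//; nra.
Qed.

Lemma GGbar_expR (t : R) : 0 <= t -> expR (- t) / 2 <= GGbar t <= expR (- t).
Proof.
move=> t0; have e0 := expR_gt0 (- t).
have [G1 _] := andP (Gbar_expR t0).
rewrite /GGbar; set x := expR (- t) in e0 *.
apply/andP; split; last by apply: le_ln1Dx; lra.
apply: le_trans G1 _.
have : - ln (1 + x) <= - Gbar t.
  rewrite -lnV ?posrE ?onepexp_gt0//.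
  have -> : (1 + x)^-1 = 1 + (- Gbar t).
    rewrite /Gbar -/x; field.
    by rewrite gt_eqF// onepexp_gt0.
  by apply: le_ln1Dx; rewrite ltrN2; have := onepexp_gt0 t; rewrite /Gbar -/x => ?; rewrite ltr_pdivrMr//; lra.
by rewrite lerN2.
Qed.

Lemma GGbar_le1 (t : R) : 0 <= t -> 0 <= GGbar t <= 1.
Proof.
move=> t0; have [] := andP (GGbar_expR t0).
have e0 := expR_gt0 (- t).
have e1 : expR (- t) <= 1 by rewrite -expR0 ler_expR lerNl oppr0.
by move=> ? ?; apply/andP; split; lra.
Qed.

Lemma derivable_measurable (f f' : R -> R) :
  (forall t : R, is_derive t 1 f (f' t)) -> measurable_fun setT f.
Proof.
move=> df; apply: continuous_measurable_fun => x.
by apply/differentiable_continuous/derivable1_diffP; apply: ex_derive.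
Qed.

Lemma measurable_g : measurable_fun setT (@g R).
Proof.
apply: measurable_funM.
  exact: (derivable_measurable is_derive_expRN).
have H : continuous (fun t : R => ((1 + expR (- t)) ^+ 2)^-1).
  move=> t; apply: cvgV; first by rewrite sqrf_eq0 gt_eqF// onepexp_gt0.
  apply: (@continuous_comp _ _ _ (fun t => 1 + expR (- t)) (fun x : R => x ^+ 2)).
    apply/differentiable_continuous/derivable1_diffP.
    by apply: ex_derive; exact: is_derive_onepexp.
  exact: exprn_continuous.
exact: continuous_measurable_fun.
Qed.

End profiles.

(** * Integration by parts on a box *)

Section ibp_profile.
Context {R : realType}.
Notation leb n := (lebesgue_Rn R n).

Lemma dot_ins1 n (k : 'I_n.+1) (gam : 'cV[R]_n.+1) x (w : Rn R n) :
  dot gam (ins1 k x w) = gam k 0 * x + dot (row' k gam) (colv w).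
Proof.
rewrite !dotE (bigD1_ord k)//= ins1_same; congr (_ + _).
by apply: eq_bigr => i _; rewrite ins1_other row1E.
Qed.

Lemma sqnorm_ins1 n (k : 'I_n.+1) x (w : Rn R n) :
  dot (ins1 k x w) (ins1 k x w) = x ^+ 2 + dot (colv w) (colv w).
Proof.
rewrite !dotE (bigD1_ord k)//= ins1_same; congr (_ + _).
by apply: eq_bigr => i _; rewrite ins1_other.
Qed.

(** A generator times a skewing factor.  Both are parameters because
    integration by parts moves A along GGbar, Gbar, g and K along J, J', J''. *)
Definition profile (A K : R -> R) n (gam z : 'cV[R]_n) : R :=
  A (dot z z / 2) * K (dot gam z).

Lemma is_derive_profile (A A' K K' : R -> R) n (k : 'I_n.+1) gam (x : R) (w : Rn R n) :
  (forall t : R, is_derive t 1 A (- A' t)) -> (forall t : R, is_derive t 1 K (K' t)) ->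
  is_derive x 1 (fun x => profile A K gam (ins1 k x w))
    (- (x * profile A' K gam (ins1 k x w)) + gam k 0 * profile A K' gam (ins1 k x w)).
Proof.
move=> dA dK; set c := dot (colv w) (colv w); set d := dot (row' k gam) (colv w).
have Dsq : is_derive x 1 (fun x : R => (x ^+ 2 + c) / 2) x.
  have -> : (fun x : R => (x ^+ 2 + c) / 2) = (2^-1 \*: ((id : R -> R) ^+ 2 + cst c) : R -> R).
    by apply/funext => y; rewrite /= mulrC.
  apply: is_derive_eq; rewrite addr0 /GRing.scale/=; by field.
have Dli : is_derive x 1 (fun x : R => gam k 0 * x + d) (gam k 0).
  have -> : (fun x : R => gam k 0 * x + d) = ((gam k 0) \*: (id : R -> R) + cst d : R -> R).
    by apply/funext => y.
  by apply: is_derive_eq; rewrite addr0 /GRing.scale/= mulr1.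
have DA := @is_derive1_comp R A (fun x : R => (x ^+ 2 + c) / 2) x _ _ (dA _) Dsq.
have DK := @is_derive1_comp R K (fun x : R => gam k 0 * x + d) x _ _ (dK _) Dli.
have DM := is_deriveM DA DK.
have -> : (fun x => profile A K gam (ins1 k x w)) =
   (A \o (fun x : R => (x ^+ 2 + c) / 2)) * (K \o (fun x : R => gam k 0 * x + d)).
  by apply/funext => y; rewrite /profile sqnorm_ins1 dot_ins1.
apply: (is_derive_eq DM).
by rewrite /profile sqnorm_ins1 dot_ins1 /GRing.scale/= -/c -/d; ring.
Qed.

(** [box_ibp] for - p * profile A K, by the product rule: A' comes with the
    factor z_k, K' with the factor gam_k.  The weight p is a constant or a
    coordinate in the applications. *)
Lemma integral_by_parts_profile n (k : 'I_n.+1) (u v gam : 'cV[R]_n.+1)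
    (A A' K K' : R -> R) (p p' : 'cV[R]_n.+1 -> R) :
  u k 0 <= v k 0 ->
  (forall t : R, is_derive t 1 A (- A' t)) -> (forall t : R, is_derive t 1 K (K' t)) ->
  (forall (x : R) w, is_derive x 1 (fun x => p (ins1 k x w)) (p' (ins1 k x w))) ->
  measurable_fun setT (fun w : Rn R n.+1 => p (colv w) * profile A K gam (colv w)) ->
  let B := colv @^-1` box u v in
  (leb n.+1).-integrable B
    (EFin \o (fun w => p (colv w) * (colv w k 0 * profile A' K gam (colv w)))) ->
  (leb n.+1).-integrable B
    (EFin \o (fun w => p' (colv w) * profile A K gam (colv w))) ->
  (leb n.+1).-integrable B
    (EFin \o (fun w => p (colv w) * profile A K' gam (colv w))) ->
  let face x w := p (ins1 k x w) * profile A K gam (ins1 k x w) in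
  (leb n).-integrable (box1 u v k) (EFin \o face (u k 0)) ->
  (leb n).-integrable (box1 u v k) (EFin \o face (v k 0)) ->
  \int[leb n.+1]_(w in B) (p (colv w) * (colv w k 0 * profile A' K gam (colv w))) =
  \int[leb n]_(w in box1 u v k) face (u k 0) w
  - \int[leb n]_(w in box1 u v k) face (v k 0) w
  + \int[leb n.+1]_(w in B) (p' (colv w) * profile A K gam (colv w))
  + gam k 0 * \int[leb n.+1]_(w in B) (p (colv w) * profile A K' gam (colv w)).
Proof.
move=> uv dA dK dp mpA B i1 i2 i3 face iu iv.
have mB : measurable B by exact: measurable_box.
pose f z := (-1) * (p z * profile A K gam z).
pose f' z := p z * (z k 0 * profile A' K gam z) - p' z * profile A K gam z
  - gam k 0 * (p z * profile A K' gam z).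
have i3g := integrable_EFinZ (gam k 0) mB i3.
have i12 := integrable_EFinB mB i1 i2.
have mB1 := measurable_box1 u v k.
have IBP : \int[leb n.+1]_(w in B) f' (colv w) =
    \int[leb n]_(w in box1 u v k) (f (ins1 k (v k 0) w) - f (ins1 k (u k 0) w)).
  apply: box_ibp => //.
  - move=> x w; have DP := is_derive_profile k gam x w dA dK.
    have DM := is_deriveZ (-1) (is_deriveM (dp x w) DP).
    apply: (is_derive_eq DM).
    by rewrite /f' ins1_same /GRing.scale/=; ring.
  - exact: measurable_funM.
  - exact: integrable_EFinB mB i12 i3g.
have L : \int[leb n.+1]_(w in B) f' (colv w) =
   \int[leb n.+1]_(w in B) (p (colv w) * (colv w k 0 * profile A' K gam (colv w)))
   - \int[leb n.+1]_(w in B) (p' (colv w) * profile A K gam (colv w))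
   - gam k 0 * \int[leb n.+1]_(w in B) (p (colv w) * profile A K' gam (colv w)).
  by rewrite /f' RintegralB// RintegralB// RintegralZl.
have L' : \int[leb n]_(w in box1 u v k) (f (ins1 k (v k 0) w) - f (ins1 k (u k 0) w)) =
  \int[leb n]_(w in box1 u v k) face (u k 0) w
  - \int[leb n]_(w in box1 u v k) face (v k 0) w.
  rewrite -RintegralB//; apply: eq_Rintegral => w _.
  by rewrite /f /face; ring.
by move: IBP; rewrite L L' => /eqP; rewrite subr_eq => /eqP; lra.
Qed.

End ibp_profile.

Section admissible.
Context {R : realType}.
Notation leb n := (lebesgue_Rn R n).

(** Boundedness is required on the closed box, so that it passes to all the
    faces. *)
Definition admissible n (u v : 'cV[R]_n) (f : 'cV[R]_n -> R) : Prop :=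
  measurable_fun setT (fun w : Rn R n => f (colv w)) /\
  exists M, forall z : 'cV[R]_n, (forall i, u i 0 <= z i 0 <= v i 0) -> `|f z| <= M.

Section lemmas.
Variables (n : nat) (u v : 'cV[R]_n).
Implicit Types f h : 'cV[R]_n -> R.

Lemma admissible_cst c : admissible u v (fun=> c).
Proof. by split; [exact: measurable_cst|exists `|c|]. Qed.

Lemma admissibleM f h : admissible u v f -> admissible u v h ->
  admissible u v (fun z => f z * h z).
Proof.
move=> [mf [M fM]] [mh [N hN]]; split; first exact: measurable_funM.
by exists (M * N) => z zB; rewrite normrM ler_pM//; [exact: fM|exact: hN].
Qed.

Lemma admissible_coord i : admissible u v (fun z => z i 0).
Proof.
split; first exact: measurable_colv.
exists (`|u i 0| + `|v i 0|) => z /(_ i) /andP[uz zv].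
have := ler_norm (v i 0); have := ler_norm (- u i 0); rewrite normrN => h1 h2.
have := normr_ge0 (u i 0); have := normr_ge0 (v i 0).
by rewrite ler_norml; lra.
Qed.

Lemma measurable_dot (c : 'cV[R]_n) :
  measurable_fun setT (fun w : Rn R n => dot c (colv w)).
Proof.
under eq_fun do rewrite dotE.
by apply: measurable_sum => i; apply: measurable_funM => //; exact: measurable_colv.
Qed.

Lemma measurable_sqnorm : measurable_fun setT (fun w : Rn R n => dot (colv w) (colv w)).
Proof.
under eq_fun do rewrite dotE.
by apply: measurable_sum => i; apply: measurable_funM; exact: measurable_colv.
Qed.

Lemma sqnorm_ge0 (z : 'cV[R]_n) : 0 <= dot z z.
Proof. by rewrite dotE sumr_ge0// => i _; rewrite -expr2 sqr_ge0. Qed.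

Lemma admissible_radial (A : R -> R) M : measurable_fun setT A ->
  (forall t, 0 <= t -> `|A t| <= M) -> admissible u v (fun z => A (dot z z / 2)).
Proof.
move=> mA AM; split.
  apply: (measurableT_comp mA); apply: measurable_funM => //.
  exact: measurable_sqnorm.
by exists M => z _; apply: AM; rewrite divr_ge0// sqnorm_ge0.
Qed.

Lemma continuous_bounded (K : R -> R) (C : R) : continuous K ->
  exists M, forall t, `|t| <= C -> `|K t| <= M.
Proof.
move=> cK.
have [C0|C0] := leP 0 C; last first.
  by exists 0 => t tC; have := normr_ge0 t; lra.
have cN : {within `[- C, C], continuous (fun t => `|K t|)}.
  apply: continuous_subspaceT => t.
  by apply: continuous_comp; [exact: cK|exact: norm_continuous].
have [|c _ Hc] := EVT_max _ cN; first by lra.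
by exists `|K c| => t; rewrite ler_norml => tC; apply: Hc; rewrite in_itv.
Qed.

(** A differentiable K is continuous, and gam . z stays in a compact interval
    when z runs through the box. *)
Lemma admissible_linear (K K' : R -> R) (gam : 'cV[R]_n) :
  (forall t : R, is_derive t 1 K (K' t)) -> admissible u v (fun z => K (dot gam z)).
Proof.
move=> dK; split.
  apply: (measurableT_comp (derivable_measurable dK)).
  exact: measurable_dot.
have cK : continuous K.
  by move=> t; apply/differentiable_continuous/derivable1_diffP; apply: ex_derive.
have [M HM] := continuous_bounded
  (\sum_i `|gam i 0| * (`|u i 0| + `|v i 0|)) cK.
exists M => z zB; apply: HM; rewrite dotE.
apply: le_trans (ler_norm_sum _ _ _) _; apply: ler_sum => i _.
rewrite normrM ler_wpM2l//.
have /andP[uz zv] := zB i.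
have := ler_norm (v i 0); have := ler_norm (- u i 0); rewrite normrN => h1 h2.
have := normr_ge0 (u i 0); have := normr_ge0 (v i 0).
by rewrite ler_norml; lra.
Qed.

Lemma admissible_integrable f : admissible u v f ->
  (leb n).-integrable (colv @^-1` box u v) (EFin \o (fun w => f (colv w))).
Proof.
move=> [mf [M fM]].
apply: (integrable_bounded (M := M)).
- exact: measurable_box.
- exact: box_fin.
- exact: measurable_funTS.
- by move=> w wB; apply: fM => i; have /andP[/ltW -> ->] := wB i.
Qed.

Lemma admissible_integrableM f h : admissible u v f ->
  (leb n).-integrable (colv @^-1` box u v) (EFin \o (fun w => h (colv w))) ->
  (leb n).-integrable (colv @^-1` box u v) (EFin \o (fun w => f (colv w) * h (colv w))).
Proof.
move=> [mf [M fM]] hi.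
apply: (integrable_EFinM_bounded (M := M)) => //.
- exact: measurable_box.
- exact: measurable_funTS.
- by move=> w wB; apply: fM => i; have /andP[/ltW -> ->] := wB i.
Qed.

End lemmas.

Lemma admissible_face n (u v : 'cV[R]_n.+1) (k : 'I_n.+1) x f :
  u k 0 <= x <= v k 0 -> admissible u v f ->
  (leb n).-integrable (box1 u v k) (EFin \o (fun w => f (ins1 k x w))).
Proof.
move=> xuv [mf [M fM]].
apply: (integrable_bounded (M := M)).
- by have H := measurable_box1 u v k; exact H.
- by rewrite box1E; exact: box_fin.
- apply: measurable_funTS.
  apply: (@measurable_comp_colv _ _ _ _ _ _ (fun w : Rn R n => ins1 k x w)) mf => i.
  by apply: measurable_ins1.
- rewrite box1E => w wB; apply: fM => i.
  case: (unliftP k i) => [j ->|->]; last by rewrite ins1_same.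
  by rewrite ins1_other -!row1E; have /andP[/ltW -> ->] := wB j.
Qed.

(** The integrability conditions are automatic, except the one on K': when
    K = J' the derivative K' = J'' need not be bounded on the box. *)
Lemma integral_by_parts_admissible n (k : 'I_n.+1) (u v gam : 'cV[R]_n.+1)
    (A A' K K' : R -> R) (p p' : 'cV[R]_n.+1 -> R) :
  u k 0 <= v k 0 ->
  (forall t : R, is_derive t 1 A (- A' t)) -> measurable_fun setT A' ->
  (forall t, 0 <= t -> `|A t| <= 1) -> (forall t, 0 <= t -> `|A' t| <= 1) ->
  (forall t : R, is_derive t 1 K (K' t)) ->
  (forall (x : R) w, is_derive x 1 (fun x => p (ins1 k x w)) (p' (ins1 k x w))) ->
  admissible u v p -> admissible u v p' ->
  (leb n.+1).-integrable (colv @^-1` box u v)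
    (EFin \o (fun w => K' (dot gam (colv w)))) ->
  \int[leb n.+1]_(w in colv @^-1` box u v)
     (p (colv w) * (colv w k 0 * profile A' K gam (colv w))) =
  \int[leb n]_(w in box1 u v k)
     (p (ins1 k (u k 0) w) * profile A K gam (ins1 k (u k 0) w))
  - \int[leb n]_(w in box1 u v k)
     (p (ins1 k (v k 0) w) * profile A K gam (ins1 k (v k 0) w))
  + \int[leb n.+1]_(w in colv @^-1` box u v) (p' (colv w) * profile A K gam (colv w))
  + gam k 0 * \int[leb n.+1]_(w in colv @^-1` box u v)
     (p (colv w) * profile A K' gam (colv w)).
Proof.
move=> uv dA mA' bA bA' dK dp ap ap' iK'.
have dNA (t : R) : is_derive t 1 A ((fun t => - A' t) t) by exact: dA.
have adA := admissible_radial u v (derivable_measurable dNA) bA.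
have adA' := admissible_radial u v mA' bA'.
have adK := admissible_linear u v gam dK.
have apA := admissibleM ap (admissibleM adA adK).
apply: integral_by_parts_profile => //.
- exact: apA.1.
- exact: (admissible_integrable
    (admissibleM ap (admissibleM (admissible_coord u v k) (admissibleM adA' adK)))).
- exact: (admissible_integrable (admissibleM ap' (admissibleM adA adK))).
- have := @admissible_integrableM _ u v _ (fun z => K' (dot gam z)) (admissibleM ap adA) iK'.
  by apply: eq_integrable; [exact: measurable_box|move=> w _ /=; rewrite /profile mulrA].
- by apply: (admissible_face (x := u k 0) _ apA); rewrite lexx.
- by apply: (admissible_face (x := v k 0) _ apA); rewrite lexx andbT.
Qed.

End admissible.

(** * Moments on a box as face and corner integrals *)

Section moments.
Context {R : realType}.
Notation leb n := (lebesgue_Rn R n).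

Lemma ins2E n (i : 'I_n.+2) (j : 'I_n.+1) x y (w : Rn R n) :
  ins2 i (lift i j) x y w = ins1 i x (tupc (ins1 j y w)).
Proof.
apply/colP => l; case: (unliftP i l) => [l' ->|->]; last by rewrite ins1_same mxE eqxx.
rewrite ins1_other tupcK [LHS]mxE eq_sym (negbTE (neq_lift i l')).
have -> : (lift i l' - (i < lift i l'))%N = l'.
  rewrite /= /bump; case: (leqP i l') => il; first by rewrite add1n ltnS il subn1.
  by rewrite add0n ltnNge (ltnW il) subn0.
rewrite mxE (inj_eq lift_inj).
case: eqVneq => // lj; congr nth; congr (_ - _)%N.
by rewrite /= !ltnNge leq_bump2.
Qed.

Lemma box2E n (u v : 'cV[R]_n.+2) (i : 'I_n.+2) (j : 'I_n.+1) :
  box2 u v i (lift i j) = box1 (row' i u) (row' i v) j.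
Proof.
apply/seteqP; split => w H.
  move=> l lj; have := H (lift i l).
  rewrite eq_sym neq_lift (inj_eq lift_inj) lj => /(_ isT isT).
  by rewrite ins2E ins1_other tupcK !row1E.
move=> l li lij; case: (unliftP i l) li lij => [l' ->|->]; last by rewrite eqxx.
rewrite (inj_eq lift_inj) => _ lj; have := H l' lj.
by rewrite ins2E ins1_other tupcK !row1E.
Qed.

Lemma is_derive_ins1_coord n (k l : 'I_n.+1) (x : R) (w : Rn R n) :
  is_derive x 1 (fun x => ins1 k x w l 0) (l == k)%:R.
Proof.
under eq_fun do rewrite mxE.
case: eqVneq => _; [exact: is_derive_id|exact: is_derive_cst].
Qed.

Lemma is_derive_comp_addr (f f' : R -> R) (c t : R) :
  (forall t : R, is_derive t 1 f (f' t)) -> is_derive t 1 (fun t => f (t + c)) (f' (t + c)).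
Proof.
move=> df.
have Dt : is_derive t 1 (fun t : R => t + c) 1.
  have H := is_deriveD (is_derive_id t 1) (is_derive_cst c t 1).
  by rewrite addr0 in H; exact H.
have H := @is_derive1_comp R f (fun t : R => t + c) t _ _ (df _) Dt.
by rewrite mulr1 in H; exact H.
Qed.

Variables (m : nat) (u v gam : 'cV[R]_m.+2) (J J1 J2 : R -> R).
Hypothesis uv : forall k, u k 0 <= v k 0.
Hypothesis dJ : forall t : R, is_derive t 1 J (J1 t).
Hypothesis dJ1 : forall t : R, is_derive t 1 J1 (J2 t).

Let B := (@colv R m.+2) @^-1` box u v.

Definition face_integral (G h : R -> R) (k : 'I_m.+2) (x : R) : R :=
  \int[leb m.+1]_(w in box1 u v k)
    (h (dot gam (ins1 k x w)) * G (dot (colv w) (colv w) / 2 + x ^+ 2 / 2)).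

Definition corner_integral (G h : R -> R) (k l : 'I_m.+2) (x y : R) : R :=
  \int[leb m]_(w in box2 u v k l)
    (h (dot gam (ins2 k l x y w)) *
     G (dot (colv w) (colv w) / 2 + x ^+ 2 / 2 + y ^+ 2 / 2)).

Lemma face_profile (G h : R -> R) (k : 'I_m.+2) (x : R) (w : Rn R m.+1) :
  profile G h gam (ins1 k x w) =
  h (dot gam (ins1 k x w)) * G (dot (colv w) (colv w) / 2 + x ^+ 2 / 2).
Proof. by rewrite /profile sqnorm_ins1 mulrC; congr (_ * G _); ring. Qed.

Let bg (t : R) : 0 <= t -> `|g t| <= 1.
Proof. by move=> _; have /andP[? ?] := g_le1 t; rewrite ger0_norm. Qed.

Let bG (t : R) : 0 <= t -> `|Gbar t| <= 1.
Proof. by move=> _; have /andP[? ?] := Gbar_le1 t; rewrite ger0_norm. Qed.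

Let bGG (t : R) : 0 <= t -> `|GGbar t| <= 1.
Proof. by move=> /GGbar_le1 /andP[? ?]; rewrite ger0_norm. Qed.

Let mG : measurable_fun setT (@Gbar R).
Proof.
exact: (@derivable_measurable R Gbar (fun t => - g t) is_derive_Gbar).
Qed.

Let dcst1 (k : 'I_m.+2) (x : R) (w : Rn R m.+1) :
  is_derive x 1 (fun x : R => (fun _ : 'cV[R]_m.+2 => 1 : R) (ins1 k x w)) 0.
Proof. exact: is_derive_cst. Qed.

Let integrable_linear (K K' : R -> R) : (forall t : R, is_derive t 1 K (K' t)) ->
  (leb m.+2).-integrable B (EFin \o (fun w => K (dot gam (colv w)))).
Proof. by move=> dK; exact: (admissible_integrable (admissible_linear u v gam dK)). Qed.

(** Integration by parts with weight 1: as A' = - dA/dt, the product of z_k and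
    profile A' K is minus the part of the derivative in z_k of profile A K that
    does not differentiate K. *)
Lemma coord_moment (A A' K K' : R -> R) k :
  (forall t : R, is_derive t 1 A (- A' t)) -> measurable_fun setT A' ->
  (forall t, 0 <= t -> `|A t| <= 1) -> (forall t, 0 <= t -> `|A' t| <= 1) ->
  (forall t : R, is_derive t 1 K (K' t)) ->
  (leb m.+2).-integrable B (EFin \o (fun w => K' (dot gam (colv w)))) ->
  \int[leb m.+2]_(w in B) (colv w k 0 * profile A' K gam (colv w)) =
  face_integral A K k (u k 0) - face_integral A K k (v k 0)
  + gam k 0 * \int[leb m.+2]_(w in B) profile A K' gam (colv w).
Proof.
move=> dA mA' bA bA' dK iK'.
have := integral_by_parts_admissible (uv k) dA mA' bA bA' dK (@dcst1 k)
  (admissible_cst u v 1) (admissible_cst u v 0) iK'.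
under eq_Rintegral do rewrite mul1r.
move=> ->; rewrite [X in _ + X + _](_ : _ = 0) ?addr0; last first.
  under eq_Rintegral do rewrite mul0r.
  by rewrite Rintegral_cst ?mul0r//; exact: measurable_box.
rewrite /face_integral; congr (_ - _ + _ * _); apply: eq_Rintegral => w _;
  by rewrite mul1r // face_profile.
Qed.

Lemma first_moment k :
  \int[leb m.+2]_(w in B) (colv w k 0 * profile g J gam (colv w)) =
  face_integral Gbar J k (u k 0) - face_integral Gbar J k (v k 0)
  + gam k 0 * \int[leb m.+2]_(w in B) profile Gbar J1 gam (colv w).
Proof.
exact: (coord_moment k is_derive_Gbar measurable_g bG bg dJ (integrable_linear dJ1)).
Qed.

Lemma first_moment_J1 k :
  (leb m.+2).-integrable B (EFin \o (fun w => J2 (dot gam (colv w)))) ->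
  \int[leb m.+2]_(w in B) (colv w k 0 * profile Gbar J1 gam (colv w)) =
  face_integral GGbar J1 k (u k 0) - face_integral GGbar J1 k (v k 0)
  + gam k 0 * \int[leb m.+2]_(w in B) profile GGbar J2 gam (colv w).
Proof.
exact: (coord_moment k is_derive_GGbar mG bGG bG dJ1).
Qed.

(** On the face z_i = x, the squared norm and the linear form are those of the
    remaining coordinates shifted by x ^ 2 and gam_i x; so this is an
    integration by parts in dimension m + 1, for the shifted functions. *)
Lemma face_first_moment (i : 'I_m.+2) (j : 'I_m.+1) (x : R) :
  \int[leb m.+1]_(w in box1 u v i)
     (ins1 i x w (lift i j) 0 * profile Gbar J gam (ins1 i x w)) =
  corner_integral GGbar J i (lift i j) x (u (lift i j) 0)
  - corner_integral GGbar J i (lift i j) x (v (lift i j) 0)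
  + gam (lift i j) 0 * face_integral GGbar J1 i x.
Proof.
pose c := x ^+ 2 / 2; pose d := gam i 0 * x.
pose sh (h : R -> R) s t := h (t + s).
have c0 : 0 <= c by rewrite divr_ge0// sqr_ge0.
have bsh (h : R -> R) : (forall t, 0 <= t -> `|h t| <= 1) ->
    forall t, 0 <= t -> `|sh h c t| <= 1.
  by move=> hb t t0; apply: hb; rewrite addr_ge0.
have profE (G h : R -> R) (w : Rn R m.+1) :
    profile (sh G c) (sh h d) (row' i gam) (colv w) = profile G h gam (ins1 i x w).
  rewrite /profile sqnorm_ins1 dot_ins1 /sh addrC (addrC _ d).
  by congr (G _ * _); rewrite mulrDl addrC.
have msh : measurable_fun setT (sh Gbar c).
  by apply: (measurableT_comp mG); exact: measurable_funD.
have dGG (t : R) : is_derive t 1 (sh GGbar c) (- sh Gbar c t).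
  exact: (@is_derive_comp_addr GGbar (fun t => - Gbar t) c t is_derive_GGbar).
have dK (t : R) : is_derive t 1 (sh J d) (sh J1 d t) by exact: is_derive_comp_addr.
have dK1 (t : R) : is_derive t 1 (sh J1 d) (sh J2 d t) by exact: is_derive_comp_addr.
have d1 (y : R) (w : Rn R m) :
    is_derive y 1 (fun y : R => (fun _ : 'cV[R]_m.+1 => 1 : R) (ins1 j y w)) 0.
  exact: is_derive_cst.
have uv' : row' i u j 0 <= row' i v j 0 by rewrite !row1E.
have := integral_by_parts_admissible uv' dGG msh (bsh _ bGG) (bsh _ bG) dK d1
  (admissible_cst _ _ 1) (admissible_cst _ _ 0)
  (admissible_integrable (admissible_linear (row' i u) (row' i v) (row' i gam) dK1)).
under eq_Rintegral do rewrite mul1r profE.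
rewrite [X in _ + X + _](_ : _ = 0) ?addr0; last first.
  under eq_Rintegral do rewrite mul0r.
  by rewrite Rintegral_cst ?mul0r//; exact: measurable_box.
rewrite -box1E => H.
under eq_Rintegral do rewrite ins1_other.
rewrite H !row1E /corner_integral /face_integral !box2E.
congr (_ - _ + _ * _); apply: eq_Rintegral => w _; rewrite mul1r.
- rewrite -{1}(tupcK (ins1 j (u (lift i j) 0) w)) profE -ins2E.
  by rewrite /profile ins2E sqnorm_ins1 tupcK sqnorm_ins1 mulrC; congr (_ * GGbar _); ring.
- rewrite -{1}(tupcK (ins1 j (v (lift i j) 0) w)) profE -ins2E.
  by rewrite /profile ins2E sqnorm_ins1 tupcK sqnorm_ins1 mulrC; congr (_ * GGbar _); ring.
- by rewrite profE face_profile.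
Qed.

Hypothesis iJ2 : (leb m.+2).-integrable B (EFin \o (fun w => J2 (dot gam (colv w)))).

(** Integrating by parts in z_i with weight z_j leaves first moments in z_j,
    evaluated on the two faces by [face_first_moment] and in the interior by
    [first_moment_J1]. *)
Lemma second_moment_off i j : i != j ->
  \int[leb m.+2]_(w in B) (colv w j 0 * (colv w i 0 * profile g J gam (colv w))) =
  (corner_integral GGbar J i j (u i 0) (u j 0)
   - corner_integral GGbar J i j (u i 0) (v j 0)
   + gam j 0 * face_integral GGbar J1 i (u i 0))
  - (corner_integral GGbar J i j (v i 0) (u j 0)
   - corner_integral GGbar J i j (v i 0) (v j 0)
   + gam j 0 * face_integral GGbar J1 i (v i 0))
  + gam i 0 * (face_integral GGbar J1 j (u j 0) - face_integral GGbar J1 j (v j 0)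
     + gam j 0 * \int[leb m.+2]_(w in B) profile GGbar J2 gam (colv w)).
Proof.
case: (unliftP i j) => [j' jE|->]; last by rewrite eqxx.
move=> ij; rewrite -first_moment_J1//.
have dp (x : R) (w : Rn R m.+1) :
    is_derive x 1 (fun x : R => ins1 i x w j 0) ((fun _ : 'cV[R]_m.+2 => 0 : R) (ins1 i x w)).
  by have := is_derive_ins1_coord i j x w; rewrite eq_sym (negbTE ij).
have := integral_by_parts_admissible (uv i) is_derive_Gbar measurable_g bG bg dJ dp
  (admissible_coord u v j) (admissible_cst u v 0) (integrable_linear dJ1).
rewrite [X in _ + X + _](_ : _ = 0) ?addr0; last first.
  under eq_Rintegral do rewrite mul0r.
  by rewrite Rintegral_cst ?mul0r//; exact: measurable_box.
by move=> ->; rewrite jE !face_first_moment.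
Qed.

(** The weight z_i now has derivative 1, which contributes the mass of
    profile Gbar J; and it is constant on the faces z_i = u_i and z_i = v_i. *)
Lemma second_moment_diag i :
  \int[leb m.+2]_(w in B) (colv w i 0 * (colv w i 0 * profile g J gam (colv w))) =
  u i 0 * face_integral Gbar J i (u i 0) - v i 0 * face_integral Gbar J i (v i 0)
  + \int[leb m.+2]_(w in B) profile Gbar J gam (colv w)
  + gam i 0 * (face_integral GGbar J1 i (u i 0) - face_integral GGbar J1 i (v i 0)
     + gam i 0 * \int[leb m.+2]_(w in B) profile GGbar J2 gam (colv w)).
Proof.
rewrite -first_moment_J1//.
have dp (x : R) (w : Rn R m.+1) :
    is_derive x 1 (fun x : R => ins1 i x w i 0) ((fun _ : 'cV[R]_m.+2 => 1 : R) (ins1 i x w)).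
  by have := is_derive_ins1_coord i i x w; rewrite eqxx.
have := integral_by_parts_admissible (uv i) is_derive_Gbar measurable_g bG bg dJ dp
  (admissible_coord u v i) (admissible_cst u v 1) (integrable_linear dJ1).
move=> ->.
have adp : admissible u v (fun z => profile Gbar J gam z).
  apply: admissibleM; last exact: (admissible_linear u v gam dJ).
  exact: (admissible_radial u v mG bG).
have faceE x : u i 0 <= x <= v i 0 ->
    \int[leb m.+1]_(w in box1 u v i) (ins1 i x w i 0 * profile Gbar J gam (ins1 i x w)) =
    x * face_integral Gbar J i x.
  move=> xuv; rewrite /face_integral; under eq_Rintegral do rewrite ins1_same.
  rewrite RintegralZl//; last 2 first.
  - by have H := measurable_box1 u v i; exact H.
  - exact: (admissible_face xuv adp).
  by congr (_ * _); apply: eq_Rintegral => w _; rewrite face_profile.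
rewrite !faceE ?lexx ?uv//.
by congr (_ + _ + _); apply: eq_Rintegral => w _; rewrite mul1r.
Qed.

End moments.

(** * Radial integrals *)

Section radial.
Context {R : realType}.
Notation lam := (@lebesgue_measure R).
Notation leb n := (lebesgue_Rn R n).

(** The integrand may be unbounded at 0, so this is the increasing limit of the
    integrals over [s / (i + 2), s]. *)
Lemma integral_powR (p s : R) : 0 < p -> 0 < s ->
  (\int[lam]_(r in `]0%R, s]) (r `^ (p - 1))%:E = (s `^ p / p)%:E)%E.
Proof.
move=> p0 s0.
pose a (i : nat) : R := s * i.+2%:R^-1.
have a0 i : 0 < a i by rewrite mulr_gt0// invr_gt0.
have as_ i : a i < s.
  by rewrite /a -[ltRHS]mulr1 ltr_pM2l// invf_lt1// ltr1n.
have E : `]0, s]%classic = \bigcup_i `[a i, s]%classic.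
  apply/seteqP; split => x /=; rewrite in_itv/=; last first.
    by move=> [i _] /=; rewrite in_itv/= => /andP[/(lt_le_trans (a0 i)) -> ->].
  move=> /andP[x0 xs].
  exists (Num.truncn (s / x)) => //=; rewrite in_itv/= xs andbT /a.
  rewrite ler_pdivrMr ?ltr0n// mulrC -ler_pdivrMr//.
  apply: (le_trans (ltW (truncnS_gt _))).
  by rewrite ler_nat.
have F1 i : (\int[lam]_(r in `[a i, s]) (r `^ (p - 1))%:E =
    (s `^ p / p)%:E - (a i `^ p / p)%:E)%E.
  have ct (q x : R) : 0 < x -> {for x, continuous (fun r : R => r `^ q)}.
    move=> x0; apply/differentiable_continuous/derivable1_diffP.
    by apply: derivable_powR; rewrite in_itv/= x0.
  have dF (x : R) : 0 < x -> is_derive x 1 (fun r : R => r `^ p / p) (x `^ (p - 1)).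
    move=> x0.
    have D1 : derivable (fun r : R => r `^ p) x 1.
      by apply: derivable_powR; rewrite in_itv/= x0.
    have E1 : (fun r : R => r `^ p)^`()%classic x = p * x `^ (p - 1).
      by apply: powR_derive1; rewrite in_itv/= x0.
    have DD : is_derive x 1 (fun r : R => r `^ p) (p * x `^ (p - 1)).
      by apply: DeriveDef => //; rewrite -derive1E.
    have := is_deriveZ p^-1 DD.
    rewrite /GRing.scale/= mulrA mulVf ?gt_eqF// mul1r.
    by rewrite (_ : (_ \*: _) = fun r : R => r `^ p / p)//; apply/funext => r; rewrite mulrC.
  apply: (@continuous_FTC2 _ (fun r : R => r `^ (p - 1)) (fun r : R => r `^ p / p)) => //.
  - apply: continuous_in_subspaceT => x /[!inE]/=; rewrite in_itv/= => /andP[ax _].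
    by apply: ct; rewrite (lt_le_trans _ ax).
  - split.
    + move=> x; rewrite in_itv/= => /andP[ax _].
      by apply: ex_derive; apply: dF; rewrite (lt_trans _ ax).
    + apply: cvg_at_right_filter; apply: cvgM; last exact: cvg_cst.
      exact: ct.
    + apply: cvg_at_left_filter; apply: cvgM; last exact: cvg_cst.
      exact: ct.
  - move=> x; rewrite in_itv/= => /andP[ax _].
    have x0 : 0 < x by rewrite (lt_trans _ ax).
    by rewrite derive1E; exact: (derive_val (is_derive := dF _ x0)).
rewrite E.
have L : (\int[lam]_(x in `[a i, s]) (x `^ (p - 1))%:E)%E @[i --> \oo] -->
   (\int[lam]_(x in \bigcup_i [set` `[a i, s]]) (x `^ (p - 1))%:E)%E.
  apply: (@ge0_nondecreasing_set_cvg_integral _ (measurableTypeR R) R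
    (fun i => `[a i, s]%classic)).
  - move=> i j ij; apply/subsetPset => x /=; rewrite !in_itv/= => /andP[ax ->].
    rewrite andbT (le_trans _ ax)// /a ler_pM2l// lef_pV2 ?posrE ?ltr0n//.
    by rewrite ler_nat.
  - by move=> i; exact: measurable_itv.
  - by move=> i; apply/measurable_EFinP/measurable_funTS; exact: measurable_powR.
  - by move=> i x _; rewrite lee_fin powR_ge0.
apply: cvg_unique L _ => //.
have -> : (fun i => \int[lam]_(x in `[a i, s]) (x `^ (p - 1))%:E)%E =
   EFin \o (fun i => s `^ p / p - (s `^ p * (i.+2%:R^-1 `^ p)) / p).
  apply/funext => i; rewrite F1 /= -EFinB /a powRM ?invr_ge0 ?ltW//.
apply: cvg_EFin; first by near=> i.
rewrite [X in _ --> X](_ : _ = s `^ p / p - (s `^ p * 0) / p); last first.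
  by rewrite mulr0 mul0r subr0.
apply: cvgB; first exact: cvg_cst.
apply: cvgM; last exact: cvg_cst.
apply: cvgM; first exact: cvg_cst.
apply: (cvg_comp _ _ _ (powR_cvg0 p0)).
move=> U [e /= e0 HU]; exists (Num.truncn e^-1) => // i /= Ni.
apply: HU; last by rewrite invr_gt0.
rewrite /= sub0r normrN ger0_norm ?invr_ge0//.
rewrite -[ltRHS]invrK ltf_pV2 ?posrE ?invr_gt0//.
by apply: (lt_le_trans (truncnS_gt _)); rewrite ler_nat ltnS (leq_trans Ni).
Unshelve. all: by end_near.
Qed.

Section layer_cake.
Variables (d : nat) (h k : R -> R).
Hypothesis d0 : (0 < d)%N.
Hypothesis mk : measurable_fun setT k.
Hypothesis k0 : forall s, 0 <= s -> 0 <= k s.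
Hypothesis hk : forall r, 0 <= r ->
  ((h r)%:E = \int[lam]_(s in `[r, +oo[) (k s)%:E)%E.

Let p : R := d%:R / 2.
Let p0 : 0 < p. Proof. by rewrite divr_gt0// ltr0n. Qed.

(* k is controlled for s >= 0 only; the point 0 is negligible *)
Let kp (s : R) : R := if 0 < s then k s else 0.

Let kp0 s : 0 <= kp s.
Proof. by rewrite /kp; case: ifP => // /ltW /k0. Qed.

Let mkp : measurable_fun setT kp.
Proof.
rewrite /kp; apply: measurable_fun_if => //.
- by apply: measurable_fun_ltr.
- exact: measurable_funTS.
Qed.

Let hkp r : 0 <= r -> ((h r)%:E = \int[lam]_s (kp s * (r <= s)%R%:R)%:E)%E.
Proof.
move=> r0; rewrite (hk r0).
transitivity (\int[lam]_(s in `[r, +oo[) (kp s)%:E)%E.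
  rewrite -[LHS]integral_itv_obnd_cbnd; last exact/measurable_EFinP/measurable_funTS.
  rewrite -[RHS]integral_itv_obnd_cbnd; last exact/measurable_EFinP/measurable_funTS.
  apply: eq_integral => s; rewrite inE/= in_itv/= andbT => rs.
  by rewrite /kp (le_lt_trans r0 rs).
rewrite integral_mkcond; apply: eq_integral => s _.
rewrite patchE; case: (boolP (r <= s)) => rs; rewrite ?mulr1 ?mulr0.
  by rewrite mem_set//= in_itv/= rs.
by rewrite memNset//= in_itv/= andbT; exact/negP.
Qed.

(** Balls are indexed by the variable |w|^2 / 2 of the generators, not by the
    radius. *)
Definition qball (s : R) : set (Rn R d) := [set w | dot (colv w) (colv w) / 2 <= s].

Definition ball_volume : \bar R := leb d (qball 1).

Let J := (\int[lam]_s (kp s * s `^ p)%:E)%E.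

Lemma measurable_qball (s : R) : measurable (qball s).
Proof.
rewrite (_ : qball s = (fun w : Rn R d => dot (colv w) (colv w) / 2) @^-1` `]-oo, s]%classic).
  rewrite -[X in measurable X]setTI; apply: measurable_funM => //.
  exact: measurable_sqnorm.
by apply/seteqP; split => w /=; rewrite in_itv.
Qed.

Lemma indic_qball (t : R) (w : Rn R d) :
  \1_(qball t) w = (dot (colv w) (colv w) / 2 <= t)%R%:R :> R.
Proof.
rewrite indicE; congr (nat_of_bool _)%:R.
by apply/idP/idP => [/set_mem|H] //; apply: mem_set.
Qed.

Lemma dotZZ n (c : R) (z : 'cV[R]_n) : dot (c *: z) (c *: z) = c ^+ 2 * dot z z.
Proof.
by rewrite !dotE mulr_sumr; apply: eq_bigr => i _; rewrite !mxE; ring.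
Qed.

Lemma ball_volume_scale (s : R) : 0 < s ->
  (leb d (qball s) = (s `^ p)%:E * ball_volume)%E.
Proof.
move=> s0.
have q0 : 0 < Num.sqrt s by rewrite sqrtr_gt0.
pose M : 'M[R]_d := (Num.sqrt s)%:M.
have pM : posdef M.
  split; first by rewrite tr_scalar_mx.
  by move=> x x0; rewrite mul_scalar_mx /dot -scalemxAr mxE -/(dot x x) mulr_gt0// sqnorm_gt0.
pose F (z : 'cV[R]_d) : \bar R := ((dot z z / 2 <= s)%R%:R)%:E.
have FE (t : R) : (\int[leb d]_w ((dot (colv w) (colv w) / 2 <= t)%R%:R)%:E =
    leb d (qball t))%E.
  rewrite -(setIT (qball t)) -integral_indic//; last exact: measurable_qball.
  by apply: eq_integral => w _; rewrite indic_qball.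
rewrite -FE (lebesgue_Rn_posdef (F := F) 0 pM); last 2 first.
- apply/measurable_EFinP; rewrite (_ : (fun _ => _) = \1_(qball s)).
    by apply: measurable_indic; exact: measurable_qball.
  by apply/funext => w; rewrite indic_qball.
- by move=> z; rewrite lee_fin.
rewrite det_scalar; congr (_ * _)%E.
  by rewrite /p mulrC powRrM powR12_sqrt ?ltW// powR_mulrn// ltW.
rewrite /ball_volume -FE; apply: eq_integral => w _; congr (_%:R%:E).
rewrite addr0 mul_scalar_mx dotZZ sqr_sqrtr ?(ltW s0)// -mulrA.
by congr nat_of_bool; rewrite -[X in (_ <= X) = _]mulr1 ler_pM2l.
Qed.

Let mprod : measurable_fun setT
  (fun z : measurableTypeR R * Rn R d =>
    (kp z.1 * (dot (colv z.2) (colv z.2) / 2 <= z.1)%R%:R)%:E).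
Proof.
apply/measurable_EFinP; apply: measurable_funM.
  exact: (measurableT_comp mkp measurable_fst).
rewrite (_ : (fun _ => _) =
  \1_((fun z : measurableTypeR R * Rn R d =>
      z.1 - dot (colv z.2) (colv z.2) / 2) @^-1` `[0, +oo[)); last first.
  apply/funext => z; rewrite indicE; congr _%:R.
  congr nat_of_bool; apply/idP/idP => [H|/set_mem].
    by apply: mem_set; rewrite /= in_itv/= subr_ge0 H.
  by rewrite /= in_itv/= subr_ge0 andbT.
apply: measurable_indic; rewrite -[X in measurable X]setTI.
have m1 : measurable_fun setT (fun z : measurableTypeR R * Rn R d => z.1 : R).
  exact: measurable_fst.
have m2 : measurable_fun setT
    (fun z : measurableTypeR R * Rn R d => dot (colv z.2) (colv z.2)).
  exact: (measurableT_comp (@measurable_sqnorm R d) measurable_snd).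
have mq : measurable_fun setT
    (fun z : measurableTypeR R * Rn R d => z.1 - dot (colv z.2) (colv z.2) / 2).
  by apply: measurable_funB => //; exact: measurable_funM.
by apply: mq => //; exact: measurable_itv.
Qed.

(** Write h (|w|^2 / 2) as the integral of k over all s >= |w|^2 / 2 and exchange
    the integrals: the inner one is the volume of a ball, proportional to
    s ^ (d / 2). *)
Lemma layer_cake_Rn :
  (\int[leb d]_w (h (dot (colv w) (colv w) / 2))%:E = ball_volume * J)%E.
Proof.
transitivity (\int[leb d]_w \int[lam]_s
    (kp s * (dot (colv w) (colv w) / 2 <= s)%R%:R)%:E)%E.
  apply: eq_integral => w _; rewrite hkp//.
  by rewrite divr_ge0// sqnorm_ge0.
have E := fubini_tonelli (m1 := lam) (m2 := leb d) _ mprod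
  (fun z => ltac:(by rewrite lee_fin mulr_ge0)).
rewrite /= in E; rewrite -E.
rewrite /J -ge0_integralZl//; last 3 first.
- apply/measurable_EFinP/measurable_funM => //; exact: measurable_powR.
- by move=> s _; rewrite lee_fin mulr_ge0// powR_ge0.
- exact: measure_ge0.
apply: eq_integral => s _.
under eq_integral do rewrite EFinM.
rewrite ge0_integralZl//; last 2 first.
- apply/measurable_EFinP; rewrite (_ : (fun _ => _) = \1_(qball s)).
    by apply: measurable_indic; exact: measurable_qball.
  by apply/funext => w; rewrite indic_qball.
- by rewrite lee_fin.
rewrite /kp; case: ifPn => s0; last by rewrite mul0e mul0r mule0.
rewrite [X in (_ * X)%E](_ : _ = leb d (qball s)).
  by rewrite ball_volume_scale// EFinM muleA muleC.
rewrite -(setIT (qball s)) -integral_indic//; last exact: measurable_qball.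
by apply: eq_integral => w _; rewrite indic_qball.
Qed.

(** The same exchange with the measure r ^ (p - 1) dr on the half line, which
    gives ]0, s] the mass s ^ p / p.  The integral J is common to both
    formulas, so one integral is a constant multiple of the other. *)
Lemma layer_cake_Gamma :
  (\int[lam]_(r in `]0%R, +oo[) (r `^ (p - 1) * h r)%:E = p^-1%:E * J)%E.
Proof.
pose rho (r : measurableTypeR R) : R := if 0 < r then r `^ (p - 1) else 0.
have rho0 r : 0 <= rho r by rewrite /rho; case: ifP => // _; exact: powR_ge0.
have mrho : measurable_fun setT rho.
  have H : measurable_fun setT (fun r : R => if 0 < r then r `^ (p - 1) else 0).
    apply: measurable_fun_if => //.
    - by apply: measurable_fun_ltr.
    - by apply: measurable_funTS; exact: measurable_powR.
  exact: H.
pose G (z : measurableTypeR R * measurableTypeR R) : \bar R :=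
  (rho z.1 * (kp z.2 * (z.1 <= z.2)%R%:R))%:E.
have G0 z : (0 <= G z)%E by rewrite lee_fin !mulr_ge0.
have mG : measurable_fun setT G.
  have m1 : measurable_fun setT (fun z : measurableTypeR R * measurableTypeR R => z.1 : R).
    exact: measurable_fst.
  have m2 : measurable_fun setT (fun z : measurableTypeR R * measurableTypeR R => z.2 : R).
    exact: measurable_snd.
  apply/measurable_EFinP; apply: measurable_funM.
    exact: (measurableT_comp mrho measurable_fst).
  apply: measurable_funM; first exact: (measurableT_comp mkp measurable_snd).
  rewrite (_ : (fun _ => _) =
    \1_((fun z : measurableTypeR R * measurableTypeR R => z.2 - z.1) @^-1` `[0, +oo[)).
    apply: measurable_indic; rewrite -[X in measurable X]setTI.
    by apply: (measurable_funB m2 m1) => //; exact: measurable_itv.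
  apply/funext => z; rewrite indicE; congr _%:R.
  congr nat_of_bool; apply/idP/idP => [H|/set_mem].
    by apply: mem_set; rewrite /= in_itv/= subr_ge0 H.
  by rewrite /= in_itv/= subr_ge0 andbT.
transitivity (\int[lam]_r \int[lam]_s G (r, s))%E.
  rewrite integral_mkcond; apply: eq_integral => r _.
  rewrite patchE /G/= /rho; case: ifPn => [|] r0.
    have {}r0 : 0 < r by have := set_mem r0; rewrite /= in_itv/= andbT.
    rewrite r0 /=; under [RHS]eq_integral do rewrite EFinM.
    rewrite ge0_integralZl//.
    - by rewrite -hkp ?(ltW r0)// EFinM.
    - apply/measurable_EFinP; apply: measurable_funM => //.
      rewrite (_ : (fun _ => _) = \1_(`[r, +oo[%classic : set R)).
        by apply: measurable_indic; exact: measurable_itv.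
      apply/funext => s; rewrite indicE; congr (nat_of_bool _)%:R.
      apply/idP/idP => [H|/set_mem]; last by rewrite /= in_itv/= andbT.
      by apply: mem_set; rewrite /= in_itv/= H.
    - by move=> s _; rewrite lee_fin mulr_ge0.
    - by rewrite lee_fin powR_ge0.
  rewrite ifF; last first.
    by apply/negbTE; apply: contra r0 => r0; apply: mem_set; rewrite /= in_itv/= r0.
  by rewrite integral0_eq// => s _; rewrite mul0r.
have E := fubini_tonelli (m1 := lam) (m2 := lam) G mG G0.
rewrite E /J -ge0_integralZl//; last 3 first.
- apply/measurable_EFinP/measurable_funM => //; exact: measurable_powR.
- by move=> s _; rewrite lee_fin mulr_ge0// powR_ge0.
- by rewrite lee_fin invr_ge0 ltW.
apply: eq_integral => s _; rewrite /G /=.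
have [s0|s0] := ltP 0 s; last first.
  rewrite /kp ltNge s0 /= mul0r mule0 integral0_eq// => r _.
  by rewrite mul0r mulr0.
transitivity (\int[lam]_(r in `]0%R, s]) ((kp s)%:E * (r `^ (p - 1))%:E))%E.
  rewrite [RHS]integral_mkcond; apply: eq_integral => r _.
  rewrite patchE; case: ifPn => r0; rewrite /rho.
    have /andP[r1 rs] : 0 < r <= s by have := set_mem r0; rewrite /= in_itv.
    by rewrite r1 rs mulr1 mulrC EFinM.
  have [r1|] := ltP 0 r; last by rewrite mul0r.
  have [rs|_] := leP r s; last by rewrite !mulr0.
  by exfalso; move/negP : r0; apply; apply: mem_set; rewrite /= in_itv/= r1.
rewrite ge0_integralZl//; last 3 first.
- by apply/measurable_EFinP/measurable_funTS; exact: measurable_powR.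
- by move=> r _; rewrite lee_fin powR_ge0.
- by rewrite lee_fin.
rewrite integral_powR// -!EFinM; congr EFin.
by rewrite /=; ring.
Qed.

End layer_cake.

Lemma gauss_lebesgue1 :
  (\int[lam]_x (expR (- (x ^+ 2 / 2)))%:E = (Num.sqrt (2 * pi))%:E)%E.
Proof.
have pi2 : 0 < Num.sqrt (2 * pi) :> R by rewrite sqrtr_gt0 mulr_gt0// pi_gt0.
have E (x : R) : expR (- (x ^+ 2 / 2)) = Num.sqrt (2 * pi) * normal_pdf 0 1 x.
  rewrite normal_pdfE ?oner_neq0// /normal_peak /normal_fun subr0 expr1n mul1r.
  rewrite -(mulr_natr pi) (mulrC pi) mulrA divff ?gt_eqF// mul1r.
  by rewrite mulNr.
under eq_integral do rewrite E EFinM.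
rewrite ge0_integralZl//; last 2 first.
- apply/measurable_EFinP; exact: measurable_normal_pdf.
- by move=> x _; rewrite lee_fin normal_pdf_ge0.
by rewrite integral_normal_pdf mule1.
Qed.

Lemma measurable_gauss_Rn n :
  measurable_fun setT (fun w : Rn R n => (expR (- (dot (colv w) (colv w) / 2)))%:E).
Proof.
apply/measurable_EFinP.
apply: (measurableT_comp (derivable_measurable (@is_derive_expRN R))).
by apply: measurable_funM => //; exact: measurable_sqnorm.
Qed.

Lemma gauss_lebesgue_Rn n :
  (\int[leb n]_w (expR (- (dot (colv w) (colv w) / 2)))%:E =
   (Num.sqrt (2 * pi) ^+ n)%:E)%E.
Proof.
elim: n => [|n IH].
  rewrite expr0 integral_dirac//; last exact: measurable_gauss_Rn.
  rewrite diracT mul1e dotE big_ord0 mul0r oppr0 expR0//.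
pose F (v : 'cV[R]_(1 + n)) := (expR (- (dot v v / 2)))%:E.
have F0 v : (0 <= F v)%E by rewrite lee_fin expR_ge0.
have -> : (\int[leb n.+1]_w (expR (- (dot (colv w) (colv w) / 2)))%:E =
    \int[leb (1 + n)]_w F (colv w))%E by [].
rewrite (lebesgue_Rn12 (@measurable_gauss_Rn (1 + n)%N) F0).
rewrite exprS EFinM -gauss_lebesgue1 -ge0_integralZr//; last first.
  apply/measurable_EFinP.
  apply: (measurableT_comp (derivable_measurable (@is_derive_expRN R))).
  by apply: measurable_funM => //; exact: measurable_funX.
apply: eq_integral => x _; rewrite -IH -ge0_integralZl//; last exact: measurable_gauss_Rn.
apply: eq_integral => w _; rewrite /F dot_ccol -EFinM -expRD; congr (expR _)%:E.
by field.
Qed.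

(** A real-valued integral that diverges is 0 by convention, so positivity
    includes the finiteness of the mass. *)
Lemma gauss_comparison_gt0 n (c : R) (h : R -> R) : 0 < c -> measurable_fun setT h ->
  (forall t, 0 <= t -> c * expR (- t) <= h t <= expR (- t)) ->
  0 < \int[leb n]_w h (dot (colv w) (colv w) / 2).
Proof.
move=> c0 mh hb.
have q0 (w : Rn R n) : 0 <= dot (colv w) (colv w) / 2.
  by rewrite divr_ge0// sqnorm_ge0.
have h0 (w : Rn R n) : 0 <= h (dot (colv w) (colv w) / 2).
  by have /andP[h1 _] := hb _ (q0 w); rewrite (le_trans _ h1)// mulr_ge0 ?expR_ge0// ltW.
have mhq : measurable_fun setT (fun w : Rn R n => (h (dot (colv w) (colv w) / 2))%:E).
  apply/measurable_EFinP; apply: (measurableT_comp mh).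
  by apply: measurable_funM => //; exact: measurable_sqnorm.
have gauss := gauss_lebesgue_Rn n.
have pi2 : 0 < Num.sqrt (2 * pi) ^+ n :> R.
  by rewrite exprn_gt0// sqrtr_gt0 mulr_gt0// pi_gt0.
rewrite /Rintegral fine_gt0//; apply/andP; split; last first.
  apply: (@le_lt_trans _ _ (Num.sqrt (2 * pi) ^+ n)%:E); last by rewrite ltry.
  rewrite -gauss; apply: ge0_le_integral => //.
  - by move=> w _; rewrite lee_fin.
  - exact: measurable_gauss_Rn.
  - by move=> w _; rewrite lee_fin; have /andP[] := hb _ (q0 w).
apply: (@lt_le_trans _ _ (c * Num.sqrt (2 * pi) ^+ n)%:E).
  by rewrite lte_fin mulr_gt0.
rewrite EFinM -gauss -ge0_integralZl//; last 2 first.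
- exact: measurable_gauss_Rn.
- by rewrite lee_fin ltW.
apply: ge0_le_integral => //.
- by move=> w _; rewrite mule_ge0// lee_fin ?expR_ge0// ltW.
- by apply: measurable_funeM; exact: measurable_gauss_Rn.
- by move=> w _; rewrite -EFinM lee_fin; have /andP[] := hb _ (q0 w).
Qed.

Lemma decreasing_profile_integral (h k : R -> R) :
  (forall t : R, is_derive t 1 h (- k t)) -> continuous k ->
  (forall t, 0 <= t -> 0 <= k t) ->
  (forall t, 0 <= t -> 0 <= h t <= expR (- t)) ->
  forall r, 0 <= r -> ((h r)%:E = \int[lam]_(s in `[r, +oo[) (k s)%:E)%E.
Proof.
move=> dh ck k0 hb r r0.
have dNh (t : R) : is_derive t 1 (fun t => - h t) (k t).
  by have := is_deriveN (dh t); rewrite opprK.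
rewrite (ge0_continuous_FTC2y (F := fun t => - h t) (l := 0)).
- by rewrite -EFinB opprK add0r.
- by move=> x rx; apply: k0; exact: le_trans rx.
- exact: continuous_subspaceT.
- have hc : h x @[x --> +oo] --> 0.
    apply: (@squeeze_cvgr _ _ _ _ (cst 0) (fun t => expR (- t))).
    + by near=> t; apply: hb; near: t; exact: nbhs_pinfty_ge.
    + exact: cvg_cst.
    + exact: cvgr_expR.
  by rewrite -[0]oppr0; exact: cvgN.
- by move=> x _; apply: ex_derive.
- have cNh : continuous (fun t => - h t).
    by move=> t; apply/differentiable_continuous/derivable1_diffP; exact: ex_derive.
  by apply: cvg_at_right_filter; exact: cNh.
- by move=> x _; rewrite derive1E; exact: derive_val.
Unshelve. all: by end_near. Qed.

Section radial_formula.
Variable d : nat.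
Hypothesis d0 : (0 < d)%N.
Let p : R := d%:R / 2.

Let hkexp : forall r, 0 <= r ->
  ((expR (- r))%:E = \int[lam]_(s in `[r, +oo[) (expR (- s))%:E)%E.
Proof.
apply: decreasing_profile_integral.
- exact: is_derive_expRN.
- by move=> t; apply/differentiable_continuous/derivable1_diffP;
    apply: ex_derive; exact: is_derive_expRN.
- by move=> t _; exact: expR_ge0.
- by move=> t _; rewrite expR_ge0 lexx.
Qed.

Let mexp : measurable_fun setT (fun t : R => expR (- t)).
Proof. exact: (derivable_measurable is_derive_expRN). Qed.

Let GammaE := (\int[lam]_(r in `]0%R, +oo[) (r `^ (p - 1) * expR (- r))%:E)%E.

(** The constant of proportionality is found on h = expR (- r), for which the
    integral over R^d is known.  A priori the volume or the Gamma integral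
    could be infinite; their product would then be 0 or infinite, but it is
    finite and positive. *)
Let Gamma_volume : GammaE \is a fin_num /\ 0 < Gamma p /\
  ball_volume d = (((2 * pi) `^ p / Gamma p) / p)%:E.
Proof.
have p0 : 0 < p by rewrite divr_gt0// ltr0n.
have pi0 : 0 < (2 * pi) `^ p :> R by rewrite powR_gt0// mulr_gt0// pi_gt0.
have k0 (s : R) : 0 <= s -> 0 <= expR (- s) by rewrite expR_ge0.
have H1 := @layer_cake_Rn d _ _ mexp k0 hkexp.
have H2 := @layer_cake_Gamma d _ _ d0 mexp k0 hkexp.
rewrite gauss_lebesgue_Rn in H1.
have E : Num.sqrt (2 * pi) ^+ d = (2 * pi) `^ p :> R.
  rewrite /p (mulrC d%:R) powRrM powR12_sqrt; first by rewrite powR_mulrn ?sqrtr_ge0.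
  by apply: mulr_ge0 => //; exact: pi_ge0.
rewrite E -/p in H1 H2.
move: H1 H2; rewrite -/GammaE.
set J0 := (\int[lam]_s ((if (0 < s)%R then expR (- s) else 0)%R * s `^ p)%:E)%E; set V := ball_volume d => H1 H2.
have J00 : (0 <= J0)%E.
  by apply: integral_ge0 => s _; rewrite lee_fin mulr_ge0 ?powR_ge0//; case: ifP.
have V0 : (0 <= V)%E by exact: measure_ge0.
have GE : Gamma p = fine GammaE by [].
case: J0 J00 H1 H2 => [j| |]//; case: V V0 => [v| |]//; rewrite ?lee_fin.
- move=> v0 j0 /(congr1 fine)/= H1 H2.
  have jp : 0 < j.
    rewrite lt_neqAle j0 andbT; apply/eqP => j0'; move: pi0.
    by rewrite H1 -j0' mulr0 ltxx.
  rewrite GE H2 -EFinM/=; split => //; split; first by rewrite mulr_gt0// invr_gt0.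
  by congr EFin; rewrite H1; field; rewrite !gt_eqF.
- move=> _ j0; have [->|jn] := eqVneq j 0.
    by rewrite mule0 => /(congr1 fine)/= H; move: pi0; rewrite H ltxx.
  by rewrite gt0_mulye// lte_fin lt_neqAle eq_sym jn.
- move=> v0 _; have [->|vn] := eqVneq v 0.
    by rewrite mul0e => /(congr1 fine)/= H; move: pi0; rewrite H ltxx.
  by rewrite gt0_muley// lte_fin lt_neqAle eq_sym vn.
Qed.

Lemma Gamma_half_gt0 : 0 < Gamma p.
Proof. by have [_ []] := Gamma_volume. Qed.

Section profile.
Variables h k : R -> R.
Hypothesis dh : forall t : R, is_derive t 1 h (- k t).
Hypothesis ck : continuous k.
Hypothesis k0 : forall t, 0 <= t -> 0 <= k t.
Hypothesis hb : forall t, 0 <= t -> 0 <= h t <= expR (- t).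

Lemma radial_formulae :
  (\int[leb d]_w (h (dot (colv w) (colv w) / 2))%:E =
   ((2 * pi) `^ p / Gamma p)%:E *
   \int[lam]_(r in `]0%R, +oo[) (r `^ (p - 1) * h r)%:E)%E.
Proof.
have p0 : 0 < p by rewrite divr_gt0// ltr0n.
have mk : measurable_fun setT k by exact: continuous_measurable_fun.
have hk := decreasing_profile_integral dh ck k0 hb.
rewrite (@layer_cake_Rn d _ _ mk k0 hk) (@layer_cake_Gamma d _ _ d0 mk k0 hk).
by have [_ [_ ->]] := Gamma_volume; rewrite -/p muleA -EFinM.
Qed.

(** By [layer_cake_Rn] and [layer_cake_Gamma] the ratio of the two integrals
    does not depend on h, and [Gamma_volume] evaluates it. *)
Lemma radial_formula :
  \int[leb d]_w h (dot (colv w) (colv w) / 2) =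
  (2 * pi) `^ p / Gamma p * \int[lam]_(r in `]0, +oo[) (r `^ (p - 1) * h r).
Proof.
rewrite /Rintegral radial_formulae fineM//.
have mh : measurable_fun setT h by exact: (derivable_measurable dh).
have mpow f : measurable_fun setT f -> measurable_fun setT (fun r : R => r `^ (p - 1) * f r).
  by move=> mf; apply: measurable_funM => //; exact: measurable_powR.
apply: integrable_fin_num => //.
have [GF _] := Gamma_volume.
apply: (@le_integrable _ _ _ lam _ _ _ (fun r => (r `^ (p - 1) * expR (- r))%:E)) => //.
- apply/measurable_EFinP; apply: measurable_funTS; have H := mpow _ mh; exact H.
- move=> r; rewrite /= in_itv/= andbT => r0; rewrite lee_fin.
  have /andP[h0 h1] := hb (ltW r0).
  by rewrite !normrM ler_wpM2l// ger0_norm// ger0_norm// expR_ge0.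
- apply/integrableP; split.
    apply/measurable_EFinP; apply: measurable_funTS; have H := mpow _ mexp; exact H.
  under eq_integral do rewrite /= ger0_norm ?mulr_ge0 ?powR_ge0 ?expR_ge0//.
  by rewrite ltey_eq GF.
Qed.

End profile.

End radial_formula.

End radial.

(** * Normalizing constants *)

Section constants.
Context {R : realType}.
Notation lam := (@lebesgue_measure R).
Notation leb n := (lebesgue_Rn R n).

Let pi2 : 0 < 2 * pi :> R. Proof. by rewrite mulr_gt0// pi_gt0. Qed.

Lemma ge0_RintegralZl d (T : measurableType d) (mu : {measure set T -> \bar R})
    (D : set T) (f : T -> R) (r : R) : 0 < r -> measurable D ->
  measurable_fun D f -> (forall x, D x -> 0 <= f x) ->
  \int[mu]_(x in D) (r * f x) = r * \int[mu]_(x in D) f x.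
Proof.
move=> r0 mD mf f0; rewrite /Rintegral.
under eq_integral do rewrite EFinM.
rewrite ge0_integralZl//; last 2 first.
- exact/measurable_EFinP.
- by rewrite lee_fin ltW.
have : (0 <= \int[mu]_(x in D) (f x)%:E)%E by exact: integral_ge0.
by case: (\int[mu]_(x in D) (f x)%:E)%E => [x| |]// _; rewrite gt0_muley ?lte_fin// mulr0.
Qed.

Lemma continuous_of_derive (f f' : R -> R) :
  (forall t : R, is_derive t 1 f (f' t)) -> continuous f.
Proof.
by move=> df t; apply/differentiable_continuous/derivable1_diffP; exact: ex_derive.
Qed.

Lemma continuous_g : continuous (@g R).
Proof.
move=> t; apply: cvgM.
  exact: (continuous_of_derive (@is_derive_expRN R)).
apply: cvgV; first by rewrite sqrf_eq0 gt_eqF// onepexp_gt0.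
apply: (@continuous_comp _ _ _ (fun t => 1 + expR (- t)) (fun x : R => x ^+ 2)).
  exact: (continuous_of_derive (@is_derive_onepexp R)).
exact: exprn_continuous.
Qed.

Lemma continuous_Gbar : continuous (@Gbar R).
Proof. exact: (@continuous_of_derive Gbar (fun t => - g t) is_derive_Gbar). Qed.

Lemma continuous_GGbar : continuous (@GGbar R).
Proof. exact: (@continuous_of_derive GGbar (fun t => - Gbar t) is_derive_GGbar). Qed.

Lemma continuous_shift (f : R -> R) (c : R) : continuous f -> continuous (fun t => f (t + c)).
Proof.
move=> cf t; apply: (@continuous_comp _ _ _ (fun t => t + c) f).
  by apply: cvgD; [exact: cvg_id|exact: cvg_cst].
exact: cf.
Qed.

Lemma expR_shift_comparison (h : R -> R) (c : R) : 0 <= c ->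
  (forall t, 0 <= t -> expR (- t) / 2 <= h t <= expR (- t)) ->
  forall t, 0 <= t -> expR (- c) / 2 * expR (- t) <= h (t + c) <= expR (- t).
Proof.
move=> c0 hb t t0; have /andP[h1 h2] := hb (t + c) (addr_ge0 t0 c0).
apply/andP; split.
  have -> : expR (- c) / 2 * expR (- t) = expR (- (t + c)) / 2 by rewrite opprD expRD; ring.
  exact: h1.
by apply: le_trans h2 _; rewrite ler_expR; lra.
Qed.

Lemma expR_shift_half_gt0 (c : R) : 0 < expR (- c) / 2.
Proof. by rewrite divr_gt0// expR_gt0. Qed.

Lemma Gbar_mass_gt0 n (c : R) : 0 <= c ->
  0 < \int[leb n]_w Gbar (dot (colv w) (colv w) / 2 + c).
Proof.
move=> c0; apply: (gauss_comparison_gt0 n (h := fun t => Gbar (t + c)) (expR_shift_half_gt0 c)).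
  have H := continuous_measurable_fun (@continuous_shift Gbar c continuous_Gbar).
  exact H.
exact: (expR_shift_comparison c0 Gbar_expR).
Qed.

Lemma GGbar_mass_gt0 n (c : R) : 0 <= c ->
  0 < \int[leb n]_w GGbar (dot (colv w) (colv w) / 2 + c).
Proof.
move=> c0; apply: (gauss_comparison_gt0 n (h := fun t => GGbar (t + c)) (expR_shift_half_gt0 c)).
  have H := continuous_measurable_fun (@continuous_shift GGbar c continuous_GGbar).
  exact H.
exact: (expR_shift_comparison c0 GGbar_expR).
Qed.

Lemma Gbar_mass d (c : R) : (0 < d)%N -> 0 <= c ->
  \int[leb d]_w Gbar (dot (colv w) (colv w) / 2 + c) =
  (2 * pi) `^ (d%:R / 2) / Gamma (d%:R / 2) *
  \int[lam]_(r in `]0, +oo[) (r `^ (d%:R / 2 - 1) * Gbar (r + c)).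
Proof.
move=> d0 c0.
apply: (@radial_formula R d d0 (fun t => Gbar (t + c)) (fun t => g (t + c))).
- by move=> t; exact: (@is_derive_comp_addr R Gbar (fun t => - g t) c t is_derive_Gbar).
- have H := @continuous_shift (@g R) c continuous_g; exact H.
- by move=> t _; have /andP[] := g_le1 (t + c).
- move=> t t0; have /andP[h1 h2] := expR_shift_comparison c0 Gbar_expR t0.
  by rewrite h2 ltW ?Gbar_gt0.
Qed.

Lemma GGbar_mass d (c : R) : (0 < d)%N -> 0 <= c ->
  \int[leb d]_w GGbar (dot (colv w) (colv w) / 2 + c) =
  (2 * pi) `^ (d%:R / 2) / Gamma (d%:R / 2) *
  \int[lam]_(r in `]0, +oo[) (r `^ (d%:R / 2 - 1) * GGbar (r + c)).
Proof.
move=> d0 c0.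
apply: (@radial_formula R d d0 (fun t => GGbar (t + c)) (fun t => Gbar (t + c))).
- by move=> t; exact: (@is_derive_comp_addr R GGbar (fun t => - Gbar t) c t is_derive_GGbar).
- have H := @continuous_shift Gbar c continuous_Gbar; exact H.
- by move=> t _; rewrite ltW ?Gbar_gt0.
- move=> t t0; have /andP[h1 h2] := expR_shift_comparison c0 GGbar_expR t0.
  by rewrite h2 (le_trans _ h1)// mulr_ge0 ?expR_ge0// ltW ?expR_shift_half_gt0.
Qed.

(** Gbar (r + c) is e^(-c) e^(-r) / (1 + e^(-c) e^(-r)), so its radial integral
    is the one that defines the zeta function at - e^(-c). *)
Lemma HLzeta1E (d : nat) (c : R) : (0 < d)%N -> 0 <= c ->
  HLzeta 1 (- expR (- c)) (d%:R / 2) 1 * expR (- c) =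
  \int[leb d]_w Gbar (dot (colv w) (colv w) / 2 + c) / (2 * pi) `^ (d%:R / 2).
Proof.
move=> d0 c0; rewrite Gbar_mass// /HLzeta.
have p0 := powR_gt0 (d%:R / 2) pi2.
have G0 := @Gamma_half_gt0 R d d0.
rewrite mulrAC.
have -> : \int[lam]_(r in `]0, +oo[) (r `^ (d%:R / 2 - 1) * Gbar (r + c)) =
  expR (- c) * \int[lam]_(t in `]0, +oo[)
    (t `^ (d%:R / 2 - 1) * expR (- 1 * t) / (1 - - expR (- c) * expR (- t)) `^ 1).
  rewrite -ge0_RintegralZl ?expR_gt0//.
  - apply: eq_Rintegral => t _; rewrite /Gbar opprD expRD mulN1r mulNr opprK.
    rewrite powRr1 ?addr_ge0 ?mulr_ge0 ?expR_ge0//.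
    by rewrite (mulrC (expR (- c)) (expR (- t))); ring.
  - apply: measurable_funTS; apply: measurable_funM.
      apply: measurable_funM; first exact: measurable_powR.
      under eq_fun do rewrite mulN1r.
      exact: (derivable_measurable (@is_derive_expRN R)).
    have H : continuous (fun t : R => (1 + expR (- c) * expR (- t))^-1).
      move=> t; apply: cvgV; first by rewrite gt_eqF// addr_gt0// mulr_gt0 ?expR_gt0.
      apply: cvgD; first exact: cvg_cst.
      apply: cvgM; first exact: cvg_cst.
      exact: (continuous_of_derive (@is_derive_expRN R)).
    rewrite (_ : (fun _ => _) = (fun t : R => (1 + expR (- c) * expR (- t))^-1)).
      exact: continuous_measurable_fun.
    apply/funext => t; rewrite mulNr opprK powRr1//.
  - move=> t _; rewrite divr_ge0 ?powR_ge0// mulr_ge0 ?powR_ge0 ?expR_ge0//.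
by field; rewrite !gt_eqF.
Qed.

End constants.

Section normalizing_constants.
Context {R : realType}.
Notation lam := (@lebesgue_measure R).
Notation leb n := (lebesgue_Rn R n).

Let pi2 : 0 < 2 * pi :> R. Proof. by rewrite mulr_gt0// pi_gt0. Qed.

Let sq0 (x : R) : 0 <= x ^+ 2 / 2. Proof. by rewrite divr_ge0// sqr_ge0. Qed.

Lemma powR_half_succ (a : R) (n : nat) : 0 < a ->
  a `^ (n.+1%:R / 2) = a `^ (n%:R / 2) * Num.sqrt a.
Proof.
move=> a0; rewrite -natr1 mulrDl mul1r powRD; last by rewrite gt_eqF ?implybT.
by rewrite powR12_sqrt// ltW.
Qed.

Lemma normal_pdf01 (x : R) : phi x = expR (- (x ^+ 2 / 2)) / Num.sqrt (2 * pi).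
Proof.
rewrite /phi normal_pdfE ?oner_neq0// /normal_peak /normal_fun subr0 expr1n mul1r.
by rewrite -(mulr_natr pi) (mulrC pi) [LHS]mulrC mulNr.
Qed.

(** A face has dimension n - 1, hence one factor sqrt (2 pi) of the constant
    c_n is left over; together with e^(-x^2/2) it makes phi x. *)
Lemma cs1_formula n (x : R) : (1 < n)%N ->
  c_ n / cs1 n x =
  HLzeta 1 (- expR (- (x ^+ 2 / 2))) ((n%:R - 1) / 2) 1 * phi x /
  HLzeta 2 (-1) (n%:R / 2) 1.
Proof.
case: n => [//|n] n1; rewrite /c_ /cs1 invrK/=.
have -> : n.+1%:R - 1 = n%:R :> R by rewrite -natr1 addrK.
have n0 : (0 < n)%N by [].
have E := HLzeta1E n0 (sq0 x).
rewrite normal_pdf01 mulrA E powR_half_succ//.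
set Q := HLzeta 2 _ _ _; rewrite !invfM.
by ring.
Qed.

Lemma css1_formula n (x : R) : (1 < n)%N ->
  c_ n / css1 n x =
  (\int[lam]_(r in `]0, +oo[) (r `^ ((n%:R - 3) / 2) *
      ln (1 + expR (- (x ^+ 2 / 2)) * expR (- r))))
  / (Gamma ((n%:R - 1) / 2) * Num.sqrt (2 * pi) * HLzeta 2 (-1) (n%:R / 2) 1).
Proof.
case: n => [//|n] n1; rewrite /c_ /css1 invrK/=.
have -> : n.+1%:R - 1 = n%:R :> R by rewrite -natr1 addrK.
have -> : (n.+1%:R - 3) / 2 = n%:R / 2 - 1 :> R by rewrite -natr1; field.
have n0 : (0 < n)%N by [].
rewrite (GGbar_mass n0 (sq0 x)) powR_half_succ//.
have -> : \int[lam]_(r in `]0, +oo[) (r `^ (n%:R / 2 - 1) * GGbar (r + x ^+ 2 / 2)) =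
  \int[lam]_(r in `]0, +oo[) (r `^ (n%:R / 2 - 1) *
      ln (1 + expR (- (x ^+ 2 / 2)) * expR (- r))).
  by apply: eq_Rintegral => r _; rewrite /GGbar opprD expRD (mulrC (expR (- r))).
have p0 := powR_gt0 (n%:R / 2) pi2.
set Q := HLzeta 2 _ _ _; set I := \int[lam]_(r in _) _.
rewrite !invfM (mulrC _ I).
set X := (2 * pi) `^ _ in p0 *.
have X1 : X^-1 * X = 1 by rewrite mulVf// gt_eqF.
rewrite -[RHS]mulr1 -X1; ring.
Qed.

Lemma css2_formula n (x y : R) : (2 < n)%N ->
  c_ n / css2 n x y =
  (\int[lam]_(r in `]0, +oo[) (r `^ ((n%:R - 4) / 2) *
      ln (1 + expR (- (x ^+ 2 / 2) - y ^+ 2 / 2) * expR (- r))))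
  / (2 * Gamma ((n%:R - 2) / 2) * pi * HLzeta 2 (-1) (n%:R / 2) 1).
Proof.
case: n => [//|[//|n]] n1; rewrite /c_ /css2 invrK/=.
have -> : n.+2%:R - 2 = n%:R :> R by rewrite -!natr1; ring.
have -> : (n.+2%:R - 4) / 2 = n%:R / 2 - 1 :> R by rewrite -!natr1; field.
have n0 : (0 < n)%N by [].
under eq_Rintegral do rewrite -addrA.
rewrite (GGbar_mass n0 (addr_ge0 (sq0 x) (sq0 y))) !powR_half_succ//.
have -> : \int[lam]_(r in `]0, +oo[) (r `^ (n%:R / 2 - 1) * GGbar (r + (x ^+ 2 / 2 + y ^+ 2 / 2))) =
  \int[lam]_(r in `]0, +oo[) (r `^ (n%:R / 2 - 1) *
      ln (1 + expR (- (x ^+ 2 / 2) - y ^+ 2 / 2) * expR (- r))).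
  by apply: eq_Rintegral => r _; rewrite /GGbar !opprD expRD (mulrC (expR (- r))).
have p0 := powR_gt0 (n%:R / 2) pi2.
have sq : Num.sqrt (2 * pi) * Num.sqrt (2 * pi) = 2 * pi :> R.
  by rewrite -expr2 sqr_sqrtr ?ltW.
rewrite -(mulrA (_ `^ _) (Num.sqrt _)) sq.
set Q := HLzeta 2 _ _ _; set I := \int[lam]_(r in _) _.
rewrite !invfM (mulrC _ I).
set X := (2 * pi) `^ _ in p0 *.
have X1 : X^-1 * X = 1 by rewrite mulVf// gt_eqF.
rewrite -[RHS]mulr1 -X1; ring.
Qed.

Lemma cs_mass n : (0 < n)%N -> HLzeta 1 (-1) (n%:R / 2) 1 != 0 :> R.
Proof.
move=> n0; have := HLzeta1E (R := R) n0 (lexx 0).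
rewrite oppr0 expR0 mulr1 => ->.
by rewrite gt_eqF// divr_gt0 ?powR_gt0// Gbar_mass_gt0.
Qed.

Lemma cs_ratio n : (0 < n)%N ->
  HLzeta 1 (-1) (n%:R / 2) 1 / HLzeta 2 (-1) (n%:R / 2) 1 * cs_ n = c_ n :> R.
Proof.
move=> n0; have z0 := cs_mass n0; rewrite /cs_ /c_.
move: z0; set Z := HLzeta 1 _ _ _; set Q := HLzeta 2 _ _ _ => z0; clearbody Z Q.
rewrite invfM; set X := (_ `^ _)^-1.
rewrite (_ : _ / _ * _ = X / Q * (Z / Z)); last by ring.
by rewrite divff// mulr1 /X invfM.
Qed.

(** The zeta value at n/2 + 1 is a mass in dimension n + 2, hence not 0. *)
Lemma css_ratio n :
  HLzeta 1 (-1) (n%:R / 2 + 1) 1 / HLzeta 2 (-1) (n%:R / 2) 1 * css_ n = c_ n :> R.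
Proof.
have := @cs_mass n.+2 isT.
have -> : n.+2%:R / 2 = n%:R / 2 + 1 :> R by rewrite -!natr1; field.
rewrite /css_ /c_.
set Z := HLzeta 1 _ _ _; set Q := HLzeta 2 _ _ _ => z0; clearbody Z Q.
rewrite invfM; set X := (_ `^ _)^-1.
rewrite (_ : _ / _ * _ = X / Q * (Z / Z)); last by ring.
by rewrite divff// mulr1 /X invfM.
Qed.

End normalizing_constants.

(** * The law of the standardized vector *)

Section density.
Local Open Scope ereal_scope.
Context d (T : measurableType d) (R : realType).
Variables nu mu : {measure set T -> \bar R}.
Variable fr : T -> R.
Let f x := (fr x)%:E.
Hypothesis mf : measurable_fun setT f.
Hypothesis f0 : forall x, 0 <= f x.
Hypothesis nuf : forall A, measurable A -> nu A = \int[mu]_(x in A) f x.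

Import HBNNSimple.

Let nnsfun_density (h : {nnsfun T >-> R}) :
  \int[nu]_x (h x)%:E = \int[mu]_x ((h x)%:E * f x).
Proof.
transitivity (\sum_(r \in range h) r%:E * nu (h @^-1` [set r])).
  by rewrite integralT_nnsfun sintegralE.
transitivity (\sum_(r \in range h) \int[mu]_x ((r * \1_(h @^-1` [set r]) x)%:E * f x)).
  apply: eq_fsbigr => r rh.
  have r0 : (0 <= r)%R by move/set_mem : rh => -[x _ <-].
  under eq_integral do rewrite EFinM -muleA.
  rewrite ge0_integralZl//.
  - congr (_ * _); rewrite nuf// integral_mkcond; apply: eq_integral => x _.
    by rewrite patchE indicE; case: ifPn; rewrite ?mul1e ?mul0e.
  - apply: emeasurable_funM => //; exact/measurable_EFinP/measurable_indic.
  - by move=> x _; rewrite mule_ge0// lee_fin.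
rewrite -ge0_integral_fsum//; last 2 first.
- move=> r; apply: emeasurable_funM => //.
  by apply/measurable_EFinP; apply: measurable_funM => //; exact: measurable_indic.
- by move=> r x _; rewrite mule_ge0// nnfun_muleindic_ge0.
apply: eq_integral => x _; rewrite [in RHS]fimfunE -fsumEFin//.
rewrite ge0_mule_fsuml// => r; exact: nnfun_muleindic_ge0.
Qed.

(** A measure with density f with respect to mu integrates as f mu does:
    simple functions first, then increasing limits. *)
Lemma ge0_integral_density (phi : T -> \bar R) : measurable_fun setT phi ->
  (forall x, 0 <= phi x) -> \int[nu]_x phi x = \int[mu]_x (phi x * f x).
Proof.
move=> mphi phi0; pose h := nnsfun_approx measurableT mphi.
transitivity (limn (fun n => \int[nu]_x (h n x)%:E)).
  rewrite -monotone_convergence//.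
  - apply: eq_integral => y _; apply/esym/cvg_lim => //.
    by apply: cvg_nnsfun_approx.
  - by move=> n; exact/measurable_EFinP/measurable_funP.
  - by move=> n y _; rewrite lee_fin.
  - by move=> y _ m n mn; rewrite lee_fin; exact/lefP/nd_nnsfun_approx.
transitivity (limn (fun n => \int[mu]_x ((h n x)%:E * f x))).
  by congr (limn _); apply/funext => n; exact: nnsfun_density.
rewrite -monotone_convergence//.
- apply: eq_integral => y _; apply/cvg_lim => //.
  by apply: cvgeMr => //; exact: cvg_nnsfun_approx.
- move=> n; apply: emeasurable_funM => //; exact/measurable_EFinP/measurable_funP.
- by move=> n y _; rewrite mule_ge0// lee_fin.
- by move=> y _ m n mn; rewrite lee_wpmul2r// lee_fin; exact/lefP/nd_nnsfun_approx.
Qed.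

Lemma integral_density D (phi : T -> \bar R) : measurable D ->
  measurable_fun setT phi ->
  \int[nu]_(x in D) phi x = \int[mu]_(x in D) (phi x * f x).
Proof.
move=> mD mphi; rewrite integral_mkcond [RHS]integral_mkcond.
have mphiD : measurable_fun setT (phi \_ D).
  by apply/(measurable_restrictT _ mD); exact: measurable_funTS.
rewrite [LHS]integralE [RHS]integralE.
rewrite (ge0_integral_density (measurable_funepos mphiD))//.
rewrite (ge0_integral_density (measurable_funeneg mphiD))//.
congr (_ - _); apply: eq_integral => x _.
- rewrite !funeposE !patchE; case: ifP => _; last by rewrite maxxx mul0e.
  by rewrite maxe_pMl// mul0e.
- rewrite !funenegE !patchE; case: ifP => _; last by rewrite oppe0 maxxx mul0e.
  by rewrite maxe_pMl// mul0e mulNe.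
Qed.

End density.

Section standardization.
Context {R : realType}.
Notation leb n := (lebesgue_Rn R n).

Lemma c_ge0 n : (0 < n)%N -> 0 <= c_ n :> R.
Proof.
move=> n0; rewrite /c_ invr_ge0 mulr_ge0 ?powR_ge0// /HLzeta.
rewrite mulr_ge0 ?invr_ge0 ?(ltW (@Gamma_half_gt0 R n n0))//.
apply: Rintegral_ge0 => t _.
by rewrite divr_ge0 ?powR_ge0// mulr_ge0 ?powR_ge0 ?expR_ge0.
Qed.

Lemma posdef_unitmx n (S : 'M[R]_n) : posdef S -> S \in unitmx.
Proof. by move=> /posdef_det_gt0 d0; rewrite unitmxE unitfE gt_eqF. Qed.

Lemma gslo_pdf_affine n (mu : 'cV[R]_n) (Sigma S : 'M[R]_n) gamma J z :
  posdef S -> S *m S = Sigma ->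
  \det S * gslo_pdf mu Sigma S gamma J (S *m z + mu) = 2 * c_ n * profile g J gamma z.
Proof.
move=> pS SS; have uS := posdef_unitmx pS; have dS := posdef_det_gt0 pS.
rewrite /gslo_pdf /profile addrK mulKmx// -SS det_mulmx -expr2 sqrtr_sqr gtr0_norm//.
have -> : dot (S *m z) (invmx (S *m S) *m (S *m z)) = dot z z.
  rewrite /dot trmx_mul pS.1; congr (fun_of_matrix _ 0 0).
  have -> : invmx (S *m S) = invmx S *m invmx S.
    have uSS : S *m S \in unitmx by rewrite unitmx_mul uS.
    have H : S *m S *m (invmx S *m invmx S) = 1%:M by rewrite mulmxA mulmxK// mulmxV.
    by rewrite -[LHS]mulmx1 -H mulKmx.
  by rewrite -!mulmxA mulKmx// mulKVmx.
by field; rewrite gt_eqF.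
Qed.

Section law.
Variables (n : nat) (gamma : 'cV[R]_n) (J J1 : R -> R).
Hypothesis n0 : (0 < n)%N.
Hypothesis hJ : skewing J.
Hypothesis dJ : forall t : R, is_derive t 1 J (J1 t).

Lemma profile_ge0 (A : R -> R) (z : 'cV[R]_n) : (forall t, 0 <= A t) ->
  0 <= profile A J gamma z.
Proof. by move=> A0; rewrite mulr_ge0//; have [/(_ (dot gamma z))/andP[]] := hJ. Qed.

Lemma measurable_profile (A : R -> R) : measurable_fun setT A ->
  measurable_fun setT (fun w : Rn R n => profile A J gamma (colv w)).
Proof.
move=> mA; apply: measurable_funM.
  apply: (measurableT_comp mA); apply: measurable_funM => //; exact: measurable_sqnorm.
apply: (measurableT_comp (derivable_measurable dJ)); exact: measurable_dot.
Qed.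

Let zpdf (z : 'cV[R]_n) := 2 * c_ n * profile g J gamma z.

Lemma zpdf_ge0 z : 0 <= zpdf z.
Proof.
apply: mulr_ge0; first by apply: mulr_ge0 => //; exact: c_ge0.
apply: profile_ge0 => t.
by have /andP[] := g_le1 t.
Qed.

Lemma measurable_zpdf : measurable_fun setT (fun w : Rn R n => zpdf (colv w)).
Proof. by apply: measurable_funM => //; apply: measurable_profile; exact: measurable_g. Qed.

Variables (mu : 'cV[R]_n) (Sigma S : 'M[R]_n).
Hypothesis pS : posdef S.
Hypothesis SS : S *m S = Sigma.
Variables (d : measure_display) (T : measurableType d) (P : probability T R).
Variable Y : {RV P >-> Rn R n}.
Hypothesis hY : has_density Y (gslo_pdf mu Sigma S gamma J).

Definition standardize (y : 'cV[R]_n) := invmx S *m (y - mu).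

Let W (w : T) : Rn R n := tupc (standardize (colv (Y w))).

Let mstd : measurable_fun setT (fun y : Rn R n => tupc (standardize (colv y))).
Proof.
apply: measurable_tupc => i.
have := measurable_mulmx_colv (invmx S) (- (invmx S *m mu)) (@measurable_colv R n) i.
by congr measurable_fun; apply/funext => w; rewrite /standardize mulmxBr.
Qed.

Lemma measurable_standardized : measurable_fun setT W.
Proof.
have mY : measurable_fun setT Y by exact: measurable_funP.
exact: (measurableT_comp mstd mY).
Qed.

(** The substitution y = S z + mu; its determinant cancels the factor
    1 / sqrt (\det Sigma) of the density. *)
Lemma standardized_density (A : set (Rn R n)) : measurable A ->
  pushforward P W A = (\int[leb n]_(w in A) (zpdf (colv w))%:E)%E.
Proof.
move=> mA; pose E := (fun y : Rn R n => tupc (standardize (colv y))) @^-1` A.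
have mE : measurable E by rewrite -[X in measurable X]setTI; exact: mstd.
have -> : pushforward P W A = P (Y @^-1` E) by [].
rewrite (hY mE) integral_mkcond [RHS]integral_mkcond.
have uS := posdef_unitmx pS; have dS := posdef_det_gt0 pS.
pose F (y : 'cV[R]_n) : \bar R :=
  if tupc (standardize y) \in A then (gslo_pdf mu Sigma S gamma J y)%:E else 0%E.
have FE z : F (S *m z + mu) = if tupc z \in A then ((\det S)^-1 * zpdf z)%:E else 0%E.
  rewrite /F /standardize addrK mulKmx//; case: ifP => // _; congr EFin.
  by rewrite /zpdf -(gslo_pdf_affine mu gamma J z pS SS) mulrA mulVf ?mul1r// gt_eqF.
pose F' (z : 'cV[R]_n) : \bar R := if tupc z \in A then (zpdf z)%:E else 0%E.
have F'0 z : (0 <= F' z)%E by rewrite /F'; case: ifP => // _; rewrite lee_fin zpdf_ge0.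
have FE' z : F (S *m z + mu) = ((\det S)^-1%:E * F' z)%E.
  by rewrite FE /F'; case: ifP => _; rewrite ?mule0.
have stdK y : S *m standardize y + mu = y.
  by rewrite /standardize mulKVmx// subrK.
have F0 y : (0 <= F y)%E.
  by rewrite -(stdK y) FE' mule_ge0// lee_fin invr_ge0 ltW.
have mF' : measurable_fun setT (fun w : Rn R n => F' (colv w)).
  rewrite (_ : (fun _ => _) = (EFin \o (fun w : Rn R n => zpdf (colv w))) \_ A).
    apply/(measurable_restrictT _ mA); apply: measurable_funTS.
    by apply/measurable_EFinP; exact: measurable_zpdf.
  by apply/funext => w; rewrite /F' colvK patchE.
have mF : measurable_fun setT (fun w : Rn R n => F (colv w)).
  rewrite (_ : (fun _ => _) =
      (fun w : Rn R n => ((\det S)^-1%:E * F' (standardize (colv w)))%E)).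
    apply: measurable_funeM.
    apply: (@measurable_comp_colv _ _ _ _ _ _ (fun w : Rn R n => standardize (colv w))) mF' => i.
    have := measurable_mulmx_colv (invmx S) (- (invmx S *m mu)) (@measurable_colv R n) i.
    by congr measurable_fun; apply/funext => w; rewrite /standardize mulmxBr.
  by apply/funext => w; rewrite -{1}(stdK (colv w)) FE'.
transitivity (\int[leb n]_w F (colv w))%E.
  apply: eq_integral => w _; rewrite patchE /F /E.
  by congr (if _ then _ else _); apply/idP/idP => /set_mem H; exact: mem_set.
rewrite (lebesgue_Rn_posdef (F := F) mu pS mF F0).
transitivity ((\det S)%:E * \int[leb n]_w ((\det S)^-1%:E * F' (colv w)))%E.
  by congr (_ * _)%E; apply: eq_integral => w _; exact: FE'.
rewrite ge0_integralZl//; last by rewrite lee_fin invr_ge0 ltW.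
rewrite muleA -EFinM divff ?gt_eqF// mul1e.
by apply: eq_integral => w _; rewrite /F' colvK patchE.
Qed.

End law.

End standardization.

Section standardized_moments.
Context {R : realType}.
Notation leb n := (lebesgue_Rn R n).
Variables (n : nat) (gamma : 'cV[R]_n) (J J1 : R -> R).
Hypothesis n0 : (0 < n)%N.
Hypothesis hJ : skewing J.
Hypothesis dJ : forall t : R, is_derive t 1 J (J1 t).
Variables (mu : 'cV[R]_n) (Sigma S : 'M[R]_n).
Hypothesis pS : posdef S.
Hypothesis SS : S *m S = Sigma.
Variables (d : measure_display) (T : measurableType d) (P : probability T R).
Variable Y : {RV P >-> Rn R n}.
Hypothesis hY : has_density Y (gslo_pdf mu Sigma S gamma J).
Variables u v : 'cV[R]_n.

Let W w := standardize mu S (colv (Y w)).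
Let D := [set w | box u v (W w)].
Let B := (@colv R n) @^-1` box u v.
Let mW : measurable_fun setT (fun w => tupc (W w)).
Proof. exact: measurable_standardized. Qed.

Let DE : D = (fun w => tupc (W w)) @^-1` B.
Proof. by apply/seteqP; split => w; rewrite /D /B /= tupcK. Qed.

Let mB : measurable B. Proof. exact: measurable_box. Qed.

Lemma measurable_truncation : measurable D.
Proof. by rewrite DE -[X in measurable X]setTI; exact: mW. Qed.

Lemma truncation_lty : (P D < +oo)%E.
Proof. by rewrite (le_lt_trans (probability_le1 P measurable_truncation))// ltry. Qed.

Lemma standardized_integrable (phi : 'cV[R]_n -> R) : admissible u v phi ->
  P.-integrable D (EFin \o (fun w => phi (W w))).
Proof.
move=> [mphi [M phiM]]; apply: (integrable_bounded (M := M)).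
- exact: measurable_truncation.
- exact: truncation_lty.
- apply: measurable_funTS; have := measurableT_comp mphi mW.
  by congr measurable_fun; apply/funext => w /=; rewrite tupcK.
- by move=> w Dw; apply: phiM => i; have /andP[/ltW -> ->] := Dw i.
Qed.

Let profile_admissible : admissible u v (fun z => profile g J gamma z).
Proof.
apply: admissibleM; last exact: (admissible_linear u v gamma dJ).
apply: (admissible_radial u v measurable_g (M := 1)) => t _.
by have /andP[? ?] := g_le1 t; rewrite ger0_norm.
Qed.

(** Admissible weights cover the coordinates and their products, which give
    the first two moments, and the constant 1, which gives the probability of
    the truncation event. *)
Lemma standardized_moment (phi : 'cV[R]_n -> R) : admissible u v phi ->
  \int[P]_(w in D) phi (W w) =
  2 * c_ n * \int[leb n]_(z in B) (phi (colv z) * profile g J gamma (colv z)).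
Proof.
move=> aphi.
have mphiE : measurable_fun setT (EFin \o (fun y : Rn R n => phi (colv y))).
  by apply/measurable_EFinP; exact: aphi.1.
have iphi := standardized_integrable aphi.
have E1 : (\int[P]_(w in D) (phi (W w))%:E =
    \int[pushforward P (fun w => tupc (W w))]_(y in B) (phi (colv y))%:E)%E.
  rewrite (integral_pushforward mW mphiE _ mB) -?DE.
    by apply: eq_integral => w _ /=; rewrite tupcK.
  by apply: eq_integrable iphi => [|w _ /=]; [exact: measurable_truncation|rewrite tupcK].
rewrite /Rintegral E1.
have mz : measurable_fun setT
    (fun w : Rn R n => (2 * c_ n * profile g J gamma (colv w))%:E).
  by apply/measurable_EFinP; exact: (measurable_zpdf (n := n) gamma dJ).
have E2 := @integral_density _ _ _
  (pushforward P (fun w => tupc (W w))) (leb n)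
  (fun w => 2 * c_ n * profile g J gamma (colv w))
  mz (fun w => zpdf_ge0 gamma n0 hJ (colv w))
  (fun A mA => standardized_density n0 hJ dJ pS SS hY mA) _ _ mB mphiE.
rewrite E2.
have := RintegralZl (2 * c_ n) mB (admissible_integrable (admissibleM aphi profile_admissible)).
rewrite /Rintegral => <-; congr fine; apply: eq_integral => z _.
by rewrite -EFinM; congr EFin; ring.
Unshelve. all: exact: mW.
Qed.

Lemma truncation_probability :
  P D = (2 * c_ n * \int[leb n]_(z in B) profile g J gamma (colv z))%:E.
Proof.
have := standardized_moment (admissible_cst u v 1).
rewrite Rintegral_cst ?mul1r; last exact: measurable_truncation.
under [in X in _ = X]eq_Rintegral do rewrite mul1r.
move=> <-; rewrite fineK// ge0_fin_numE//; exact: truncation_lty.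
Qed.

End standardized_moments.

(** * Conditional expectation of random matrices *)

Section conditional_expectation.
Context {R : realType} (d : measure_display) (T : measurableType d) (P : probability T R).
Variable D : set T.
Hypothesis mD : measurable D.
Hypothesis PD : (0 < P D)%E.

Definition mx_integrable p q (X : T -> 'M[R]_(p, q)) : Prop :=
  forall i j, P.-integrable D (EFin \o (fun w => X w i j)).

Lemma mx_integrable_cst p q (A : 'M[R]_(p, q)) : mx_integrable (fun=> A).
Proof.
move=> i j; apply: (integrable_bounded (M := `|A i j|)) => //.
by rewrite (le_lt_trans (probability_le1 P mD))// ltry.
Qed.

Lemma mx_integrableD p q (X Z : T -> 'M[R]_(p, q)) :
  mx_integrable X -> mx_integrable Z -> mx_integrable (fun w => X w + Z w).
Proof.
move=> iX iZ i j; have := integrable_EFinD mD (iX i j) (iZ i j).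
by apply: eq_integrable => // w _ /=; rewrite mxE.
Qed.

Lemma integrable_Rsum (I : finType) (f : I -> T -> R) :
  (forall i, P.-integrable D (EFin \o f i)) ->
  P.-integrable D (EFin \o (fun w => \sum_i f i w)) /\
  \int[P]_(w in D) (\sum_i f i w) = \sum_i \int[P]_(w in D) f i w.
Proof.
move=> fi.
suff H (s : seq I) : P.-integrable D (EFin \o (fun w => \sum_(i <- s) f i w)) /\
  \int[P]_(w in D) (\sum_(i <- s) f i w) = \sum_(i <- s) \int[P]_(w in D) f i w.
  exact: H.
elim: s => [|a s [IH1 IH2]].
  split.
    have := mx_integrable_cst (0 : 'M[R]_1) 0 0; apply: eq_integrable => // w _ /=.
    by rewrite big_nil mxE.
  under eq_Rintegral do rewrite big_nil.
  by rewrite Rintegral_cst// mul0r big_nil.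
split.
  have := integrable_EFinD mD (fi a) IH1.
  by apply: eq_integrable => // w _ /=; rewrite big_cons.
rewrite big_cons -IH2 -RintegralD//.
by apply: eq_Rintegral => w _; rewrite big_cons.
Qed.

Lemma mx_integrable_mull p q r (A : 'M[R]_(r, p)) (X : T -> 'M[R]_(p, q)) :
  mx_integrable X -> mx_integrable (fun w => A *m X w).
Proof.
move=> iX i j.
have [H _] := integrable_Rsum (fun k => integrable_EFinZ (A i k) mD (iX k j)).
by apply: eq_integrable H => // w _ /=; rewrite mxE.
Qed.

Lemma mx_integrable_tr p q (X : T -> 'M[R]_(p, q)) : mx_integrable X -> mx_integrable (fun w => (X w)^T).
Proof.
by move=> iX i j; apply: eq_integrable (iX j i) => // w _ /=; rewrite mxE.
Qed.

Lemma mx_integrable_mulr p q r (A : 'M[R]_(q, r)) (X : T -> 'M[R]_(p, q)) :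
  mx_integrable X -> mx_integrable (fun w => X w *m A).
Proof.
move=> /mx_integrable_tr /(mx_integrable_mull A^T) /mx_integrable_tr iX i j.
by apply: eq_integrable (iX i j) => // w _ /=; rewrite trmx_mul !trmxK.
Qed.

Lemma cexp_cst p q (A : 'M[R]_(p, q)) : cexp P D (fun=> A) = A.
Proof.
apply/matrixP => i j; rewrite mxE Rintegral_cst// mulfK// gt_eqF// fine_gt0// PD/=.
by rewrite (le_lt_trans (probability_le1 P mD))// ltry.
Qed.

Lemma cexpD p q (X Z : T -> 'M[R]_(p, q)) : mx_integrable X -> mx_integrable Z ->
  cexp P D (fun w => X w + Z w) = cexp P D X + cexp P D Z.
Proof.
move=> iX iZ; apply/matrixP => i j; rewrite !mxE -mulrDl; congr (_ / _).
rewrite -(RintegralD mD (iX i j) (iZ i j)).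
by apply: eq_Rintegral => w _; rewrite mxE.
Qed.

Lemma cexp_tr p q (X : T -> 'M[R]_(p, q)) : cexp P D (fun w => (X w)^T) = (cexp P D X)^T.
Proof.
apply/matrixP => i j; rewrite !mxE; congr (_ / _).
by apply: eq_Rintegral => w _; rewrite mxE.
Qed.

Lemma cexp_mull p q r (A : 'M[R]_(r, p)) (X : T -> 'M[R]_(p, q)) : mx_integrable X ->
  cexp P D (fun w => A *m X w) = A *m cexp P D X.
Proof.
move=> iX; apply/matrixP => i j; rewrite !mxE.
have [_ H] := integrable_Rsum (fun k => integrable_EFinZ (A i k) mD (iX k j)).
have -> : \int[P]_(w in D) (A *m X w) i j = \int[P]_(w in D) (\sum_k A i k * X w k j).
  by apply: eq_Rintegral => w _; rewrite mxE.
rewrite H mulr_suml; apply: eq_bigr => k _.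
by rewrite (RintegralZl _ mD (iX k j)) mxE mulrA.
Qed.

Lemma cexp_mulr p q r (A : 'M[R]_(q, r)) (X : T -> 'M[R]_(p, q)) : mx_integrable X ->
  cexp P D (fun w => X w *m A) = cexp P D X *m A.
Proof.
move=> iX; have := cexp_mull A^T (mx_integrable_tr iX).
rewrite cexp_tr => /(congr1 trmx); rewrite trmx_mul !trmxK => <-.
rewrite -cexp_tr; congr (cexp _ _ _); apply/funext => w.
by rewrite trmx_mul !trmxK.
Qed.

Section affine.
Variables (n : nat) (S : 'M[R]_n) (mu : 'cV[R]_n) (W : T -> 'cV[R]_n).
Hypothesis St : S^T = S.
Hypothesis iW : mx_integrable W.
Hypothesis iWW : mx_integrable (fun w => W w *m (W w)^T).

Lemma cexp_affine : cexp P D (fun w => S *m W w + mu) = mu + S *m cexp P D W.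
Proof.
by rewrite cexpD; [rewrite cexp_mull// cexp_cst addrC|exact: mx_integrable_mull|exact: mx_integrable_cst].
Qed.

(** Stated for an arbitrary translation c: c = mu gives the second moment, and
    c = - S E[W] the covariance. *)
Lemma cexp_affine2 (c : 'cV[R]_n) :
  cexp P D (fun w => (S *m W w + c) *m (S *m W w + c)^T) =
  c *m c^T + S *m cexp P D W *m c^T + c *m (cexp P D W)^T *m S
  + S *m cexp P D (fun w => W w *m (W w)^T) *m S.
Proof.
have iSW := mx_integrable_mull S iW.
have i1 := mx_integrable_cst (c *m c^T).
have i2 := mx_integrable_mulr c^T iSW.
have i3 := mx_integrable_mulr S (mx_integrable_mull c (mx_integrable_tr iW)).
have i4 := mx_integrable_mulr S (mx_integrable_mull S iWW).
have -> : (fun w => (S *m W w + c) *m (S *m W w + c)^T) =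
  (fun w => c *m c^T + S *m W w *m c^T + c *m (W w)^T *m S + S *m (W w *m (W w)^T) *m S).
  apply/funext => w; rewrite linearD/= trmx_mul St mulmxDl !mulmxDr !mulmxA.
  rewrite -addrA [RHS]addrC; congr (_ + _).
  by rewrite addrA -[RHS]addrA [RHS]addrC.
rewrite (cexpD (mx_integrableD (mx_integrableD i1 i2) i3) i4) (cexpD (mx_integrableD i1 i2) i3) (cexpD i1 i2).
rewrite cexp_cst (cexp_mulr _ iSW) cexp_mull//.
rewrite (cexp_mulr _ (mx_integrable_mull c (mx_integrable_tr iW))) (cexp_mull _ (mx_integrable_tr iW)) cexp_tr.
by rewrite (cexp_mulr _ (mx_integrable_mull S iWW)) (cexp_mull _ iWW).
Qed.

Lemma cexp_affine_cov : let m := cexp P D (fun w => S *m W w + mu) in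
  cexp P D (fun w => (S *m W w + mu - m) *m (S *m W w + mu - m)^T) =
  S *m (cexp P D (fun w => W w *m (W w)^T) - cexp P D W *m (cexp P D W)^T) *m S.
Proof.
move=> m; rewrite /m cexp_affine; set e := cexp P D W.
have -> : (fun w => (S *m W w + mu - (mu + S *m e)) *m (S *m W w + mu - (mu + S *m e))^T) =
  (fun w => (S *m W w + - (S *m e)) *m (S *m W w + - (S *m e))^T).
  by apply/funext => w; rewrite opprD addrA addrK.
rewrite cexp_affine2 -/e.
have -> : (- (S *m e))^T = - (e^T *m S) by rewrite raddfN/= trmx_mul St.
rewrite !mulNmx !mulmxN opprK mulmxBr mulmxBl !mulmxA.
by rewrite subrr add0r addrC.
Qed.

End affine.

End conditional_expectation.

(** * Normalized face and corner integrals *)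

Section normalized_integrals.
Context {R : realType}.
Notation leb n := (lebesgue_Rn R n).
Variables (m : nat) (u v gam : 'cV[R]_m.+2).

Let sq0 (x : R) : 0 <= x ^+ 2 / 2. Proof. by rewrite divr_ge0// sqr_ge0. Qed.

Lemma cs1_neq0 n (x : R) : cs1 n x != 0.
Proof. by rewrite /cs1 invr_eq0 gt_eqF// Gbar_mass_gt0. Qed.

Lemma css1_neq0 n (x : R) : css1 n x != 0.
Proof. by rewrite /css1 invr_eq0 gt_eqF// GGbar_mass_gt0. Qed.

Lemma css2_neq0 n (x y : R) : css2 n x y != 0.
Proof.
rewrite /css2 invr_eq0; under eq_Rintegral do rewrite -addrA.
by rewrite gt_eqF// GGbar_mass_gt0// addr_ge0.
Qed.

(** Fixing a coordinate preserves admissibility; applied to a face, it makes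
    the corner integrals converge. *)
Lemma admissible_slice n (a b : 'cV[R]_n.+1) (k : 'I_n.+1) x f :
  a k 0 <= x <= b k 0 -> admissible a b f ->
  admissible (row' k a) (row' k b) (fun z => f (ins1 k x (tupc z))).
Proof.
move=> xab [mf [M fM]]; split.
  apply: (@measurable_comp_colv _ _ _ _ _ _ (fun w : Rn R n => ins1 k x (tupc (colv w)))) mf => i.
  apply: measurable_ins1; first exact: measurable_cst.
  by rewrite (_ : (fun _ => _) = id)//; apply/funext => w; rewrite colvK.
exists M => z zB; apply: fM => i.
case: (unliftP k i) => [j ->|->]; last by rewrite ins1_same.
by rewrite ins1_other tupcK -!row1E; exact: zB.
Qed.

Section with_profile.
Variables (G h : R -> R).
Hypothesis aGh : admissible u v (fun z => profile G h gam z).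

Lemma face_integralZ k x kappa : u k 0 <= x <= v k 0 ->
  \int[leb m.+1]_(w in box1 u v k) (h (dot gam (ins1 k x w)) *
     (kappa * G (dot (colv w) (colv w) / 2 + x ^+ 2 / 2))) =
  kappa * face_integral u v gam G h k x.
Proof.
move=> xuv; have H := admissible_face xuv aGh.
have mB := measurable_box1 u v k.
rewrite /face_integral -RintegralZl//.
  by apply: eq_Rintegral => w _; rewrite mulrCA.
by apply: eq_integrable H => // w _ /=; rewrite face_profile.
Qed.

Lemma corner_integralZ k l x y kappa : k != l -> u k 0 <= x <= v k 0 ->
  u l 0 <= y <= v l 0 ->
  \int[leb m]_(w in box2 u v k l) (h (dot gam (ins2 k l x y w)) *
     (kappa * G (dot (colv w) (colv w) / 2 + x ^+ 2 / 2 + y ^+ 2 / 2))) =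
  kappa * corner_integral u v gam G h k l x y.
Proof.
case: (unliftP k l) => [j ->|->]; last by rewrite eqxx.
move=> _ xuv yuv; have H0 := admissible_slice xuv aGh.
have yuv' : row' k u j 0 <= y <= row' k v j 0 by rewrite !row1E.
have H := admissible_face yuv' H0.
have mB := measurable_box1 (row' k u) (row' k v) j.
rewrite /corner_integral box2E -RintegralZl//.
  by apply: eq_Rintegral => w _; rewrite mulrCA.
apply: eq_integrable H => // w _ /=.
rewrite -ins2E /profile ins2E sqnorm_ins1 tupcK sqnorm_ins1 mulrC.
by congr (_ * G _)%:E; ring.
Qed.

End with_profile.

Lemma box_integralZ (G h : R -> R) kappa :
  (leb m.+2).-integrable (colv @^-1` box u v) (EFin \o (fun w => profile G h gam (colv w))) ->
  \int[leb m.+2]_(w in colv @^-1` box u v)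
    (h (dot gam (colv w)) * (kappa * G (dot (colv w) (colv w) / 2))) =
  kappa * \int[leb m.+2]_(w in colv @^-1` box u v) profile G h gam (colv w).
Proof.
move=> H; have mB := measurable_box u v.
rewrite -RintegralZl//; apply: eq_Rintegral => w _.
by rewrite mulrCA /profile (mulrC (h _)).
Qed.

End normalized_integrals.

(** * Boxes under a diagonal scale matrix *)

Section posdef_facts.
Context {R : realType}.

Lemma posdef1 n : posdef (1%:M : 'M[R]_n).
Proof. by split=> [|x x0]; rewrite ?trmx1// mul1mx sqnorm_gt0. Qed.

Lemma posdef_diag_gt0 n (S : 'M[R]_n) i : posdef S -> 0 < S i i.
Proof.
move=> [_ /(_ (delta_mx i 0))].
have d0 : (delta_mx i 0 : 'cV[R]_n) != 0.
  by apply/eqP => /matrixP/(_ i 0); rewrite !mxE !eqxx; apply/eqP/oner_neq0.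
move=> /(_ d0); rewrite dotE (bigD1 i)//= big1 ?addr0; last first.
  by move=> j ji; rewrite mxE (negbTE ji) mul0r.
rewrite mxE !eqxx mul1r mxE (bigD1 i)//= big1 ?addr0 ?mxE ?eqxx ?mulr1//.
by move=> j ji; rewrite mxE (negbTE ji) mulr0.
Qed.

(** Let Q be the diagonal root of Sigma.  As S commutes with S^2 = Sigma, it
    commutes with Q, whence (S + Q) (S - Q) = S^2 - Q^2 = 0; and S + Q is
    positive definite, so S = Q. *)
Lemma posdef_sqrt_diag n (Sigma S : 'M[R]_n) :
  posdef S -> S *m S = Sigma -> is_diag_mx Sigma -> is_diag_mx S.
Proof.
move=> pS SS /is_diag_mxP dS.
pose q i := Num.sqrt (Sigma i i).
have Sii i : 0 <= Sigma i i.
  rewrite -SS mxE sumr_ge0// => j _.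
  by rewrite -{2}pS.1 mxE -expr2 sqr_ge0.
have comm i j : S i j * Sigma j j = Sigma i i * S i j.
  have : (S *m Sigma) i j = (Sigma *m S) i j by rewrite -SS mulmxA.
  rewrite !mxE (bigD1 j)//= big1 ?addr0; last first.
    by move=> k kj; rewrite dS ?mulr0.
  rewrite (bigD1 i)//= big1 ?addr0// => k ki.
  by rewrite dS ?mul0r// eq_sym.
have commq i j : S i j * q j = q i * S i j.
  have [->|Sij] := eqVneq (S i j) 0; first by rewrite mul0r mulr0.
  have := comm i j; rewrite (mulrC (Sigma i i)) => /(mulfI Sij) e.
  by rewrite /q e mulrC.
pose Q : 'M[R]_n := diag_mx (\row_i q i).
have QQ : Q *m Q = Sigma.
  apply/matrixP => i j; rewrite mul_diag_mx !mxE.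
  have [->|ij] := eqVneq i j; first by rewrite mulr1n -expr2 sqr_sqrtr.
  by rewrite mulr0n mulr0 dS.
have SQ : S *m Q = Q *m S.
  by apply/matrixP => i j; rewrite mul_diag_mx mul_mx_diag !mxE commq.
have SQ0 : (S + Q) *m (S - Q) = 0.
  by rewrite mulmxBr !mulmxDl SS QQ SQ (addrC (Q *m S)) subrr.
have pSQ : posdef (S + Q).
  split; first by rewrite linearD/= pS.1 tr_diag_mx.
  move=> x x0; rewrite mulmxDl /dot mulmxDr mxE -!/(dot _ _).
  rewrite ltr_wpDr//; last exact: pS.2.
  rewrite dotE sumr_ge0// => i _; rewrite mul_diag_mx !mxE.
  by rewrite mulrCA mulr_ge0 ?sqrtr_ge0// -expr2 sqr_ge0.
have : S - Q = 0 by rewrite -[LHS](mulKmx (posdef_unitmx pSQ)) SQ0 mulmx0.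
by move/eqP; rewrite subr_eq0 => /eqP ->; exact: diag_mx_is_diag.
Qed.

(** S is diagonal with a positive diagonal, so standardizing is an increasing
    affine map in each coordinate. *)
Lemma box_diag n (Sigma S : 'M[R]_n) (mu a b y : 'cV[R]_n) :
  posdef S -> S *m S = Sigma -> is_diag_mx Sigma ->
  box a b y <-> box (standardize mu S a) (standardize mu S b) (standardize mu S y).
Proof.
move=> pS SS dS; have /is_diag_mxP dS' := posdef_sqrt_diag pS SS dS.
have uS := posdef_unitmx pS.
have E (z : 'cV[R]_n) i : z i 0 = S i i * standardize mu S z i 0 + mu i 0.
  have {1}-> : z = S *m standardize mu S z + mu by rewrite /standardize mulKVmx// subrK.
  rewrite mxE; congr (_ + _); rewrite mxE (bigD1 i)//= big1 ?addr0// => j ji.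
  by rewrite dS' ?mul0r// eq_sym.
have Si i := posdef_diag_gt0 i pS.
by split=> H i; have := H i; rewrite (E a) (E b) (E y) ltrD2r lerD2r ltr_pM2l// ler_pM2l.
Qed.

End posdef_facts.

(** * The formulas for delta and Omega *)

Section moment_formulae.
Context {R : realType}.
Notation leb n := (lebesgue_Rn R n).
Variables (m : nat) (u v gam : 'cV[R]_m.+2) (J J1 J2 : R -> R).
Hypothesis uv : forall k, u k 0 <= v k 0.
Hypothesis dJ : forall t : R, is_derive t 1 J (J1 t).
Hypothesis dJ1 : forall t : R, is_derive t 1 J1 (J2 t).

Let n := m.+2.
Let B := (@colv R n) @^-1` box u v.
Let Jg (z : 'cV[R]_n) := J (dot gam z).
Let J1g (z : 'cV[R]_n) := J1 (dot gam z).
Let J2g (z : 'cV[R]_n) := J2 (dot gam z).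

Let aG (K K' : R -> R) : (forall t : R, is_derive t 1 K (K' t)) ->
  admissible u v (fun z => profile Gbar K gam z).
Proof.
move=> dK; apply: admissibleM; last exact: (admissible_linear u v gam dK).
apply: (admissible_radial u v (M := 1)).
  exact: (@derivable_measurable R Gbar (fun t => - g t) is_derive_Gbar).
by move=> t _; have /andP[? ?] := Gbar_le1 t; rewrite ger0_norm.
Qed.

Let aGG : admissible u v (fun z => GGbar (dot z z / 2)).
Proof.
apply: (admissible_radial u v (M := 1)).
  exact: (@derivable_measurable R GGbar (fun t => - Gbar t) is_derive_GGbar).
by move=> t /GGbar_le1 /andP[? ?]; rewrite ger0_norm.
Qed.

Let aGGM (K K' : R -> R) : (forall t : R, is_derive t 1 K (K' t)) ->
  admissible u v (fun z => profile GGbar K gam z).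
Proof. by move=> dK; apply: admissibleM aGG (admissible_linear u v gam dK). Qed.

Let in_edge k x : x = u k 0 \/ x = v k 0 -> u k 0 <= x <= v k 0.
Proof. by case=> ->; rewrite lexx uv. Qed.

Lemma Es1E r k x : x = u k 0 \/ x = v k 0 ->
  r / cs1 n x * Es1 u v k x Jg = r * face_integral u v gam Gbar J k x.
Proof.
move=> /in_edge xuv; rewrite /Es1 (face_integralZ (aG dJ) _ xuv).
by rewrite mulrA divfK// cs1_neq0.
Qed.

Lemma Ess1E r k x : x = u k 0 \/ x = v k 0 ->
  r / css1 n x * Ess1 u v k x J1g = r * face_integral u v gam GGbar J1 k x.
Proof.
move=> /in_edge xuv; rewrite /Ess1 (face_integralZ (aGGM dJ1) _ xuv).
by rewrite mulrA divfK// css1_neq0.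
Qed.

Lemma Ess2E r k l x y : k != l -> x = u k 0 \/ x = v k 0 -> y = u l 0 \/ y = v l 0 ->
  r / css2 n x y * Ess2 u v k x l y Jg = r * corner_integral u v gam GGbar J k l x y.
Proof.
move=> kl /in_edge xuv /in_edge yuv.
rewrite /Ess2 (corner_integralZ (aGGM dJ) _ kl xuv yuv).
by rewrite mulrA divfK// css2_neq0.
Qed.

Let Psi1 : R := HLzeta 1 (-1) (n%:R / 2) 1.
Let Psi1' : R := HLzeta 1 (-1) (n%:R / 2 + 1) 1.
Let Psi2 : R := HLzeta 2 (-1) (n%:R / 2) 1.

Lemma EsE r : Psi1 * r / Psi2 * Es u v J1g =
  c_ n * (r * \int[leb n]_(w in B) profile Gbar J1 gam (colv w)).
Proof.
rewrite /Es (box_integralZ _ (admissible_integrable (aG dJ1))).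
rewrite -(@cs_ratio R n)// -/Psi1 -/Psi2 /B.
set I := \int[_]_(_ in _) _; set q := Psi2^-1.
by clearbody I q Psi1 Psi1' Psi2; ring.
Qed.

Lemma EssE r : (leb n).-integrable B (EFin \o (fun w => J2g (colv w))) ->
  Psi1' * r / Psi2 * Ess u v J2g =
  c_ n * (r * \int[leb n]_(w in B) profile GGbar J2 gam (colv w)).
Proof.
move=> iJ2; rewrite /Ess (box_integralZ _ (admissible_integrableM aGG iJ2)).
rewrite -(@css_ratio R n)// -/Psi1' -/Psi2 /B.
set I := \int[_]_(_ in _) _; set q := Psi2^-1.
by clearbody I q Psi1 Psi1' Psi2; ring.
Qed.

(** The normalizing constants of the face densities cancel, and [cs_ratio]
    turns the constant of E* into c_n; what remains is [first_moment]. *)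
Lemma delta_moment k :
  2 * (c_ n / cs1 n (u k 0) * Es1 u v k (u k 0) Jg
    - c_ n / cs1 n (v k 0) * Es1 u v k (v k 0) Jg
    + Psi1 * gam k 0 / Psi2 * Es u v J1g) =
  2 * c_ n * \int[leb n]_(w in B) (colv w k 0 * profile g J gam (colv w)).
Proof.
rewrite /B (first_moment gam uv dJ dJ1) EsE !Es1E; [|by right|by left].
by rewrite -mulrA; congr (_ * _); rewrite mulrDr mulrBr.
Qed.

Lemma star_rect_prob d (T : measurableType d) (P : probability T R)
    (X : {RV P >-> Rn R n}) : has_density X (gslo_star_pdf gam J) ->
  rect_prob X u v =
  2 * cs_ n * \int[leb n]_(w in B) profile Gbar J gam (colv w).
Proof.
move=> hX; have mB : measurable B by exact: measurable_box.
rewrite /rect_prob -[X in P X]/(X @^-1` B) (hX _ mB).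
have H := admissible_integrable (aG dJ).
rewrite -(RintegralZl _ mB H); congr fine; apply: eq_integral => w _.
by rewrite /gslo_star_pdf /profile !mulrA.
Qed.

Hypothesis iJ2 : (leb n).-integrable B (EFin \o (fun w => J2g (colv w))).

Lemma Omega_off_moment i j : i != j ->
  2 * (
      c_ n / css2 n (u i 0) (u j 0) * Ess2 u v i (u i 0) j (u j 0) Jg
    - c_ n / css2 n (u i 0) (v j 0) * Ess2 u v i (u i 0) j (v j 0) Jg
    + c_ n * gam j 0 / css1 n (u i 0) * Ess1 u v i (u i 0) J1g
    + c_ n / css2 n (v i 0) (v j 0) * Ess2 u v i (v i 0) j (v j 0) Jg
    - c_ n / css2 n (v i 0) (u j 0) * Ess2 u v i (v i 0) j (u j 0) Jg
    - c_ n * gam j 0 / css1 n (v i 0) * Ess1 u v i (v i 0) J1g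
    + c_ n * gam i 0 / css1 n (u j 0) * Ess1 u v j (u j 0) J1g
    - c_ n * gam i 0 / css1 n (v j 0) * Ess1 u v j (v j 0) J1g
    + Psi1' * gam i 0 * gam j 0 / Psi2 * Ess u v J2g) =
  2 * c_ n * \int[leb n]_(w in B) (colv w j 0 * (colv w i 0 * profile g J gam (colv w))).
Proof.
move=> ij; rewrite /B (second_moment_off uv dJ dJ1 iJ2 ij) -(mulrA Psi1').
set I := \int[_]_(_ in _) _.
(* the nine terms are rewritten one by one, each with its own constant *)
have sum_eq (a1 a2 a3 a4 a5 a6 a7 a8 a9 b1 b2 b3 b4 b5 b6 b7 b8 b9 : R) :
    a1 = b1 -> a2 = b2 -> a3 = b3 -> a4 = b4 -> a5 = b5 -> a6 = b6 -> a7 = b7 ->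
    a8 = b8 -> a9 = b9 ->
    2 * (a1 - a2 + a3 + a4 - a5 - a6 + a7 - a8 + a9) =
    2 * (b1 - b2 + b3 + b4 - b5 - b6 + b7 - b8 + b9).
  by do 9 move=> ->.
have [au av] : (forall k, u k 0 = u k 0 \/ u k 0 = v k 0) /\
               (forall k, v k 0 = u k 0 \/ v k 0 = v k 0).
  by split=> k; [left|right].
refine (etrans (sum_eq _ _ _ _ _ _ _ _ _ _ _ _ _ _ _ _ _ _
  (Ess2E (c_ n) ij (au i) (au j)) (Ess2E (c_ n) ij (au i) (av j))
  (Ess1E (c_ n * gam j 0) (au i))
  (Ess2E (c_ n) ij (av i) (av j)) (Ess2E (c_ n) ij (av i) (au j))
  (Ess1E (c_ n * gam j 0) (av i))
  (Ess1E (c_ n * gam i 0) (au j)) (Ess1E (c_ n * gam i 0) (av j))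
  (EssE (gam i 0 * gam j 0) iJ2)) _).
set C := corner_integral u v gam GGbar J i j.
set F := face_integral u v gam GGbar J1.
rewrite -/I; move: C F I (c_ n) => C F I c.
clear.
ring.
Qed.

Lemma Omega_diag_moment i (q : R) :
  q = 2 * cs_ n * \int[leb n]_(w in B) profile Gbar J gam (colv w) ->
  2 * (
      c_ n * u i 0 / cs1 n (u i 0) * Es1 u v i (u i 0) Jg
    - c_ n * v i 0 / cs1 n (v i 0) * Es1 u v i (v i 0) Jg
    + c_ n * gam i 0 / css1 n (u i 0) * Ess1 u v i (u i 0) J1g
    - c_ n * gam i 0 / css1 n (v i 0) * Ess1 u v i (v i 0) J1g
    + Psi1' * gam i 0 ^+ 2 / Psi2 * Ess u v J2g)
    + Psi1 / Psi2 * q =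
  2 * c_ n * \int[leb n]_(w in B) (colv w i 0 * (colv w i 0 * profile g J gam (colv w))).
Proof.
move=> ->; rewrite /B (second_moment_diag uv dJ dJ1 iJ2).
set I := \int[_]_(_ in _) profile GGbar _ _ _.
set I0 := \int[_]_(_ in _) profile Gbar _ _ _.
have E0 : Psi1 / Psi2 * (2 * cs_ n * I0) = 2 * c_ n * I0.
  rewrite -(@cs_ratio R n)// -/Psi1 -/Psi2 mulrA; congr (_ * _).
  by rewrite mulrCA.
have sum_eq (a1 a2 a3 a4 a5 a6 b1 b2 b3 b4 b5 b6 : R) :
    a1 = b1 -> a2 = b2 -> a3 = b3 -> a4 = b4 -> a5 = b5 -> a6 = b6 ->
    2 * (a1 - a2 + a3 - a4 + a5) + a6 = 2 * (b1 - b2 + b3 - b4 + b5) + b6.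
  by do 6 move=> ->.
have [au av] : (u i 0 = u i 0 \/ u i 0 = v i 0) /\ (v i 0 = u i 0 \/ v i 0 = v i 0).
  by split; [left|right].
refine (etrans (sum_eq _ _ _ _ _ _ _ _ _ _ _ _
  (Es1E (c_ n * u i 0) au) (Es1E (c_ n * v i 0) av)
  (Ess1E (c_ n * gam i 0) au) (Ess1E (c_ n * gam i 0) av)
  (EssE (gam i 0 ^+ 2) iJ2) E0) _).
set C := face_integral u v gam Gbar J i.
set F := face_integral u v gam GGbar J1 i.
clear E0.
rewrite -/I; move: C F I I0 (c_ n) => C F I I0 c.
ring.
Qed.

End moment_formulae.

(** * Moments of the truncated vector *)

Section truncated_law.
Context {R : realType}.
Notation leb n := (lebesgue_Rn R n).
Variables (n : nat) (gamma : 'cV[R]_n) (J J1 : R -> R).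
Hypothesis n0 : (0 < n)%N.
Hypothesis hJ : skewing J.
Hypothesis dJ : forall t : R, is_derive t 1 J (J1 t).
Variables (mu : 'cV[R]_n) (Sigma S : 'M[R]_n).
Hypothesis pS : posdef S.
Hypothesis SS : S *m S = Sigma.
Variables (d : measure_display) (T : measurableType d) (P : probability T R).
Variable Y : {RV P >-> Rn R n}.
Hypothesis hY : has_density Y (gslo_pdf mu Sigma S gamma J).
Variables u v : 'cV[R]_n.

Let W w := standardize mu S (colv (Y w)).
Let D := [set w | box u v (W w)].
Let B := (@colv R n) @^-1` box u v.

Lemma truncation_order : (0 < P D)%E -> forall k, u k 0 <= v k 0.
Proof.
move=> PD k; have D0 : D != set0 by apply: contraTneq PD => ->; rewrite measure0 ltxx.
have /set0P[w Dw] := D0.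
by have /andP[/ltW uW Wv] := Dw k; exact: le_trans uW Wv.
Qed.

Lemma cexp_standardized_mean k : cexp P D W k 0 =
  (fine (P D))^-1 *
  (2 * c_ n * \int[leb n]_(z in B) (colv z k 0 * profile g J gamma (colv z))).
Proof.
by rewrite mxE mulrC -(standardized_moment n0 hJ dJ pS SS hY (admissible_coord u v k)).
Qed.

Lemma cexp_standardized_moment2 i j : cexp P D (fun w => W w *m (W w)^T) i j =
  (fine (P D))^-1 *
  (2 * c_ n * \int[leb n]_(z in B)
     (colv z j 0 * (colv z i 0 * profile g J gamma (colv z)))).
Proof.
rewrite mxE mulrC; congr (_ * _).
have := standardized_moment n0 hJ dJ pS SS hY
  (admissibleM (admissible_coord u v j) (admissible_coord u v i)).
under [in X in _ = X -> _]eq_Rintegral do rewrite -mulrA.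
move=> <-; apply: eq_Rintegral => w _.
by rewrite mxE big_ord1 [X in _ * X]mxE mulrC.
Qed.

Lemma mx_integrable_standardized : mx_integrable P D W.
Proof.
move=> i j; rewrite ord1.
exact: (standardized_integrable mu S Y (admissible_coord u v i)).
Qed.

Lemma mx_integrable_standardized2 : mx_integrable P D (fun w => W w *m (W w)^T).
Proof.
move=> i j; have := standardized_integrable mu S Y
  (admissibleM (admissible_coord u v i) (admissible_coord u v j)).
apply: eq_integrable => [|w _ /=]; first exact: measurable_truncation.
by congr EFin; rewrite [RHS]mxE big_ord1; congr (_ * _); rewrite [RHS]mxE.
Qed.

End truncated_law.

Theorem corollary3 (R : realType) (n : nat) (hn : (2 <= n)%N)
  (mu : 'cV[R]_n) (Sigma S : 'M[R]_n)
  (hSigma : posdef Sigma) (hS : posdef S) (hSS : S *m S = Sigma)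
  (gamma : 'cV[R]_n) (J : R -> R)
  (hJ : skewing J) (hJ2 : twice_differentiable J)
  (dY dZ dZs : measure_display)
  (TY : measurableType dY) (TZ : measurableType dZ) (TZs : measurableType dZs)
  (P : probability TY R) (PZ : probability TZ R) (PZs : probability TZs R)
  (Y : {RV P >-> Rn R n}) (Z : {RV PZ >-> Rn R n}) (Zs : {RV PZs >-> Rn R n})
  (hY : has_density Y (gslo_pdf mu Sigma S gamma J))
  (hZ : has_density Z (gslo_pdf 0 1%:M 1%:M gamma J))
  (hZs : has_density Zs (gslo_star_pdf gamma J))
  (a b : 'cV[R]_n) (hab : forall i, a i 0 < b i 0)
  (xi : 'cV[R]_n -> 'cV[R]_n)
  (hxi : forall v, xi v = invmx S *m (v - mu))
  (Jg J1g J2g : 'cV[R]_n -> R)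
  (hJg : forall z, Jg z = J (dot gamma z))
  (hJ1g : forall z, J1g z = derive1 J (dot gamma z))
  (hJ2g : forall z, J2g z = derive1 (derive1 J) (dot gamma z))
  (Psi1 Psi1' Psi2 : R)
  (hPsi1 : Psi1 = HLzeta 1 (-1) (n%:R / 2) 1)
  (hPsi1' : Psi1' = HLzeta 1 (-1) (n%:R / 2 + 1) 1)
  (hPsi2 : Psi2 = HLzeta 2 (-1) (n%:R / 2) 1)
  (c F : R) (hc : c = c_ n) (hF : F = rect_prob Z (xi a) (xi b))
  (A B : 'I_n -> R)
  (hA : forall k, A k = xi a k 0) (hB : forall k, B k = xi b k 0)
  (delta : 'cV[R]_n)
  (hdelta : forall k, delta k 0 = 2 * (
      c / cs1 n (A k) * Es1 (xi a) (xi b) k (A k) Jg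
    - c / cs1 n (B k) * Es1 (xi a) (xi b) k (B k) Jg
    + Psi1 * gamma k 0 / Psi2 * Es (xi a) (xi b) J1g))
  (Omega : 'M[R]_n)
  (hOmega : forall i j, i != j -> Omega i j = 2 * (
      c / css2 n (A i) (A j) * Ess2 (xi a) (xi b) i (A i) j (A j) Jg
    - c / css2 n (A i) (B j) * Ess2 (xi a) (xi b) i (A i) j (B j) Jg
    + c * gamma j 0 / css1 n (A i) * Ess1 (xi a) (xi b) i (A i) J1g
    + c / css2 n (B i) (B j) * Ess2 (xi a) (xi b) i (B i) j (B j) Jg
    - c / css2 n (B i) (A j) * Ess2 (xi a) (xi b) i (B i) j (A j) Jg
    - c * gamma j 0 / css1 n (B i) * Ess1 (xi a) (xi b) i (B i) J1g
    + c * gamma i 0 / css1 n (A j) * Ess1 (xi a) (xi b) j (A j) J1g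
    - c * gamma i 0 / css1 n (B j) * Ess1 (xi a) (xi b) j (B j) J1g
    + Psi1' * gamma i 0 * gamma j 0 / Psi2 * Ess (xi a) (xi b) J2g))
  (hOmegad : forall i, Omega i i = 2 * (
      c * A i / cs1 n (A i) * Es1 (xi a) (xi b) i (A i) Jg
    - c * B i / cs1 n (B i) * Es1 (xi a) (xi b) i (B i) Jg
    + c * gamma i 0 / css1 n (A i) * Ess1 (xi a) (xi b) i (A i) J1g
    - c * gamma i 0 / css1 n (B i) * Ess1 (xi a) (xi b) i (B i) J1g
    + Psi1' * gamma i 0 ^+ 2 / Psi2 * Ess (xi a) (xi b) J2g)
    + Psi1 / Psi2 * rect_prob Zs (xi a) (xi b)) :
  (* truncated moments given the truncation event D *)
  (forall D : set TY,
     D = [set w | box (xi a) (xi b) (xi (colv (Y w)))] \/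
     (is_diag_mx Sigma /\ D = [set w | box a b (colv (Y w))]) ->
     (0 < P D)%E ->
     let m := cexp P D (fun w => colv (Y w)) in
     m = mu + F^-1 *: (S *m delta) /\
     ((* the integral E**[J''_gamma] exists *)
      (lebesgue_Rn R n).-integrable (colv @^-1` box (xi a) (xi b))
        (fun w => (J2g (colv w))%:E) ->
      cexp P D (fun w => colv (Y w) *m (colv (Y w))^T) =
        mu *m mu^T + F^-1 *: (S *m delta *m mu^T)
        + F^-1 *: (mu *m delta^T *m S) + F^-1 *: (S *m Omega *m S)
      /\
      cexp P D (fun w => (colv (Y w) - m) *m (colv (Y w) - m)^T) =
        S *m (F^-1 *: Omega - (F ^+ 2)^-1 *: (delta *m delta^T)) *m S))
  /\
  (forall (s t : 'cV[R]_n) (k l : 'I_n),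
     s = a \/ s = b -> t = a \/ t = b -> k != l ->
     let x := xi s k 0 in let y := xi t l 0 in
     [/\ c / cs1 n x =
           HLzeta 1 (- expR (- (x ^+ 2 / 2))) ((n%:R - 1) / 2) 1 * phi x / Psi2,
         c / css1 n x =
           (\int[@lebesgue_measure R]_(r in `]0, +oo[)
              (r `^ ((n%:R - 3) / 2) *
               ln (1 + expR (- (x ^+ 2 / 2)) * expR (- r))))
           / (Gamma ((n%:R - 1) / 2) * Num.sqrt (2 * pi) * Psi2)
       & (3 <= n)%N ->
         c / css2 n x y =
           (\int[@lebesgue_measure R]_(r in `]0, +oo[)
              (r `^ ((n%:R - 4) / 2) *
               ln (1 + expR (- (x ^+ 2 / 2) - y ^+ 2 / 2) * expR (- r))))
           / (2 * Gamma ((n%:R - 2) / 2) * pi * Psi2)]).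
Proof.
have dJ (t : R) : is_derive t 1 J (derive1 J t).
  by apply: DeriveDef; [exact: hJ2.1|rewrite derive1E].
have dJ1 (t : R) : is_derive t 1 (derive1 J) (derive1 (derive1 J) t).
  by apply: DeriveDef; [exact: hJ2.2|rewrite [RHS]derive1E].
have xiE : xi = standardize mu S by apply/funext => y; rewrite hxi.
have AE : A = (fun k => xi a k 0) by apply/funext.
have BE : B = (fun k => xi b k 0) by apply/funext.
have JgE : Jg = (fun z => J (dot gamma z)) by apply/funext.
have J1gE : J1g = (fun z => derive1 J (dot gamma z)) by apply/funext.
have J2gE : J2g = (fun z => derive1 (derive1 J) (dot gamma z)) by apply/funext.
clear hxi hA hB hJg hJ1g hJ2g.
subst xi A B Jg J1g J2g c Psi1 Psi1' Psi2.
split; last first.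
  move=> s t k l _ _ _ x y; split=> [||n3].
  - exact: cs1_formula.
  - exact: css1_formula.
  - exact: css2_formula.
destruct n as [|[|m]] => //.
have n0 : (0 < m.+2)%N by [].
have uS := posdef_unitmx hS.
set u := standardize mu S a in hF hdelta hOmega hOmegad *.
set v := standardize mu S b in hF hdelta hOmega hOmegad *.
move=> D DE.
(* both descriptions of D truncate the standardized vector to the box *)
have {DE}-> : D = [set w | box u v (standardize mu S (colv (Y w)))].
  case: DE => [//|[dS ->]]; apply/seteqP.
  by split=> w /= H; have [] := box_diag mu a b (colv (Y w)) hS hSS dS; [move=> /(_ H)|move=> _ /(_ H)].
move=> PD mm.
have uv := truncation_order PD.
(* Y and Z have the same law once they are standardized *)
have FE : fine (P [set w | box u v (standardize mu S (colv (Y w)))]) = F.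
  rewrite hF /rect_prob (truncation_probability n0 hJ dJ hS hSS hY).
  have := truncation_probability n0 hJ dJ (@posdef1 R m.+2) (mulmx1 1%:M) hZ u v.
  rewrite (_ : [set w | _] = [set w | box u v (colv (Z w))]) => [->//|].
  by apply/seteqP; split => w /=; rewrite /standardize invmx1 mul1mx subr0.
have YE : (fun w => colv (Y w)) = (fun w => S *m standardize mu S (colv (Y w)) + mu).
  by apply/funext => w; rewrite /standardize mulKVmx// subrK.
have meanE : cexp P [set w | box u v (standardize mu S (colv (Y w)))]
    (fun w => standardize mu S (colv (Y w))) = F^-1 *: delta.
  apply/colP => k; rewrite (cexp_standardized_mean n0 hJ dJ hS hSS hY) FE.
  by rewrite [RHS]mxE hdelta (delta_moment gamma uv dJ dJ1).
have mD := measurable_truncation mu S Y u v.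
have iW := mx_integrable_standardized mu S Y u v.
have iWW := mx_integrable_standardized2 mu S Y u v.
have mE : mm = mu + F^-1 *: (S *m delta).
  by rewrite /mm YE (cexp_affine mD PD) // meanE -scalemxAr.
split => // iJ2.
have ZsE := star_rect_prob u v dJ hZs.
have momE : cexp P [set w | box u v (standardize mu S (colv (Y w)))]
    (fun w => standardize mu S (colv (Y w)) *m (standardize mu S (colv (Y w)))^T)
    = F^-1 *: Omega.
  apply/matrixP => i j; rewrite (cexp_standardized_moment2 n0 hJ dJ hS hSS hY) FE.
  rewrite [RHS]mxE; congr (_ * _); have [->|ij] := eqVneq i j.
    by rewrite hOmegad (Omega_diag_moment uv dJ dJ1 iJ2 _ ZsE).
  by rewrite (hOmega _ _ ij) (Omega_off_moment uv dJ dJ1 iJ2 ij).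
have deltaT : (F^-1 *: delta)^T = F^-1 *: delta^T by apply/matrixP => i j; rewrite !mxE.
split.
  rewrite (_ : (fun w => _) = (fun w =>
     (S *m standardize mu S (colv (Y w)) + mu) *m
     (S *m standardize mu S (colv (Y w)) + mu)^T)); last first.
    by apply/funext => w; rewrite /standardize mulKVmx// subrK.
  rewrite (cexp_affine2 mD PD hS.1 iW iWW) meanE momE.
  by rewrite deltaT -!scalemxAr -!scalemxAl.
have covE := cexp_affine_cov mD PD mu hS.1 iW iWW.
rewrite meanE momE in covE.
rewrite (_ : (fun w => _) = (fun w =>
   (S *m standardize mu S (colv (Y w)) + mu - mm) *m
   (S *m standardize mu S (colv (Y w)) + mu - mm)^T)); last first.
  by apply/funext => w; rewrite /standardize mulKVmx// subrK.
rewrite {1 2}/mm YE covE deltaT -scalemxAr -scalemxAl scalerA.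
by rewrite expr2 invfM.
Qed.
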